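(* Let $R=L=2$, let $q\in(0,1)$ and $p=1-q$ (so that $\alpha=\frac12$), and let $(X_n)_{n\ge0}$ be the site-based feedback random walk with parameters $p,q,R,L$ and initial environment $\omega$. In the negative feedback case, $q>\frac12$, assume also that $\omega$ is constant in a neighborhood of $+\infty$ and constant in a neighborhood of $-\infty$. Let $q_1^*=\frac{\sqrt{13}-3}{2}\approx0.303$ and let $q_2^*\approx0.682$ be the unique root in $(0,1)$ of $q^3+q-1$. (i) Let $q<q_1^*$. (a) If $\omega(x)=(p,0)$ for all $x$ in a neighborhood of $+\infty$ and $\omega(x)\ne(q,0)$ for all $x$ in a neighborhood of $-\infty$, then $(X_n)$ is $\mathbb{P}_\omega$-a.s. transient to $+\infty$. (b) If $\omega(x)=(q,0)$ for all $x$ in a neighborhood of $-\infty$ and $\omega(x)\ne(p,0)$ for all $x$ in a neighborhood of $+\infty$, then $(X_n)$ is $\mathbb{P}_\omega$-a.s. transient to $-\infty$. (c) If $\omega(x)\ne(p,0)$ for all $x$ in a neighborhood of $+\infty$ and $\omega(x)\ne(q,0)$ for all $x$ in a neighborhood of $-\infty$, then $(X_n)$ is $\mathbb{P}_\omega$-a.s. recurrent. (d) If $\omega(x)=(p,0)$ for all $x$ in a neighborhood of $+\infty$ and $\omega(x)=(q,0)$ for all $x$ in a neighborhood of $-\infty$, then $\mathbb{P}_\omega(X_n\to+\infty)=1-\mathbb{P}_\omega(X_n\to-\infty)\in(0,1)$. (ii) Let $q>q_2^*$. (a) If $\omega(x)=(q,0)$ for all $x$ in a neighborhood of $+\infty$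 and $\omega(x)\ne(p,0)$ for all $x$ in a neighborhood of $-\infty$, then $(X_n)$ is $\mathbb{P}_\omega$-a.s. transient to $+\infty$. (b) If $\omega(x)=(p,0)$ for all $x$ in a neighborhood of $-\infty$ and $\omega(x)\ne(q,0)$ for all $x$ in a neighborhood of $+\infty$, then $(X_n)$ is $\mathbb{P}_\omega$-a.s. transient to $-\infty$. (c) If $\omega(x)\ne(q,0)$ for all $x$ in a neighborhood of $+\infty$ and $\omega(x)\ne(p,0)$ for all $x$ in a neighborhood of $-\infty$, then $(X_n)$ is $\mathbb{P}_\omega$-a.s. recurrent. (d) If $\omega(x)=(q,0)$ for all $x$ in a neighborhood of $+\infty$ and $\omega(x)=(p,0)$ for all $x$ in a neighborhood of $-\infty$, then $\mathbb{P}_\omega(X_n\to+\infty)=1-\mathbb{P}_\omega(X_n\to-\infty)\in(0,1)$. (iii) Let $q\in[q_1^*,q_2^*]$. Then $(X_n)$ is $\mathbb{P}_\omega$-a.s. recurrent.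
   Context: Model (site-based feedback random walk). Fix $p,q\in(0,1)$ and $R,L\in\mathbb{N}=\{1,2,\dots\}$. The set of single site configurations is $\Lambda=\Lambda_p\cup\Lambda_q$, where $\Lambda_p=\{(p,0),\dots,(p,L-1)\}$ and $\Lambda_q=\{(q,0),\dots,(q,R-1)\}$ (formal labels, $\Lambda_p$ and $\Lambda_q$ being regarded as disjoint). An environment is an element $\omega=\{\omega(x)\}_{x\in\mathbb{Z}}\in\Lambda^{\mathbb{Z}}$. The pair $(X_n,\omega_n)_{n\ge0}$ is a Markov process with $X_n\in\mathbb{Z}$, $\omega_n\in\Lambda^{\mathbb{Z}}$ and $\omega_0=\omega$ (the initial environment). Jump rule: if $\omega_n(X_n)\in\Lambda_p$ then $X_{n+1}=X_n+1$ with probability $p$ and $X_{n+1}=X_n-1$ with probability $1-p$; if $\omega_n(X_n)\in\Lambda_q$ then $X_{n+1}=X_n+1$ with probability $q$ and $X_{n+1}=X_n-1$ with probability $1-q$. Environment update: $\omega_{n+1}(x)=\omega_n(x)$ for all $x\ne X_n$, and at the site $X_n$: - if $\omega_n(X_n)\in\Lambda_p\cup\{(q,R-1)\}$ and $X_{n+1}=X_n+1$, then $\omega_{n+1}(X_n)=(p,0)$; - if $\omega_n(X_n)=(q,i)$, $0\le i\le R-2$, and $X_{n+1}=X_n+1$, then $\omega_{n+1}(X_n)=(q,i+1)$; - if $\omega_n(X_n)\in\Lambda_q\cup\{(p,L-1)\}$ and $X_{n+1}=X_n-1$, then $\omega_{n+1}(X_n)=(q,0)$; - if $\omega_n(X_n)=(p,i)$,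 $0\le i\le L-2$, and $X_{n+1}=X_n-1$, then $\omega_{n+1}(X_n)=(p,i+1)$. $\mathbb{P}_{\omega}$ is the law of the process with initial environment $\omega$ and $X_0=0$. The path $(X_n)$ is recurrent if $N_0=|\{n\ge0:X_n=0\}|=\infty$, transient to $+\infty$ if $\lim_{n\to\infty}X_n=+\infty$, and transient to $-\infty$ if $\lim_{n\to\infty}X_n=-\infty$. A property holds in a neighborhood of $+\infty$ (of $-\infty$) if it holds for all sufficiently large $x$ (all sufficiently negative $x$). The quantity $\alpha$ is $$\alpha(p,q,R,L)=\frac{p\cdot\big[(1-q)q^R(1-(1-p)^L)\big]+q\cdot\big[p(1-p)^L(1-q^R)\big]}{\big[(1-q)q^R(1-(1-p)^L)\big]+\big[p(1-p)^L(1-q^R)\big]}.$$ *)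

(* Defs.v *)
From HB Require Import structures.
From mathcomp Require Import all_boot all_order all_algebra.
From mathcomp Require Import all_classical all_reals all_analysis.
From mathcomp Require Import ring lra.

Set Implicit Arguments.
Unset Strict Implicit.
Unset Printing Implicit Defensive.

Import Order.TTheory GRing.Theory Num.Theory.
Import numFieldNormedType.Exports.

Local Open Scope classical_set_scope.
Local Open Scope ring_scope.

(* [inl i] is the label (p, i), 0 <= i < L, and [inr i] is (q, i), 0 <= i < R.
   Below, L and R are successors, so that the labels (p, 0) and (q, 0) exist. *)
Definition site_config (L R : nat) : Type := ('I_L + 'I_R)%type.

Definition p0 {L R : nat} : site_config L.+1 R.+1 := inl ord0.
Definition q0 {L R : nat} : site_config L.+1 R.+1 := inr ord0.

Definition update_right {L R : nat} (c : site_config L.+1 R.+1) :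
    site_config L.+1 R.+1 :=
  match c with
  | inl _ => p0
  | inr i => if (i.+1 < R.+1)%N then inr (inord i.+1) else p0
  end.

Definition update_left {L R : nat} (c : site_config L.+1 R.+1) :
    site_config L.+1 R.+1 :=
  match c with
  | inl i => if (i.+1 < L.+1)%N then inl (inord i.+1) else q0
  | inr _ => q0
  end.

Definition environment (L R : nat) : Type := int -> site_config L R.

Definition set_site {L R : nat} (w : environment L R) (x : int)
    (c : site_config L R) : environment L R :=
  fun y => if y == x then c else w y.

Definition state (L R : nat) : Type := (int * environment L R)%type.

Definition step_right {L R : nat} (s : state L.+1 R.+1) : state L.+1 R.+1 :=
  (s.1 + 1, set_site s.2 s.1 (update_right (s.2 s.1))).

Definition step_left {L R : nat} (s : state L.+1 R.+1) : state L.+1 R.+1 :=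
  (s.1 - 1, set_site s.2 s.1 (update_left (s.2 s.1))).

Definition prob_right {K : realType} {L R : nat} (p q : K)
    (s : state L R) : K :=
  if s.2 s.1 is inl _ then p else q.

Definition coordinate_events {d : measure_display} {T : measurableType d}
    {L R : nat} (X : nat -> T -> int) (W : nat -> T -> environment L R)
    (k : nat) : set (set T) :=
  [set A | (exists x, A = [set t | X k t = x]) \/
           (exists x c, A = [set t | W k t x = c])].

(* The sigma-algebra generated by (X_k, omega_k) for k <= n. *)
Definition history {d : measure_display} {T : measurableType d}
    {L R : nat} (X : nat -> T -> int) (W : nat -> T -> environment L R)
    (n : nat) : set (set T) :=
  <<s \bigcup_(k in [set k | (k <= n)%N]) coordinate_events X W k >>.

(* (X, W) is a Markov process started from (0, w) which, given its history up
   to time n, jumps from its current state s to [step_right s] with probability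
   [prob_right p q s] and to [step_left s] with the complementary probability.
   The conditional probabilities are expressed by their defining integral
   identity over the events of the history.  These properties determine the law
   of (X, W), which is the law P_w of the walk with initial environment w. *)
Record feedback_walk {K : realType} {d : measure_display}
    {T : measurableType d} {L R : nat} (P : probability T K) (p q : K)
    (w : environment L.+1 R.+1)
    (X : nat -> T -> int) (W : nat -> T -> environment L.+1 R.+1) : Prop :=
  FeedbackWalk {
    walk_measurable : forall n, coordinate_events X W n `<=` measurable;
    walk_init : P [set t | (X 0%N t, W 0%N t) = (0, w)] = 1%E;
    walk_right : forall n A, history X W n A ->
      P (A `&` [set t | (X n.+1 t, W n.+1 t) = step_right (X n t, W n t)]) =
      (\int[P]_(t in A) (prob_right p q (X n t, W n t))%:E)%E;
    walk_left : forall n A, history X W n A ->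
      P (A `&` [set t | (X n.+1 t, W n.+1 t) = step_left (X n t, W n t)]) =
      (\int[P]_(t in A) (1 - prob_right p q (X n t, W n t))%:E)%E
  }.

Definition recurrent (x : nat -> int) : Prop := infinite_set [set n | x n = 0].

(* The path is read in the real field K, where the limits live. *)
Definition transient_pinfty (K : realType) (x : nat -> int) : Prop :=
  ((x n)%:~R : K) @[n --> \oo] --> +oo.

Definition transient_ninfty (K : realType) (x : nat -> int) : Prop :=
  ((x n)%:~R : K) @[n --> \oo] --> -oo.

Definition near_pinfty (Q : int -> Prop) : Prop :=
  exists N : int, forall x, N <= x -> Q x.

Definition near_ninfty (Q : int -> Prop) : Prop :=
  exists N : int, forall x, x <= N -> Q x.

Definition alpha {K : realType} (p q : K) (R L : nat) : K :=
  let A := (1 - q) * q ^+ R * (1 - (1 - p) ^+ L) in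
  let B := p * (1 - p) ^+ L * (1 - q ^+ R) in
  (p * A + q * B) / (A + B).

Definition q1star (K : realType) : K := (Num.sqrt 13 - 3) / 2.

Definition q2star (K : realType) : K :=
  xget 0 [set x : K | 0 < x < 1 /\ x ^+ 3 + x - 1 = 0].

Lemma q2starP (K : realType) (x : K) :
  (0 < x < 1 /\ x ^+ 3 + x - 1 = 0) <-> x = q2star K.
Proof.
have uni (a b : K) : 0 < a < 1 /\ a ^+ 3 + a - 1 = 0 ->
    0 < b < 1 /\ b ^+ 3 + b - 1 = 0 -> a = b.
  move=> [/andP[a0 a1] ea] [/andP[b0 b1] eb].
  have : (a - b) * (a ^+ 2 + a * b + b ^+ 2 + 1) = 0.
    by transitivity ((a ^+ 3 + a - 1) - (b ^+ 3 + b - 1));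
      [ring | rewrite ea eb subrr].
  move/eqP; rewrite mulf_eq0 subr_eq0 => /orP[/eqP//|/eqP h].
  have : 0 < a ^+ 2 + a * b + b ^+ 2 + 1.
    by rewrite !addr_gt0 ?exprn_gt0 ?mulr_gt0.
  by rewrite h ltxx.
have [y yP] : exists y : K, 0 < y < 1 /\ y ^+ 3 + y - 1 = 0.
  have [||y y01 /rootP] := @poly_ivt K ('X^3 + 'X - 1%:P) 0 1.
  - exact: ler01.
  - by rewrite !hornerE /=; apply/andP; split; lra.
  rewrite !hornerE => ey; exists y; split=> //.
  move: y01 => /andP[y0 y1]; rewrite !lt_neqAle y0 y1 !andbT.
  apply/andP; split; apply/eqP => e; move: ey.
    by rewrite -e => h; lra.
  by rewrite e => h; lra.
have q2P : 0 < q2star K < 1 /\ q2star K ^+ 3 + q2star K - 1 = 0.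
  exact: (@xgetI _ 0 [set x : K | 0 < x < 1 /\ x ^+ 3 + x - 1 = 0] y yP).
by split=> [xP|->//]; exact: uni.
Qed.

(* Main.v *)
Require Import Defs.
From HB Require Import structures.
From mathcomp Require Import all_boot all_order all_algebra.
From mathcomp Require Import all_classical all_reals all_analysis.
From mathcomp Require Import ring lra zify.

Import Order.TTheory GRing.Theory Num.Theory.
Import numFieldNormedType.Exports.

Local Open Scope classical_set_scope.
Local Open Scope ring_scope.

(** The numbers of jumps from x to x + 1 that the walk still makes before it
    returns to the left of a given site form, as x increases, a Markov chain: the
    next number is the number of rightward jumps made by a site before it has been
    left a prescribed number of times to the left.
    From n this chain has mean n + mu c + o(1) and variance nu n + O(1), where c is
    the initial configuration of the site, and it hits 0 exactly when the walk
    returns.  By Lamperti's dichotomy, with the Lyapunov functions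
    ln (m + 1) - a / (m + 1) and 1 / (A + ln (m + 1)), the chain dies out if
    mu c <= nu / 2 for all c that occur far away, and survives with positive
    probability if mu c > nu / 2 for the constant value c.  For p = 1 - q the sign
    of mu c - nu / 2 is that of 1 - 3 q - q ^ 2 if c = (p, 0), that of q ^ 3 + q - 1
    if c = (q, 0), and it is negative for the other two configurations.  The left
    half-line is treated by reflection. *)

(** * The jumps of a single site *)

(** Since alpha = 1/2, the drift of the spatial chain is only the bounded shift mu c, so its fate
    hangs on mu c against nu / 2. The mean must therefore be known up to O(1 / n) and the variance
    up to O(1). Both come from recursions over the number of leftward jumps of a site: up to a
    function of its configuration, the displacement is a martingale, and the moments solve linear
    recursions with small forcing terms. The spatial chain is never realised as a random process.
    Its law is encoded as a function of the current state of the walk that is harmonic for one jump,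
    and its comparison with survival up to a finite time is an induction on time. The hypotheses
    near infinity persist in every later state because a finite history changes finitely many sites.
    On the transient side, a positive chance of escape has to become an almost sure statement. What
    makes this possible is that the environment ahead of a new maximum is untouched, so the chance
    of never turning back is bounded below uniformly over all pasts. *)

Notation cfg := (site_config 2 2).

Definition p1 : cfg := inl (inord 1).
Definition q1 : cfg := inr (inord 1).

Lemma cfg_ind (Q : cfg -> Prop) :
  Q p0 -> Q p1 -> Q q0 -> Q q1 -> forall c, Q c.
Proof.
move=> hp0 hp1 hq0 hq1 [] [[|[|//]] lt_i].
- by rewrite (_ : Ordinal lt_i = ord0)//; apply/val_inj.
- by rewrite (_ : Ordinal lt_i = inord 1)//; apply/val_inj; rewrite /= inordK.
- by rewrite (_ : Ordinal lt_i = ord0)//; apply/val_inj.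
- by rewrite (_ : Ordinal lt_i = inord 1)//; apply/val_inj; rewrite /= inordK.
Qed.

Lemma update_right_p0 : update_right (p0 : cfg) = p0. Proof. by []. Qed.
Lemma update_right_p1 : update_right p1 = p0. Proof. by []. Qed.
Lemma update_right_q0 : update_right (q0 : cfg) = q1. Proof. by []. Qed.
Lemma update_right_q1 : update_right q1 = p0.
Proof. by rewrite /update_right /q1 /= inordK. Qed.
Lemma update_left_p0 : update_left (p0 : cfg) = p1. Proof. by []. Qed.
Lemma update_left_p1 : update_left p1 = q0.
Proof. by rewrite /update_left /p1 /= inordK. Qed.
Lemma update_left_q0 : update_left (q0 : cfg) = q0. Proof. by []. Qed.
Lemma update_left_q1 : update_left q1 = q0. Proof. by []. Qed.
Definition updateE := (update_right_p0, update_right_p1, update_right_q0,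
  update_right_q1, update_left_p0, update_left_p1, update_left_q0,
  update_left_q1).

Definition cfg_fun {A : Type} (a0 a1 b0 b1 : A) (c : cfg) : A :=
  match c with
  | inl i => if (i : nat) == 0%N then a0 else a1
  | inr i => if (i : nat) == 0%N then b0 else b1
  end.

Section CfgFun.
Variables (A : Type) (a0 a1 b0 b1 : A).
Let f := cfg_fun a0 a1 b0 b1.
Lemma cfg_fun_p0 : f p0 = a0. Proof. by []. Qed.
Lemma cfg_fun_p1 : f p1 = a1. Proof. by rewrite /f /cfg_fun /p1 /= inordK. Qed.
Lemma cfg_fun_q0 : f q0 = b0. Proof. by []. Qed.
Lemma cfg_fun_q1 : f q1 = b1. Proof. by rewrite /f /cfg_fun /q1 /= inordK. Qed.
Definition cfg_funE := (cfg_fun_p0, cfg_fun_p1, cfg_fun_q0, cfg_fun_q1).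
End CfgFun.

(** * The law of the number of rightward jumps of a site, and its transfer operator *)

Section Kernel.
Context {K : realType} {q : K}.
Hypothesis q01 : 0 < q < 1.

Definition rprob (c : cfg) : K := if c is inl _ then 1 - q else q.

Lemma rprob_p0 : rprob p0 = 1 - q. Proof. by []. Qed.
Lemma rprob_p1 : rprob p1 = 1 - q. Proof. by []. Qed.
Lemma rprob_q0 : rprob q0 = q. Proof. by []. Qed.
Lemma rprob_q1 : rprob q1 = q. Proof. by []. Qed.
Definition rprobE := (rprob_p0, rprob_p1, rprob_q0, rprob_q1).

Lemma rprob_gt0 c : 0 < rprob c.
Proof. by move: q01 => /andP[? ?]; elim/cfg_ind: c; rewrite rprobE; lra. Qed.

Lemma rprob_lt1 c : rprob c < 1.
Proof. by move: q01 => /andP[? ?]; elim/cfg_ind: c; rewrite rprobE; lra. Qed.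

Let rprob_ge0 c : 0 <= rprob c := ltW (rprob_gt0 c).
Let lprob_ge0 c : 0 <= 1 - rprob c.
Proof. by have := rprob_lt1 c; lra. Qed.

(* [kern n c m] is the probability that a site in configuration [c] is left
   exactly [m] times to the right before it is left [n] times to the left. *)
Fixpoint kern (n : nat) : cfg -> nat -> K :=
  match n with
  | 0 => fun _ m => (m == 0%N)%:R
  | n'.+1 => fix kern_n (c : cfg) (m : nat) {struct m} : K :=
      match m with
      | 0 => (1 - rprob c) * kern n' (update_left c) 0
      | m'.+1 => rprob c * kern_n (update_right c) m' +
                 (1 - rprob c) * kern n' (update_left c) m'.+1
      end
  end.

Lemma kern0 c m : kern 0 c m = (m == 0%N)%:R. Proof. by []. Qed.

Lemma kernS0 n c : kern n.+1 c 0 = (1 - rprob c) * kern n (update_left c) 0.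
Proof. by []. Qed.

Lemma kernSS n c m : kern n.+1 c m.+1 =
  rprob c * kern n.+1 (update_right c) m +
  (1 - rprob c) * kern n (update_left c) m.+1.
Proof. by []. Qed.

Arguments kern : simpl never.

Lemma kern_ge0 n c m : 0 <= kern n c m.
Proof.
elim: n c m => [|n IHn] c m; first by rewrite kern0.
elim: m c => [|m IHm] c; first by rewrite kernS0 mulr_ge0.
by rewrite kernSS addr_ge0 // mulr_ge0.
Qed.

Lemma kern_gt0 n c m : (0 < n)%N -> 0 < kern n c m.
Proof.
have l0 c' : 0 < 1 - rprob c' by have := rprob_lt1 c'; lra.
have h0 n' c' : 0 < kern n' c' 0.
  elim: n' c' => [|n' IHn] c'; first by rewrite kern0.
  by rewrite kernS0 mulr_gt0.
case: n => // n _; elim: m c => [|m IHm] c; first exact: h0.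
by rewrite kernSS ltr_pwDl ?mulr_gt0 ?rprob_gt0// mulr_ge0 ?kern_ge0.
Qed.

Lemma bernoulli (x : K) n : 0 <= x -> 1 + n%:R * x <= (1 + x) ^+ n.
Proof.
move=> x0; elim: n => [|n IH]; first by rewrite mul0r addr0 expr0.
have x1 : 0 <= 1 + x by lra.
rewrite exprS; apply: le_trans (ler_wpM2l x1 IH).
rewrite -[n.+1%:R]natr1 -subr_ge0 (_ : _ - _ = n%:R * x ^+ 2); last by ring.
by rewrite mulr_ge0// sqr_ge0.
Qed.

(** In [p0] a rightward jump keeps the configuration, so there the run of rightward jumps is
    geometric with ratio 1 - q, and any rho with (1 - q) rho < 1 gives a finite exponential moment.
    Every other configuration becomes [p0] after at most two rightward jumps. Partial sums are
    bounded uniformly, so that convergence need not be known beforehand. *)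
Lemma kern_exp_sum :
  exists2 rho : K, (exists A : K, forall m, (m.+1)%:R ^+ 4 <= A * rho ^+ m) &
  forall n, exists C : K, forall c M,
    \sum_(m < M) kern n c m * rho ^+ m <= C.
Proof.
have [qgt0 qlt1] : 0 < q /\ q < 1 by apply/andP.
(* By Bernoulli's inequality s ^ m is at least q / 8 times m + 1, hence the fourth power; and s ^ 4
   <= 1 + q gives (1 - q) s ^ 4 <= 1 - q ^ 2 < 1. *)
pose s : K := 1 + q / 8.
have s1 : 1 <= s by rewrite /s; lra.
exists (s ^+ 4).
  exists ((8 / q) ^+ 4) => m; rewrite exprAC -exprMn.
  apply: lerXn2r; rewrite ?nnegrE ?ler0n//.
    by rewrite mulr_ge0 ?exprn_ge0 ?divr_ge0 //; lra.
  have bern : 1 + m%:R * (q / 8) <= s ^+ m by apply: bernoulli; lra.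
  have : 8 / q * (q / 8 * m.+1%:R) <= 8 / q * s ^+ m.
    apply: ler_wpM2l; first by rewrite divr_ge0//; lra.
    apply: le_trans bern; rewrite -[m.+1%:R]natr1; have : 0 <= m%:R :> K by []; lra.
  by rewrite mulrA (_ : 8 / q * (q / 8) = 1) ?mul1r//; field; lra.
set rho := s ^+ 4.
have r1 : 1 <= rho by rewrite exprn_ege1.
have r0 : 0 <= rho by lra.
have rq : (1 - q) * rho < 1.
  have : rho <= 1 + q.
    rewrite /rho /s !exprS expr0 mulr1.
    have := mulr_gt0 qgt0 qgt0; set r := q * q => rgt0.
    have : r <= q by rewrite /r; nra.
    by rewrite /r; nra.
  by nra.
clearbody rho; clear s s1.
elim=> [|n [C hC]].
  exists 1 => c [|M]; first by rewrite big_ord0.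
  by rewrite big_ord_recl big1 ?kern0 ?expr0 ?mulr1 ?addr0// => i _; rewrite kern0 mul0r.
have C0 : 0 <= C by have := hC p0 0%N; rewrite big_ord0.
pose S c M := \sum_(m < M) kern n.+1 c m * rho ^+ m.
have S0 c : S c 0%N = 0 by rewrite /S big_ord0.
have SS c M : S c M.+1 <=
    rprob c * rho * S (update_right c) M + (1 - rprob c) * C.
  have -> : S c M.+1 = rprob c * rho * S (update_right c) M +
      (1 - rprob c) * \sum_(m < M.+1) kern n (update_left c) m * rho ^+ m.
    rewrite /S big_ord_recl [in RHS]big_ord_recl kernS0 !expr0 !mulr1.
    rewrite mulrDr addrCA; congr (_ + _).
    rewrite !mulr_sumr -big_split; apply: eq_bigr => i _.
    by rewrite lift0 kernSS exprS /=; ring.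
  by rewrite lerD2l ler_wpM2l.
(* The fixed point of the affine recursion satisfied by the partial sums in [p0]. *)
pose B0 := q * C / (1 - (1 - q) * rho).
have d0 : 0 < 1 - (1 - q) * rho by lra.
have B00 : 0 <= B0 by rewrite divr_ge0 ?mulr_ge0//; lra.
have hB0 : (1 - q) * rho * B0 + q * C = B0 by rewrite /B0; field; lra.
have Sp0 M : S p0 M <= B0.
  elim: M => [|M IH]; first by rewrite S0.
  apply: (le_trans (SS _ _)); rewrite rprobE updateE.
  rewrite -[leRHS]hB0 (_ : 1 - (1 - q) = q) ?lerD2r ?ler_wpM2l ?mulr_ge0//; lra.
pose B1 := rho * B0 + C.
have step c B M : 0 <= B -> (forall M, S (update_right c) M <= B) ->
    S c M <= rho * B + C.
  move=> B_ge0 hB; case: M => [|M].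
    by rewrite S0 addr_ge0 ?mulr_ge0.
  apply: (le_trans (SS _ _)); apply: lerD.
    apply: le_trans (ler_wpM2l _ (hB M)) _; first by rewrite mulr_ge0.
    by rewrite ler_wpM2r// ler_piMl// ltW// rprob_lt1.
  by rewrite ler_piMl//; have := rprob_ge0 c; lra.
have B1_ge0 : 0 <= B1 by apply: addr_ge0 => //; apply: mulr_ge0.
have Sq1 M : S q1 M <= B1 by apply: step => // M'; rewrite updateE.
have Sp1 M : S p1 M <= B1 by apply: step => // M'; rewrite updateE.
have Sq0 M : S q0 M <= rho * B1 + C by apply: step => // M'; rewrite updateE.
have le01 : B0 <= B1 by rewrite /B1; nra.
have le12 : B1 <= rho * B1 + C by nra.
exists (rho * B1 + C) => c M; rewrite -/(S c M).
by elim/cfg_ind: c => //; [apply: le_trans (Sp0 M) _| apply: le_trans (Sp1 M) _| apply: le_trans (Sq1 M) _]; lra.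
Qed.

(** Degree four, because fourth moments are the highest that the Lyapunov estimates use. *)
Definition tame (phi : nat -> K) : Prop :=
  exists A : K, forall m, `|phi m| <= A * (m.+1)%:R ^+ 4.

(** The Markov operator of the spatial chain at a site in configuration c: the expectation of phi
    under [kern n c]. *)
Definition transfer (c : cfg) (phi : nat -> K) (n : nat) : K :=
  limn (series (fun m => kern n c m * phi m)).

Lemma tame_cvg n c phi : tame phi ->
  cvgn (series (fun m => kern n c m * phi m)).
Proof.
move=> [A hA]; have [rho [A' hA'] /(_ n)[C hC]] := kern_exp_sum.
apply: normed_cvg.
have A0 : 0 <= A.
  by have := hA 0%N; rewrite expr1n mulr1; apply: le_trans.
have A'0 : 0 <= A'.
  by have := hA' 0%N; rewrite !expr1n expr0 mulr1; apply: le_trans ler01.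
apply: nondecreasing_is_cvgn.
  by apply: nondecreasing_series => m _ _ /=.
exists (A * A' * C) => _ [M _ <-].
apply: le_trans (ler_wpM2l (mulr_ge0 A0 A'0) (hC c M)).
rewrite -[leLHS]/(\sum_(0 <= m < M) `|kern n c m * phi m|) big_mkord mulr_sumr.
apply: ler_sum => i _.
rewrite normrM ger0_norm ?kern_ge0// mulrCA ler_wpM2l ?kern_ge0//.
by rewrite -mulrA; apply: le_trans (hA i) _; rewrite ler_wpM2l.
Qed.

Lemma tame_const (a : K) : tame (fun=> a).
Proof.
exists `|a| => m; rewrite ler_peMr// exprn_ege1//.
by rewrite -[1]/(1%:R) ler_nat.
Qed.

Lemma tame_lin (a b : K) phi psi : tame phi -> tame psi ->
  tame (fun m => a * phi m + b * psi m).
Proof.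
move=> [A hA] [B hB]; exists (`|a| * A + `|b| * B) => m.
apply: le_trans (ler_normD _ _) _; rewrite !normrM mulrDl -!mulrA.
by rewrite lerD// ler_wpM2l.
Qed.

Lemma tame_shift phi : tame phi -> tame (fun m => phi m.+1).
Proof.
move=> [A hA]; exists (A * 16) => m; apply: le_trans (hA _) _.
have A0 : 0 <= A.
  by have := hA 0%N; rewrite expr1n mulr1; apply: le_trans.
rewrite -mulrA ler_wpM2l// (_ : 16 = 2%:R ^+ 4); last by ring.
rewrite -exprMn lerXn2r ?nnegrE ?mulr_ge0//.
by rewrite -natrM ler_nat; lia.
Qed.

Lemma transfer_ext c phi psi n : phi =1 psi -> transfer c phi n = transfer c psi n.
Proof. by move=> /funext->. Qed.

Lemma transfer_lin c (a b : K) phi psi n : tame phi -> tame psi ->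
  transfer c (fun m => a * phi m + b * psi m) n =
  a * transfer c phi n + b * transfer c psi n.
Proof.
move=> tphi tpsi; rewrite /transfer.
have cphi := tame_cvg n c phi tphi; have cpsi := tame_cvg n c psi tpsi.
rewrite (_ : (fun m => _) = a *: (fun m => kern n c m * phi m) +
    b *: (fun m => kern n c m * psi m)); last first.
  by apply/funext => m; rewrite /= !fctE /GRing.scale /=; ring.
rewrite lim_seriesD; [|exact: is_cvg_seriesZ..].
by rewrite !lim_seriesZ.
Qed.

Lemma transfer_le c phi psi n : tame phi -> tame psi ->
  (forall m, phi m <= psi m) -> transfer c phi n <= transfer c psi n.
Proof.
move=> tphi tpsi le; apply: lim_series_le; [exact: tame_cvg..|].
by move=> m; rewrite ler_wpM2l ?kern_ge0.
Qed.

Lemma transfer_ge0 c phi n : tame phi ->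
  (forall m, 0 <= phi m) -> 0 <= transfer c phi n.
Proof.
move=> tphi h.
have -> : 0 = transfer c (fun=> 0) n :> K.
  have := transfer_lin c 0 0 _ _ n (tame_const 0) (tame_const 0).
  by under transfer_ext do rewrite !mul0r addr0; rewrite !mul0r addr0.
by apply: transfer_le => //; exact: tame_const.
Qed.

Lemma lim_seriesS (u : nat -> K) : cvgn (series u) ->
  cvgn (series (fun m => u m.+1)) /\
  limn (series u) = u 0%N + limn (series (fun m => u m.+1)).
Proof.
move=> cu.
have h : series (fun m => u m.+1) @ \oo --> limn (series u) - u 0%N.
  rewrite (_ : series _ = (fun n => [sequence series u n.+1]_n n - u 0%N)).
    by apply: cvgB; [rewrite cvg_shiftS|exact: cvg_cst].
  by apply/funext => n; rewrite /series /= big_nat_recl// addrC addKr.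
split; first by apply/cvg_ex; exists (limn (series u) - u 0%N).
by rewrite (cvg_lim _ h)// addrC subrK.
Qed.

Lemma transfer0 c phi : tame phi -> transfer c phi 0 = phi 0%N.
Proof.
move=> tphi; have [_] := lim_seriesS _ (tame_cvg 0 c _ tphi).
rewrite -/(transfer c phi 0) => ->; rewrite kern0 mul1r.
rewrite [X in limn X](_ : _ = fun=> 0) ?lim_cst ?addr0//.
by apply/funext => n; rewrite /series /= big1// => i _; rewrite kern0 mul0r.
Qed.

(** Analysis of the first jump: a rightward one adds 1 to the count, a leftward one leaves n
    leftward jumps to make. *)
Lemma transferS c phi n : tame phi ->
  transfer c phi n.+1 =
  rprob c * transfer (update_right c) (fun m => phi m.+1) n.+1 +
  (1 - rprob c) * transfer (update_left c) phi n.
Proof.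
move=> tphi; have tphiS := tame_shift _ tphi.
have [_] := lim_seriesS _ (tame_cvg n.+1 c _ tphi).
rewrite -/(transfer c phi n.+1) => ->.
have [cl] := lim_seriesS _ (tame_cvg n (update_left c) _ tphi).
rewrite -/(transfer (update_left c) phi n) => ->.
have cr := tame_cvg n.+1 (update_right c) _ tphiS.
rewrite (_ : (fun m => _) =
    rprob c *: (fun m => kern n.+1 (update_right c) m * phi m.+1) +
    (1 - rprob c) *: (fun m => kern n (update_left c) m.+1 * phi m.+1)); last first.
  by apply/funext => m; rewrite /= !fctE /GRing.scale /= kernSS; ring.
rewrite lim_seriesD; [|exact: is_cvg_seriesZ..].
by rewrite !lim_seriesZ// kernS0 /transfer /GRing.scale /=; ring.
Qed.

(* The mean number of steps up to the next leftward jump is at most [1 / q + 2]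
   in every configuration, whence the factor in front of the forcing term. *)
Lemma recursion_bound (x g : cfg -> K) (x' : cfg -> K) (X G : K) :
  (forall c, x' c = rprob c * x' (update_right c) +
                    (1 - rprob c) * x (update_left c) + g c) ->
  (forall c, `|x c| <= X) -> (forall c, `|g c| <= G) ->
  forall c, `|x' c| <= X + (1 / q + 2) * G.
Proof.
move=> hx' hX hG; have [qgt0 qlt1] : 0 < q /\ q < 1 by apply/andP.
have G0 : 0 <= G by apply: le_trans (hG p0).
pose G' := 1 / q * G.
have qG : q * G' = G by rewrite /G'; field; lra.
have GG' : G <= G' by rewrite -qG; nra.
have {hX}hX c : - X <= x c /\ x c <= X by apply/andP; rewrite -ler_norml.
have {hG}hG c : - G <= g c /\ g c <= G by apply/andP; rewrite -ler_norml.
have -> : X + (1 / q + 2) * G = X + G' + 2 * G by rewrite /G'; ring.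
have := hx' p0; have := hx' p1; have := hx' q0; have := hx' q1.
rewrite !updateE !rprobE => eq1 eq0 ep1 ep0.
have [? ?] := hX p1; have [? ?] := hX q0.
have [? ?] := hG p0; have [? ?] := hG p1; have [? ?] := hG q0.
have [? ?] := hG q1.
(* At [p0] the recursion contains x' p0 itself; solving for it divides the forcing term by q. The
   remaining values follow along the rightward updates leading to [p0], each adding one G. *)
have [hp0l hp0r] : - (X + G') <= x' p0 /\ x' p0 <= X + G'.
  pose g' := g p0 / q.
  have qg : q * g' = g p0 by rewrite /g'; field; lra.
  have e : x' p0 = x p1 + g'.
    apply: (mulfI (lt0r_neq0 qgt0)); rewrite mulrDr qg.
    by move: ep0; lra.
  have : g' <= G' by rewrite -(ler_pM2l qgt0) qg qG.
  have : - G' <= g' by rewrite -(ler_pM2l qgt0) qg mulrN qG.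
  by rewrite e; lra.
have [hp1l hp1r] : - (X + G' + G) <= x' p1 /\ x' p1 <= X + G' + G.
  by rewrite ep1; split; nra.
have [hq1l hq1r] : - (X + G' + G) <= x' q1 /\ x' q1 <= X + G' + G.
  by rewrite eq1; split; nra.
have [hq0l hq0r] : - (X + G' + 2 * G) <= x' q0 /\ x' q0 <= X + G' + 2 * G.
  by rewrite eq0; split; nra.
by elim/cfg_ind; rewrite ler_norml; apply/andP; split; lra.
Qed.

(** The kernel has total mass 1: the defect of mass solves the recursion of [recursion_bound]
    without forcing and is 0 for n = 0. *)
Lemma transfer_cst c (a : K) n : transfer c (fun=> a) n = a.
Proof.
have h1 : forall c, transfer c (fun=> 1) n = 1.
  elim: n => [|n IHn] {}c; first by rewrite transfer0//; exact: tame_const.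
  apply/eqP; rewrite -subr_eq0 -normr_le0.
  have := @recursion_bound (fun c => transfer c (fun=> 1) n - 1) (fun=> 0)
    (fun c => transfer c (fun=> 1) n.+1 - 1) 0 0.
  rewrite mulr0 addr0; apply => [{}c|{}c|_]; last by rewrite normr0.
    by rewrite transferS; [ring|exact: tame_const].
  by rewrite IHn subrr normr0.
rewrite -[RHS]mulr1 -[RHS]addr0 -[in RHS](mul0r (transfer c (fun=> 0) n)) -[in RHS](h1 c).
rewrite -transfer_lin; [|exact: tame_const..].
by apply: transfer_ext => m; rewrite mulr1 mul0r addr0.
Qed.

End Kernel.

Arguments rprob {K} q c.
Arguments kern {K} q n c m : simpl never.
Arguments transfer {K} q c phi n.

(** * Moments of the number of rightward jumps *)

Section Moments.
Context {K : realType} {q : K}.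
Hypothesis q01 : 0 < q < 1.
Local Notation rprob := (rprob q).
Local Notation transfer := (transfer q).

Let qgt0 : 0 < q. Proof. by case/andP: q01. Qed.
Let qlt1 : q < 1. Proof. by case/andP: q01. Qed.
Let q_neq0 : q != 0. Proof. exact: lt0r_neq0. Qed.
Let q1_neq0 : 1 + q != 0. Proof. by apply: lt0r_neq0; rewrite addr_gt0. Qed.

(* [poisson] solves the Poisson equation of the configuration of a site for the
   mean displacement, so that X_n + sum_x poisson (omega_n x) is a martingale;
   [- poisson_bar] is its mean over the configurations left behind by a leftward
   jump. *)
Definition poisson0 : K := (1 - 2 * q) * (1 + q) / (2 * q ^+ 2).
Definition poisson1 : K := poisson0 * (1 - q) / (1 + q).
Definition poisson (c : cfg) : K :=
  cfg_fun poisson0 poisson1 (- poisson0) (- poisson1) c.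
Definition poisson_bar : K := poisson0 * (1 + q ^+ 2) / (1 + q) ^+ 2.
Definition mu (c : cfg) : K := poisson c + poisson_bar.
Definition nu : K := 2 * ((1 - q) * (1 - q + q ^+ 2) / (q ^+ 2 * (1 + q))).

Lemma nu_gt0 : 0 < nu.
Proof.
have [? ?] := andP q01.
by rewrite /nu mulr_gt0// divr_gt0 ?mulr_gt0 ?exprn_gt0//; nra.
Qed.

(** The increments of the martingale built from [poisson] at a jump of a site. That their mean is 0,
    without any centering constant, reflects alpha = 1/2. *)
Definition right_incr (c : cfg) : K := 1 + poisson (update_right c) - poisson c.
Definition left_incr (c : cfg) : K := -1 + poisson (update_left c) - poisson c.

Lemma incr_mean0 c : rprob c * right_incr c + (1 - rprob c) * left_incr c = 0.
Proof.
by elim/cfg_ind: c; rewrite /right_incr /left_incr !updateE rprobE /poisson !cfg_funE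
  /poisson1 /poisson0; field; apply/andP; split.
Qed.

Lemma tame_pow (a : K) j : (j <= 4)%N -> tame (fun m => (m%:R - a) ^+ j).
Proof.
move=> j4; exists ((1 + `|a|) ^+ 4) => m.
have m1 : 1 <= (m.+1)%:R :> K by rewrite -[1]/(1%:R) ler_nat.
rewrite normrX -exprMn.
have b1 : 1 <= (1 + `|a|) * m.+1%:R.
  by rewrite -[leLHS]mulr1 ler_pM// lerDl.
have b0 := le_trans ler01 b1.
apply: le_trans (ler_weXn2l b1 j4); apply: lerXn2r; rewrite ?nnegrE//.
apply: (le_trans (ler_normB _ _)); rewrite ger0_norm// -natr1.
have : 0 <= `|a| * m%:R by rewrite mulr_ge0.
by lra.
Qed.

Lemma transfer_poly c n (a b0 b1 b2 b3 b4 : K) :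
  let T j := transfer c (fun m => (m%:R - a) ^+ j) n in
  transfer c (fun m => b0 + b1 * (m%:R - a) + b2 * (m%:R - a) ^+ 2 +
     b3 * (m%:R - a) ^+ 3 + b4 * (m%:R - a) ^+ 4) n =
  b0 + b1 * T 1%N + b2 * T 2%N + b3 * T 3%N + b4 * T 4%N.
Proof.
move=> T; pose u j m : K := (m%:R - a) ^+ j.
have tu j : (j <= 4)%N -> tame (u j) by exact: tame_pow.
have tc := tame_const b0.
have t1 := tame_lin 1 b1 _ _ tc (tu 1%N isT).
have t2 := tame_lin 1 b2 _ _ t1 (tu 2%N isT).
have t3 := tame_lin 1 b3 _ _ t2 (tu 3%N isT).
have e : forall m, b0 + b1 * (m%:R - a) + b2 * (m%:R - a) ^+ 2 +
     b3 * (m%:R - a) ^+ 3 + b4 * (m%:R - a) ^+ 4 =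
     1 * (1 * (1 * (1 * b0 + b1 * u 1%N m) + b2 * u 2%N m) + b3 * u 3%N m) +
     b4 * u 4%N m by move=> m; rewrite /u; ring.
rewrite (transfer_ext _ _ _ _ e) !(transfer_lin q01)//; [|exact: tu..].
by rewrite transfer_cst// !mul1r.
Qed.

Lemma tame_poly (a b0 b1 b2 b3 b4 : K) : tame (fun m => b0 + b1 * (m%:R - a) +
  b2 * (m%:R - a) ^+ 2 + b3 * (m%:R - a) ^+ 3 + b4 * (m%:R - a) ^+ 4).
Proof.
pose u j m : K := (m%:R - a) ^+ j.
have tu j : (j <= 4)%N -> tame (u j) by exact: tame_pow.
have t1 := tame_lin 1 b1 _ _ (tame_const b0) (tu 1%N isT).
have t2 := tame_lin 1 b2 _ _ t1 (tu 2%N isT).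
have t3 := tame_lin 1 b3 _ _ t2 (tu 3%N isT).
have := tame_lin 1 b4 _ _ t3 (tu 4%N isT); congr tame.
by apply/funext => m; rewrite /u /=; ring.
Qed.

Definition centered (j : nat) (c : cfg) (n : nat) : K :=
  transfer c (fun m => (m%:R - (n%:R + mu c)) ^+ j) n.

(** Centering at n + mu c is chosen so that the shift caused by the first jump is exactly the
    martingale increment. Expanding the power gives the same recursion for each moment, forced by
    moments of lower order. *)
Lemma centeredS j c n : (j <= 4)%N ->
  centered j c n.+1 =
  rprob c * transfer (update_right c)
    (fun m => (m%:R - (n.+1%:R + mu (update_right c)) + right_incr c) ^+ j) n.+1 +
  (1 - rprob c) * transfer (update_left c)
    (fun m => (m%:R - (n%:R + mu (update_left c)) + left_incr c) ^+ j) n.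
Proof.
move=> j4; rewrite /centered transferS//; last exact: tame_pow.
congr (_ * _ + _ * _); apply: transfer_ext => m; congr (_ ^+ _);
  rewrite /mu /right_incr /left_incr -!natr1; ring.
Qed.

Lemma transfer_shift_pow c n (a d : K) :
  let T j := transfer c (fun m => (m%:R - a) ^+ j) n in
  [/\ transfer c (fun m => (m%:R - a + d) ^+ 1) n = T 1%N + d,
      transfer c (fun m => (m%:R - a + d) ^+ 2) n =
        T 2%N + 2 * d * T 1%N + d ^+ 2,
      transfer c (fun m => (m%:R - a + d) ^+ 3) n =
        T 3%N + 3 * d * T 2%N + 3 * d ^+ 2 * T 1%N + d ^+ 3 &
      transfer c (fun m => (m%:R - a + d) ^+ 4) n =
        T 4%N + 4 * d * T 3%N + 6 * d ^+ 2 * T 2%N + 4 * d ^+ 3 * T 1%N + d ^+ 4].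
Proof.
move=> T; have P := transfer_poly c n a.
have := P d 1 0 0 0; have := P (d ^+ 2) (2 * d) 1 0 0.
have := P (d ^+ 3) (3 * d ^+ 2) (3 * d) 1 0.
have := P (d ^+ 4) (4 * d ^+ 3) (6 * d ^+ 2) (4 * d) 1.
rewrite -/(T _) => e4 e3 e2 e1.
split.
- rewrite (_ : T 1%N + d = d + 1 * T 1%N + 0 * T 2%N + 0 * T 3%N + 0 * T 4%N); last ring.
  by rewrite -e1; apply: transfer_ext => m; ring.
- rewrite (_ : _ + d ^+ 2 = d ^+ 2 + 2 * d * T 1%N + 1 * T 2%N + 0 * T 3%N + 0 * T 4%N); last ring.
  by rewrite -e2; apply: transfer_ext => m; ring.
- rewrite (_ : _ + d ^+ 3 = d ^+ 3 + 3 * d ^+ 2 * T 1%N + 3 * d * T 2%N + 1 * T 3%N + 0 * T 4%N); last ring.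
  by rewrite -e3; apply: transfer_ext => m; ring.
- rewrite (_ : _ + d ^+ 4 = d ^+ 4 + 4 * d ^+ 3 * T 1%N + 6 * d ^+ 2 * T 2%N + 4 * d * T 3%N + 1 * T 4%N); last ring.
  by rewrite -e4; apply: transfer_ext => m; ring.
Qed.

Lemma centered1S c n : centered 1 c n.+1 =
  rprob c * centered 1 (update_right c) n.+1 +
  (1 - rprob c) * centered 1 (update_left c) n.
Proof.
rewrite centeredS//.
have [-> _ _ _] := transfer_shift_pow (update_right c) n.+1
  (n.+1%:R + mu (update_right c)) (right_incr c).
have [-> _ _ _] := transfer_shift_pow (update_left c) n
  (n%:R + mu (update_left c)) (left_incr c).
rewrite -/(centered _ _ _) -/(centered _ _ _).
by have := incr_mean0 c; lra.
Qed.

(** The recursion closes on the values a, b at [p1] and [q0], the configurations that leftward jumps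
    leave behind. Its matrix has eigenvalues 1 and 1 - q - q ^ 2. The combination q a + b, belonging
    to the eigenvalue 1, is conserved, and [poisson_bar] is the constant that makes it 0 at the
    start; what remains decays geometrically. *)
Lemma mean_bound : exists C : K, exists2 lam : K, 0 < lam < 1 &
  forall c n, `|centered 1 c n| <= C * lam ^+ n.
Proof.
pose a := centered 1 p1; pose b := centered 1 q0.
have p0S n : centered 1 p0 n.+1 = a n.
  apply: (mulfI q_neq0); have := centered1S p0 n.
  by rewrite !updateE rprobE -/a; lra.
have aS n : a n.+1 = (1 - q) * a n + q * b n.
  have := centered1S p1 n; rewrite !updateE rprobE p0S -/a -/b => ->; ring.
have q1S n : centered 1 q1 n.+1 = q * a n + (1 - q) * b n.
  by rewrite centered1S !updateE rprobE p0S -/b.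
have bS n : b n.+1 = q * (q * a n + (1 - q) * b n) + (1 - q) * b n.
  by rewrite /b centered1S !updateE rprobE q1S.
have init c : centered 1 c 0 = - mu c.
  rewrite /centered transfer0//; first by ring.
  exact: tame_pow.
have inv n : b n = - (q * a n).
  elim: n => [|n IH]; last by rewrite bS aS IH; ring.
  rewrite /a /b !init /mu /poisson !cfg_funE /poisson_bar /poisson1 /poisson0; field.
  by apply/andP; split.
(* The eigenvalue can be 0 or close to it. Keeping lam above 1 / 2 makes it positive and lets bounds
   at n + 1 be expressed by a at n at the price of a constant factor. *)
have [lam [lam0 lam1 lam2 lamk]] : exists lam : K,
    [/\ 0 < lam, lam < 1, 1 / 2 <= lam & `|1 - q - q ^+ 2| <= lam].
  have [le|/ltW le] := leP `|1 - q - q ^+ 2| (1 / 2).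
    by exists (1 / 2); split; lra.
  exists `|1 - q - q ^+ 2|; split=> //; first lra.
  by have := qgt0; have := qlt1; rewrite ltr_norml; nra.
have abound n : `|a n| <= `|a 0%N| * lam ^+ n.
  elim: n => [|n IH]; first by rewrite expr0 mulr1.
  rewrite aS inv (_ : _ + _ = (1 - q - q ^+ 2) * a n); last by ring.
  by rewrite normrM [lam ^+ n.+1]exprS mulrCA; apply: ler_pM.
pose A := `|mu p0| + `|mu p1| + `|mu q0| + `|mu q1|.
have A0 : 0 <= A by rewrite !addr_ge0.
exists (A + 4 * `|a 0%N|), lam; first by rewrite lam0.
move=> c [|n].
  rewrite init normrN expr0 mulr1.
  have := normr_ge0 (mu p0); have := normr_ge0 (mu p1).
  have := normr_ge0 (mu q0); have := normr_ge0 (mu q1).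
  have := normr_ge0 (a 0%N); rewrite /A.
  by elim/cfg_ind: c; lra.
have ln0 : 0 <= lam ^+ n by rewrite exprn_ge0 ?ltW.
have bnd k : -1 <= k <= 1 ->
    `|k * a n| <= (A + 4 * `|a 0%N|) * lam ^+ n.+1.
  move=> k1; rewrite normrM.
  apply: (@le_trans _ _ (1 * (`|a 0%N| * lam ^+ n))).
    by apply: ler_pM => //; rewrite ler_norml.
  rewrite mul1r exprS mulrA ler_wpM2r//.
  have := normr_ge0 (a 0%N); nra.
have [q_gt0 q_lt1] := andP q01.
have q2a : 0 <= q ^+ 2 by exact: sqr_ge0.
have q2b : q ^+ 2 <= q by rewrite expr2 ler_piMr// ltW.
elim/cfg_ind: c.
- by rewrite p0S -[a n]mul1r; apply: bnd; apply/andP; split; lra.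
- rewrite -/a aS inv (_ : _ + _ = (1 - q - q ^+ 2) * a n); last by ring.
  by apply: bnd; apply/andP; split; lra.
- rewrite -/b bS inv (_ : _ + _ = (q * (q ^+ 2 + q - 1)) * a n); last by ring.
  by apply: bnd; apply/andP; split; nra.
- rewrite q1S inv (_ : _ + _ = q ^+ 2 * a n); last by ring.
  by apply: bnd; apply/andP; split; lra.
Qed.

(* [beta] corrects the squared increments, whose mean depends on the
   configuration, to the constant variance [nu] per leftward jump. *)
Let r : K := (1 - q) / q.
Let beta : cfg -> K :=
  let b0 := r / q - nu in
  let b2 := nu - (r ^+ 3 + (1 - q) * b0) / q in
  cfg_fun b0 0 b2 (q * b0 + (1 - q) * b2 - (1 - q) * nu + r ^+ 3).

Lemma beta_poisson c :
  rprob c * (right_incr c ^+ 2 + beta (update_right c)) +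
  (1 - rprob c) * (left_incr c ^+ 2 + beta (update_left c) - nu) = beta c.
Proof.
by elim/cfg_ind: c; rewrite /right_incr /left_incr !updateE rprobE /beta /poisson
  !cfg_funE /r /nu /poisson1 /poisson0; field; apply/andP; split.
Qed.

Let D : K := 1 / q + 2.
Let D0 : 0 <= D. Proof. by rewrite addr_ge0// divr_ge0// ltW. Qed.

Lemma cfg_bound (f : cfg -> K) : exists2 B : K, 0 <= B & forall c, `|f c| <= B.
Proof.
exists (`|f p0| + `|f p1| + `|f q0| + `|f q1|); first by rewrite !addr_ge0.
move=> c; have := normr_ge0 (f p0); have := normr_ge0 (f p1).
by have := normr_ge0 (f q0); have := normr_ge0 (f q1); elim/cfg_ind: c; lra.
Qed.

Lemma normD_le (x y X Y : K) : `|x| <= X -> `|y| <= Y -> `|x + y| <= X + Y.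
Proof. by move=> hx hy; apply: (le_trans (ler_normD _ _)); rewrite lerD. Qed.

Lemma normM_le (x y X Y : K) : `|x| <= X -> `|y| <= Y -> `|x * y| <= X * Y.
Proof. by move=> hx hy; rewrite normrM ler_pM. Qed.

Lemma normX_le (x X : K) n : `|x| <= X -> `|x ^+ n| <= X ^+ n.
Proof.
move=> hx; rewrite normrX; apply: lerXn2r; rewrite ?nnegrE//.
exact: le_trans hx.
Qed.

Arguments normD_le {x y X Y}.
Arguments normM_le {x y X Y}.
Arguments normX_le {x X}.

Lemma norm_rprob_le c : `|rprob c| <= 1 /\ `|1 - rprob c| <= 1.
Proof.
have := rprob_gt0 q01 c; have := rprob_lt1 q01 c => ? ?.
by split; rewrite ler_norml; apply/andP; split; lra.
Qed.

(** Once nu n and [beta] are subtracted, the forcing consists of products of increments with the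
    first centered moments. These decay geometrically, so that the forcing is summable. *)
Lemma variance_bound : exists C : K, forall c n,
  `|centered 2 c n - nu * n%:R| <= C.
Proof.
have [C [lam /andP[lam0 lam1] hC]] := mean_bound.
pose x c n := centered 2 c n - nu * n%:R - beta c.
pose g c n := 2 * (rprob c * right_incr c * centered 1 (update_right c) n.+1 +
   (1 - rprob c) * left_incr c * centered 1 (update_left c) n).
have xS c n : x c n.+1 = rprob c * x (update_right c) n.+1 +
   (1 - rprob c) * x (update_left c) n + g c n.
  rewrite /x centeredS//.
  have [_ -> _ _] := transfer_shift_pow (update_right c) n.+1
    (n.+1%:R + mu (update_right c)) (right_incr c).
  have [_ -> _ _] := transfer_shift_pow (update_left c) n
    (n%:R + mu (update_left c)) (left_incr c).
  rewrite -/(centered _ _ _) -/(centered _ _ _) -/(centered _ _ _) -/(centered _ _ _).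
  have := beta_poisson c; rewrite /g -natr1; lra.
have [B B0 hB] := cfg_bound (fun c => `|right_incr c| + `|left_incr c|).
have C0 : 0 <= C by have := hC p0 0%N; rewrite mulr1; apply: le_trans.
have wle (k u v : K) : 0 <= k -> k <= 1 -> 0 <= u -> u <= v -> k * u <= v.
  by move=> *; nra.
have gle c n : `|g c n| <= 2 * (B * C) * lam ^+ n.
  have := hB c; rewrite ger0_norm ?addr_ge0// => hBc.
  have r0 := ltW (rprob_gt0 q01 c); have r1 := ltW (rprob_lt1 q01 c).
  rewrite /g normrM [`|2|]ger0_norm// -!mulrA ler_wpM2l//.
  apply: (le_trans (ler_normD _ _)).
  have r1' : 0 <= 1 - rprob c by rewrite subr_ge0.
  rewrite !normrM (ger0_norm r0) (ger0_norm r1').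
  have h1 := hC (update_right c) n.+1; have h2 := hC (update_left c) n.
  have ln0 : 0 <= lam ^+ n by rewrite exprn_ge0 ?ltW.
  have {}h1 : `|centered 1 (update_right c) n.+1| <= C * lam ^+ n.
    apply: (le_trans h1); rewrite ler_wpM2l// exprS ler_piMl// ltW//.
  apply: (@le_trans _ _ (`|right_incr c| * (C * lam ^+ n) + `|left_incr c| * (C * lam ^+ n))).
    apply: lerD.
      by apply: wle => //; rewrite ler_wpM2l.
    by apply: wle => //; rewrite ?gerBl// ler_wpM2l.
  by rewrite -mulrDl ler_wpM2r// mulr_ge0.
have [X X0 hX] := cfg_bound (fun c => x c 0%N).
pose E := D * (2 * (B * C)).
have E0 : 0 <= E by rewrite !mulr_ge0.
have xle n : forall c, `|x c n| <= X + E * ((1 - lam ^+ n) / (1 - lam)).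
  elim: n => [|n IH] c; first by rewrite expr0 subrr mul0r mulr0 addr0.
  have := recursion_bound q01 (x^~ n) (g^~ n) (x^~ n.+1) _ _ (fun c => xS c n) IH (fun c => gle c n) c.
  move=> /le_trans; apply; rewrite le_eqVlt; apply/orP; left; apply/eqP.
  rewrite /E /D exprS; field; apply/andP; split=> //.
  by rewrite subr_eq0 gt_eqF.
have [b b0 hb] := cfg_bound beta.
exists (X + E * (1 / (1 - lam)) + b) => c n.
rewrite (_ : _ - _ = x c n + beta c); last by rewrite /x; ring.
apply: (le_trans (ler_normD _ _)); apply: lerD => //.
have i0 : 0 <= (1 - lam)^-1 by rewrite invr_ge0 subr_ge0 ltW.
apply: (le_trans (xle n c)); rewrite lerD2l; apply: ler_wpM2l => //.
by apply: ler_wpM2r => //; rewrite gerBl exprn_ge0// ltW.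
Qed.

(** The forcing contains three times the increment times the second moment, which is of order n. Its
    leading part nu n does not depend on the configuration and is cancelled by [incr_mean0], so the
    forcing is bounded. Without this cancellation the bound would be of order n ^ 2, too weak for
    the Taylor expansions. *)
Lemma third_bound : exists C : K, forall c n, `|centered 3 c n| <= C * n.+1%:R.
Proof.
have [C1 [lam /andP[lam0 lam1] hC1']] := mean_bound.
have C10 : 0 <= C1 by have := hC1' p0 0%N; rewrite mulr1; apply: le_trans.
have hC1 c n : `|centered 1 c n| <= C1.
  apply: (le_trans (hC1' c n)); rewrite ler_piMr// exprn_ile1// ltW//.
have [C2 hC2] := variance_bound.
have C20 : 0 <= C2 by apply: le_trans (hC2 p0 0%N).
pose s c n := centered 2 c n - nu * n%:R.
pose g c n := let d := right_incr c in let e := left_incr c in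
   rprob c * (3 * d * s (update_right c) n.+1 +
      3 * d ^+ 2 * centered 1 (update_right c) n.+1 + d ^+ 3 + 3 * d * nu) +
   (1 - rprob c) * (3 * e * s (update_left c) n +
      3 * e ^+ 2 * centered 1 (update_left c) n + e ^+ 3).
have yS c n : centered 3 c n.+1 =
    rprob c * centered 3 (update_right c) n.+1 +
    (1 - rprob c) * centered 3 (update_left c) n + g c n.
  rewrite centeredS//.
  have [_ _ -> _] := transfer_shift_pow (update_right c) n.+1
    (n.+1%:R + mu (update_right c)) (right_incr c).
  have [_ _ -> _] := transfer_shift_pow (update_left c) n
    (n%:R + mu (update_left c)) (left_incr c).
  rewrite -!/(centered _ _ _) /g /s -natr1.
  have := incr_mean0 c.
  move: (right_incr c) (left_incr c) (rprob c) => d e p h.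
  set y1 := centered 1 _ _; set y2 := centered 2 _ _; set y3 := centered 3 _ _.
  set z1 := centered 1 _ n; set z2 := centered 2 _ n; set z3 := centered 3 _ n.
  suff : nu * n%:R * 3 * (p * d + (1 - p) * e) = 0 by lra.
  by rewrite h mulr0.
have [B B0 hd] := cfg_bound right_incr; have [B' B'0 he] := cfg_bound left_incr.
have [G hG] : exists G : K, forall c n, `|g c n| <= G.
  eexists=> c n; rewrite /g /=; have [r0 r1] := norm_rprob_le c.
  have n3 : `|3| <= 3 :> K by rewrite ger0_norm.
  have nn : `|nu| <= `|nu| by [].
  have hc d b c' n' : `|d| <= b -> `|3 * d * s c' n' + 3 * d ^+ 2 * centered 1 c' n' + d ^+ 3| <=
      3 * b * C2 + 3 * b ^+ 2 * C1 + b ^+ 3.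
    move=> db; exact: (normD_le (normD_le (normM_le (normM_le n3 db) (hC2 c' n'))
      (normM_le (normM_le n3 (normX_le 2 db)) (hC1 c' n'))) (normX_le 3 db)).
  exact: (normD_le (normM_le r0 (normD_le (hc _ _ _ _ (hd c))
    (normM_le (normM_le n3 (hd c)) nn))) (normM_le r1 (hc _ _ _ _ (he c)))).
have [X X0 hX] := cfg_bound (fun c => centered 3 c 0%N).
have G0 : 0 <= G by apply: le_trans (hG p0 0%N).
exists (X + D * G) => c n; move: n c; elim=> [|n IH] c.
  by rewrite mulr1; apply: le_trans (hX c) _; rewrite lerDl mulr_ge0.
have := recursion_bound q01 (centered 3 ^~ n) (g^~ n) (centered 3 ^~ n.+1) _ _
  (fun c => yS c n) IH (fun c => hG c n) c.
move=> /le_trans; apply; rewrite -[n.+2%:R]natr1 -/D [leRHS]mulrDr mulr1 lerD2l.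
by rewrite lerDr.
Qed.

(** Here the crude forcing bound of order n is good enough. *)
Lemma fourth_bound : exists C : K, forall c n, `|centered 4 c n| <= C * n.+1%:R ^+ 2.
Proof.
have [C1 [lam /andP[lam0 lam1] hC1']] := mean_bound.
have C10 : 0 <= C1 by have := hC1' p0 0%N; rewrite mulr1; apply: le_trans.
have n1 n : 1 <= n.+1%:R :> K by rewrite -[1]/(1%:R) ler_nat.
have hC1 c n : `|centered 1 c n| <= C1 * n.+1%:R.
  apply: (le_trans (hC1' c n)); rewrite ler_wpM2l//.
  by apply: le_trans (n1 n); rewrite exprn_ile1// ltW.
have [C2' hC2'] := variance_bound.
have C2'0 : 0 <= C2' by apply: le_trans (hC2' p0 0%N).
have nu0 := ltW nu_gt0.
have hC2 c n : `|centered 2 c n| <= (C2' + nu) * n.+1%:R.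
  rewrite -[centered _ _ _](subrK (nu * n%:R)); apply: (le_trans (ler_normD _ _)).
  rewrite mulrDl; apply: lerD; last by rewrite normrM (ger0_norm nu0) normr_nat ler_wpM2l// ler_nat.
  by apply: (le_trans (hC2' c n)); rewrite ler_peMr.
have [C3 hC3] := third_bound.
have C30 : 0 <= C3 by have := hC3 p0 0%N; rewrite mulr1; apply: le_trans.
pose f c n d := 4 * d * centered 3 c n + 6 * d ^+ 2 * centered 2 c n +
  4 * d ^+ 3 * centered 1 c n + d ^+ 4.
pose g c n := rprob c * f (update_right c) n.+1 (right_incr c) +
  (1 - rprob c) * f (update_left c) n (left_incr c).
have yS c n : centered 4 c n.+1 =
    rprob c * centered 4 (update_right c) n.+1 +
    (1 - rprob c) * centered 4 (update_left c) n + g c n.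
  rewrite centeredS//.
  have [_ _ _ ->] := transfer_shift_pow (update_right c) n.+1
    (n.+1%:R + mu (update_right c)) (right_incr c).
  have [_ _ _ ->] := transfer_shift_pow (update_left c) n
    (n%:R + mu (update_left c)) (left_incr c).
  by rewrite -!/(centered _ _ _) /g /f; ring.
have [B B0 hd] := cfg_bound right_incr; have [B' B'0 he] := cfg_bound left_incr.
pose F b : K := 4 * b * C3 + 6 * b ^+ 2 * (C2' + nu) + 4 * b ^+ 3 * C1 + b ^+ 4.
have F0 b : 0 <= b -> 0 <= F b by move=> b0; rewrite !addr_ge0// ?mulr_ge0// ?exprn_ge0// addr_ge0.
have hf c n d b : `|d| <= b -> `|f c n d| <= F b * n.+1%:R.
  move=> db; have b0 : 0 <= b by apply: le_trans db.
  apply: (@le_trans _ _ (4 * b * (C3 * n.+1%:R) +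
     6 * b ^+ 2 * ((C2' + nu) * n.+1%:R) + 4 * b ^+ 3 * (C1 * n.+1%:R) + b ^+ 4 * n.+1%:R)).
    have [n2 n3 n4] : [/\ `|4| <= 4 :> K, `|6| <= 6 :> K & b ^+ 4 <= b ^+ 4 * n.+1%:R].
      by rewrite !ger0_norm// ler_peMr ?exprn_ge0.
    apply: normD_le; last exact: le_trans (normX_le 4 db) n4.
    exact: (normD_le (normD_le (normM_le (normM_le n2 db) (hC3 c n))
      (normM_le (normM_le n3 (normX_le 2 db)) (hC2 c n)))
      (normM_le (normM_le n2 (normX_le 3 db)) (hC1 c n))).
  by rewrite /F le_eqVlt; apply/orP; left; apply/eqP; ring.
have [X X0 hX] := cfg_bound (fun c => centered 4 c 0%N).
pose G := F B + F B'.
have G0 : 0 <= G by rewrite addr_ge0 ?F0.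
have hG c n : `|g c n| <= G * n.+2%:R.
  have [r0 r1] := norm_rprob_le c.
  rewrite /g /G [leRHS]mulrDl; apply: normD_le; rewrite -[leRHS]mul1r; apply: normM_le => //.
    exact: hf.
  apply: le_trans (hf _ _ _ _ (he c)) _; rewrite ler_wpM2l ?F0// ler_nat//.
exists (X + D * G) => c n; move: n c; elim=> [|n IH] c.
  by rewrite expr1n mulr1; apply: le_trans (hX c) _; rewrite lerDl mulr_ge0.
have := recursion_bound q01 (centered 4 ^~ n) (g^~ n) (centered 4 ^~ n.+1) _ _
  (fun c => yS c n) IH (fun c => hG c n) c.
move=> /le_trans; apply; rewrite -/D mulrA.
have DG0 : 0 <= D * G by rewrite mulr_ge0.
rewrite -[n.+2%:R]natr1; have := n1 n; set N := n.+1%:R; clearbody D; nra.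
Qed.

End Moments.
Arguments nu {K} q.
Arguments mu {K} q c.
Arguments poisson {K} q c.
Arguments centered {K} q j c n.
Arguments normD_le {K x y X Y}.
Arguments normM_le {K x y X Y}.
Arguments normX_le {K x X} n.

(** * Lyapunov functions *)

Section Log.
Context {K : realType}.
(** The sign condition says that f decreases up to 1 and increases afterwards. *)
Lemma ge_at1 (f f' : K -> K) (a : K) : a < 1 ->
  (forall x, a < x -> is_derive x 1 f (f' x)) ->
  (forall x, a < x -> 0 <= f' x * (x - 1)) ->
  forall x, a < x -> f 1 <= f x.
Proof.
move=> a1 df hf' x ax.
have cf y z : a < y -> {within `[y, z], continuous f}.
  move=> ay; apply: derivable_within_continuous => t; rewrite in_itv /= => /andP[yt _].
  by have [] := df t (lt_le_trans ay yt).
rewrite -subr_ge0; have [x1|x1|->] := ltgtP x 1; last by rewrite subrr.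
- have [||c] := @MVT K f f' x 1 x1; [|exact: cf|].
    by move=> t; rewrite in_itv /= => /andP[xt _]; apply: df; exact: lt_trans xt.
  rewrite in_itv /= => /andP[xc c1] e.
  have hc := hf' c (lt_trans ax xc).
  have fc : f' c <= 0 by rewrite -oppr_ge0 -(pmulr_lge0 _ (_ : 0 < 1 - c)) ?subr_gt0//; lra.
  have : 0 < 1 - x by rewrite subr_gt0.
  by move: e; nra.
- have [||c] := @MVT K f f' 1 x x1; [|exact: cf|].
    by move=> t; rewrite in_itv /= => /andP[xt _]; apply: df; exact: lt_trans xt.
  rewrite in_itv /= => /andP[xc c1] e.
  have hc := hf' c (lt_trans a1 xc).
  have fc : 0 <= f' c by rewrite -(pmulr_lge0 _ (_ : 0 < c - 1)) ?subr_gt0//.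
  have : 0 < x - 1 by rewrite subr_gt0.
  by rewrite e; nra.
Qed.

Lemma ln_le_poly3 (x : K) : -1 < x -> ln (1 + x) <= x - x ^+ 2 / 2 + x ^+ 3 / 3.
Proof.
move=> x1.
pose u : {poly K} := 'X - 1%:P.
pose p := u - (1 / 2) *: u ^+ 2 + (1 / 3) *: u ^+ 3.
have pE y : p.[y] = (y - 1) - (y - 1) ^+ 2 / 2 + (y - 1) ^+ 3 / 3.
  by rewrite /p /u !(hornerE, horner_exp) /=; field.
have : ((horner p : K -> K) - (@ln K : K -> K)) 1 <=
       ((horner p : K -> K) - (@ln K : K -> K)) (1 + x).
  apply: (@ge_at1 _ (fun y => (deriv p).[y] - y^-1) 0) => [|y y0|y y0|]; [exact: ltr01| | |lra].
    by apply: is_deriveB; exact: is_derive1_ln.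
  rewrite /p /u !(poly.derivE, hornerE, horner_exp) /=.
  rewrite (_ : _ * _ = (y - 1) ^+ 4 / y); last by field; rewrite gt_eqF.
  by apply: divr_ge0; [exact: exprn_even_ge0|exact: ltW].
by rewrite !fctE !pE ln1; lra.
Qed.

(** The cubic Taylor polynomial lies above the logarithm; subtracting x ^ 4 reverses the inequality
    as long as 1 + x >= 1 / 4, where 4 y - 1 >= 0 for y = 1 + x. *)
Lemma ln_ge_poly4 (x : K) : -1 / 2 <= x ->
  x - x ^+ 2 / 2 + x ^+ 3 / 3 - x ^+ 4 <= ln (1 + x).
Proof.
move=> x1.
pose u : {poly K} := 'X - 1%:P.
pose p := u - (1 / 2) *: u ^+ 2 + (1 / 3) *: u ^+ 3 - u ^+ 4.
have pE y : p.[y] = (y - 1) - (y - 1) ^+ 2 / 2 + (y - 1) ^+ 3 / 3 - (y - 1) ^+ 4.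
  by rewrite /p /u !(hornerE, horner_exp) /=; field.
have : ((@ln K : K -> K) - (horner p : K -> K)) 1 <=
       ((@ln K : K -> K) - (horner p : K -> K)) (1 + x).
  apply: (@ge_at1 _ (fun y => y^-1 - (deriv p).[y]) (1 / 4)) => [|y y0|y y0|]; [lra| | |lra].
    by apply: is_deriveB; apply: is_derive1_ln; lra.
  rewrite /p /u !(poly.derivE, hornerE, horner_exp) /=.
  have yn0 : y != 0 by rewrite gt_eqF//; lra.
  rewrite (_ : _ * _ = (y - 1) ^+ 4 * ((4 * y - 1) / y)); last by field.
  by rewrite mulr_ge0 ?exprn_even_ge0// divr_ge0; lra.
by rewrite !fctE !pE ln1; lra.
Qed.

Lemma ln_sq_le (x : K) : -1 / 2 <= x -> ln (1 + x) ^+ 2 <= 4 * x ^+ 2.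
Proof.
move=> x1; have x0 : 0 < 1 + x by lra.
have up : ln (1 + x) <= x by apply: le_ln1Dx; lra.
have lo : - ln (1 + x) <= (1 + x)^-1 - 1.
  rewrite -lnV ?posrE//.
  have := @le_ln1Dx K ((1 + x)^-1 - 1); rewrite [X in ln X](_ : _ = (1 + x)^-1); last by ring.
  apply.
  by have i0 : 0 < (1 + x)^-1; [rewrite invr_gt0|lra].
have e : (1 + x) * ((1 + x)^-1 - 1) = - x by field; lra.
have [x_ge0|x_le0] := leP 0 x.
  have : 0 <= ln (1 + x) by apply: ln_ge0; lra.
  nra.
have : (1 + x)^-1 - 1 <= - 2 * x by nra.
have : ln (1 + x) <= 0 by lra.
nra.
Qed.
End Log.

Ltac nonneg :=
  repeat (first [done | apply: addr_ge0 | apply: mulr_ge0 | apply: exprn_ge0]).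

(** * Moments about the present value, and the logarithmic supermartingale *)

Section Lyapunov.
Context {K : realType} {q : K}.
Hypothesis q01 : 0 < q < 1.
Local Notation rprob := (rprob q).
Local Notation transfer := (transfer q).
Local Notation mu := (mu q).
Local Notation nu := (nu q).

Lemma geometric_decay (lam : K) : 0 < lam < 1 ->
  exists2 B : K, 0 <= B & forall n, lam ^+ n <= B / n.+1%:R.
Proof.
move=> /andP[l0 l1]; pose d := lam^-1 - 1.
have d0 : 0 < d by rewrite subr_gt0 invf_gt1.
have di0 : 0 < d^-1 by rewrite invr_gt0.
exists (1 + d^-1); first lra.
move=> n; have n0 : 0 < n.+1%:R :> K by rewrite ltr0n.
rewrite ler_pdivlMr//.
have := bernoulli d n (ltW d0); rewrite (_ : 1 + d = lam^-1); last by rewrite /d; ring.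
rewrite exprVn => b.
have ln0 : 0 < lam ^+ n by rewrite exprn_gt0.
have : lam ^+ n * (1 + n%:R * d) <= 1.
  by rewrite -[leRHS](mulfV (lt0r_neq0 ln0)) ler_wpM2l// ltW.
rewrite -natr1 => b'.
have : 0 <= n%:R :> K by [].
have dd : d * d^-1 = 1 by rewrite mulfV// gt_eqF.
move: (n%:R) (lam ^+ n) (d^-1) b' ln0 d0 di0 dd => N l e b' ln0 d0 di0 dd N0.
have : e * (l * (1 + N * d)) <= e by rewrite ler_piMr// ltW.
rewrite (_ : e * _ = l * e + l * N * (d * e)); last by ring.
rewrite dd => h1.
have : 0 <= l * N * d by rewrite !mulr_ge0// ltW.
by nra.
Qed.

(** Taylor expansions of Lyapunov functions are made about n, whereas the recursions close for
    moments about n + mu c. *)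
Definition raw (j : nat) c n : K := transfer c (fun m => (m%:R - n%:R) ^+ j) n.

Lemma raw_moments : exists2 C : K, 0 <= C & forall c n,
  [/\ `|raw 1 c n - mu c| <= C / n.+1%:R, `|raw 2 c n - nu * n%:R| <= C,
      `|raw 3 c n| <= C * n.+1%:R & `|raw 4 c n| <= C * n.+1%:R ^+ 2].
Proof.
have n1 n : 1 <= n.+1%:R :> K by rewrite -[1]/(1%:R) ler_nat.
have [C1 [lam l01 hC1']] := mean_bound q01; have [E E0 hE] := geometric_decay lam l01.
have C10 : 0 <= C1 by have := hC1' p0 0%N; rewrite mulr1; apply: le_trans.
have [C2' hC2'] := variance_bound q01.
have C2'0 : 0 <= C2' by apply: le_trans (hC2' p0 0%N).
have [C3 hC3] := third_bound q01; have [C4 hC4] := fourth_bound q01.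
have C30 : 0 <= C3 by have := hC3 p0 0%N; rewrite mulr1; apply: le_trans.
have C40 : 0 <= C4 by have := hC4 p0 0%N; rewrite expr1n mulr1; apply: le_trans.
have nu0 := ltW (nu_gt0 q01).
have [M M0 hM] := cfg_bound mu.
have hC1 c n : `|centered q 1 c n| <= C1.
  by apply: (le_trans (hC1' c n)); case/andP: l01 => *; rewrite ler_piMr// exprn_ile1// ltW.
have [Q Q0 hC2] : exists2 Q : K, 0 <= Q &
    forall c n, `|centered q 2 c n| <= Q * n.+1%:R.
  exists (C2' + nu); first by rewrite addr_ge0.
  move=> c n; rewrite -[centered _ _ _ _](subrK (nu * n%:R)).
  apply: (le_trans (ler_normD _ _)); rewrite mulrDl; apply: lerD.
    by apply: (le_trans (hC2' c n)); rewrite ler_peMr.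
  by rewrite normrM (ger0_norm nu0) normr_nat ler_wpM2l// ler_nat.
have n2 : `|2| <= 2 :> K by rewrite ger0_norm.
have n3 : `|3| <= 3 :> K by rewrite ger0_norm.
have n4 : `|4| <= 4 :> K by rewrite ger0_norm.
have n6 : `|6| <= 6 :> K by rewrite ger0_norm.
pose B1 := C1 * E.
pose B2 := C2' + 2 * M * C1 + M ^+ 2.
pose B3 := C3 + 3 * M * Q + 3 * M ^+ 2 * C1 + M ^+ 3.
pose B4 := C4 + 4 * M * C3 + 6 * M ^+ 2 * Q + 4 * M ^+ 3 * C1 + M ^+ 4.
have B10 : 0 <= B1 by rewrite mulr_ge0.
have B20 : 0 <= B2 by rewrite /B2; nonneg.
have B30 : 0 <= B3 by rewrite /B3; nonneg.
have B40 : 0 <= B4 by rewrite /B4; nonneg.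
exists (B1 + B2 + B3 + B4); first by lra.
move=> c n.
have rawE j : raw j c n = transfer c (fun m => (m%:R - (n%:R + mu c) + mu c) ^+ j) n.
  by apply: transfer_ext => m; congr (_ ^+ _); ring.
rewrite !rawE.
have [-> -> -> ->] := transfer_shift_pow q01 c n (n%:R + mu c) (mu c).
rewrite -!/(centered _ _ _ _).
have N0 : 0 <= n.+1%:R :> K by [].
have NN : n.+1%:R <= n.+1%:R ^+ 2 :> K by rewrite expr2 ler_peMr.
have N1 := n1 n.
split.
- rewrite addrK; apply: (le_trans (hC1' c n)).
  apply: (le_trans (ler_wpM2l C10 (hE n))); rewrite mulrA ler_wpM2r ?invr_ge0//.
  by rewrite -/B1; lra.
- apply: (@le_trans _ _ B2); last lra.
  rewrite (_ : _ - _ = (centered q 2 c n - nu * n%:R) + 2 * mu c * centered q 1 c n + mu c ^+ 2); last by ring.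
  exact: (normD_le (normD_le (hC2' c n) (normM_le (normM_le n2 (hM c)) (hC1 c n))) (normX_le 2 (hM c))).
- apply: (@le_trans _ _ (B3 * n.+1%:R)); last by rewrite ler_wpM2r//; lra.
  apply: (le_trans (normD_le (normD_le (normD_le (hC3 c n) (normM_le (normM_le n3 (hM c)) (hC2 c n)))
    (normM_le (normM_le n3 (normX_le 2 (hM c))) (hC1 c n))) (normX_le 3 (hM c)))).
  rewrite (_ : B3 * _ = C3 * n.+1%:R + 3 * M * (Q * n.+1%:R) +
    3 * M ^+ 2 * C1 * n.+1%:R + M ^+ 3 * n.+1%:R); last by rewrite /B3; ring.
  apply: lerD; last by rewrite ler_peMr ?exprn_ge0.
  apply: lerD => //; rewrite ler_peMr//.
  by repeat (first [done | apply: mulr_ge0 | apply: exprn_ge0]).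
- apply: (@le_trans _ _ (B4 * n.+1%:R ^+ 2)); last by rewrite ler_wpM2r ?exprn_ge0//; lra.
  apply: (le_trans (normD_le (normD_le (normD_le (normD_le (hC4 c n) (normM_le (normM_le n4 (hM c)) (hC3 c n)))
    (normM_le (normM_le n6 (normX_le 2 (hM c))) (hC2 c n)))
    (normM_le (normM_le n4 (normX_le 3 (hM c))) (hC1 c n))) (normX_le 4 (hM c)))).
  have N21 := le_trans N1 NN.
  rewrite (_ : B4 * _ = C4 * n.+1%:R ^+ 2 + 4 * M * (C3 * n.+1%:R ^+ 2) +
    6 * M ^+ 2 * (Q * n.+1%:R ^+ 2) + 4 * M ^+ 3 * C1 * n.+1%:R ^+ 2 +
    M ^+ 4 * n.+1%:R ^+ 2); last by rewrite /B4; ring.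
  apply: lerD; last by rewrite ler_peMr ?exprn_ge0.
  apply: lerD; last first.
    rewrite ler_peMr//; by repeat (first [done | apply: mulr_ge0 | apply: exprn_ge0]).
  apply: lerD; last first.
    rewrite ler_wpM2l ?ler_wpM2l//; by repeat (first [done | apply: mulr_ge0 | apply: exprn_ge0]).
  apply: lerD => //.
  rewrite ler_wpM2l ?ler_wpM2l//; by repeat (first [done | apply: mulr_ge0 | apply: exprn_ge0]).
Qed.

Lemma linear_tame (phi : nat -> K) (A : K) :
  (forall m, `|phi m| <= A * m.+1%:R) -> tame phi.
Proof.
move=> hA; exists A => m; apply: (le_trans (hA m)).
have A0 : 0 <= A by have := hA 0%N; rewrite mulr1; apply: le_trans.
have m1 : 1 <= m.+1%:R :> K by rewrite -[1]/(1%:R) ler_nat.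
by rewrite ler_wpM2l// -[leLHS]expr1; apply: ler_weXn2l.
Qed.

(** A class inside [tame] that [transfer] preserves, since the mean of the kernel is n + O(1); this
    allows the operators of successive sites to be composed. *)
Definition lingrowth (phi : nat -> K) := exists A, forall m, `|phi m| <= A * m.+1%:R.

Lemma lingrowth_tame phi : lingrowth phi -> tame phi.
Proof. by move=> [A]; exact: linear_tame. Qed.

Lemma lingrowth_bounded phi (B : K) : (forall m, `|phi m| <= B) -> lingrowth phi.
Proof.
move=> hB; exists B => m; apply: (le_trans (hB m)).
rewrite ler_peMr ?(le_trans _ (hB m))//.
by rewrite -[1]/(1%:R) ler_nat.
Qed.

Lemma lingrowth_transfer c phi : lingrowth phi -> lingrowth (transfer c phi).
Proof.
move=> lphi; have tphi := lingrowth_tame _ lphi; move: lphi => [A hA].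
have [C C0 hC] := raw_moments; have [M M0 hM] := cfg_bound mu.
have A0 : 0 <= A by have := hA 0%N; rewrite mulr1; apply: le_trans.
exists (A * (1 + (C + M))) => n.
have tN : tame (fun m => A * (n.+1%:R + (m%:R - n%:R) ^+ 1)).
  have := tame_lin (A * n.+1%:R) A _ _ (tame_const 1) (tame_pow n%:R 1 isT).
  by congr tame; apply/funext => m; ring.
have ub : transfer c (fun m => A * (n.+1%:R + (m%:R - n%:R) ^+ 1)) n <= A * (1 + (C + M)) * n.+1%:R.
  rewrite (transfer_ext _ _ (fun m => (A * n.+1%:R) * 1 + A * (m%:R - n%:R) ^+ 1)); last first.
    by move=> m; ring.
  rewrite (transfer_lin q01) ?transfer_cst//; [|exact: tame_const|exact: tame_pow].
  rewrite -/(raw 1 c n) mulr1 -mulrDr -mulrA ler_wpM2l//.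
  have [h1 _ _ _] := hC c n.
  have n1 : 1 <= n.+1%:R :> K by rewrite -[1]/(1%:R) ler_nat.
  have := ler_norm (raw 1 c n - mu c); have := ler_norm (mu c); have := hM c.
  have : C / n.+1%:R <= C by rewrite ler_pdivrMr ?ler_peMr// ltr0n.
  have CM : 0 <= C + M by rewrite addr_ge0.
  have := mulr_ge0 CM (_ : 0 <= n.+1%:R - 1); rewrite subr_ge0 => /(_ n1).
  move=> h2 /(le_trans h1) {}h1 h3 h4 h5; set N := n.+1%:R in h2 n1 *; lra.
have le m : - (A * (n.+1%:R + (m%:R - n%:R) ^+ 1)) <= phi m /\ phi m <= A * (n.+1%:R + (m%:R - n%:R) ^+ 1).
  have := hA m; rewrite ler_norml expr1 (_ : n.+1%:R + _ = m.+1%:R) => [/andP[]//|].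
  by rewrite -!natr1; ring.
rewrite ler_norml; apply/andP; split; last first.
  by apply: le_trans ub; apply: transfer_le => // m; have [] := le m.
rewrite lerNl; apply: le_trans ub.
rewrite (_ : - _ = transfer c (fun m => -1 * phi m + 0 * phi m) n); last first.
  by rewrite (transfer_lin q01)// mul0r addr0 mulN1r.
apply: transfer_le => //; first exact: tame_lin.
by move=> m; rewrite mul0r addr0 mulN1r lerNl; have [] := le m.
Qed.

(* At criticality the drift of [ln (m + 1)] vanishes up to [O(1 / m ^ 2)]; the
   term [- a / (m + 1)] makes it negative for large [a]. *)
Definition glog (a : K) (m : nat) : K := ln m.+1%:R + a - a / m.+1%:R.

Lemma glog_ge0 a m : 0 <= a -> 0 <= glog a m.
Proof.
move=> a0; have m1 : 1 <= m.+1%:R :> K by rewrite -[1]/(1%:R) ler_nat.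
rewrite /glog -addrA addr_ge0 ?ln_ge0// subr_ge0 ler_pdivrMr ?ltr0n//.
by rewrite ler_peMr.
Qed.

Lemma glog_le a m n : 0 <= a -> (m <= n)%N -> glog a m <= glog a n.
Proof.
move=> a0 mn; have le : m.+1%:R <= n.+1%:R :> K by rewrite ler_nat.
rewrite /glog; apply: lerB.
  by rewrite lerD2r ler_ln ?posrE ?ltr0n.
by rewrite ler_wpM2l// lef_pV2 ?posrE ?ltr0n.
Qed.

Lemma glog0 a : glog a 0 = 0.
Proof. by rewrite /glog ln1 add0r divr1 subrr. Qed.

Lemma lingrowth_glog a : 0 <= a -> lingrowth (glog a).
Proof.
move=> a0; exists (1 + a) => m; rewrite ger0_norm ?glog_ge0//.
have m1 : 1 <= m.+1%:R :> K by rewrite -[1]/(1%:R) ler_nat.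
have : ln m.+1%:R < m.+1%:R :> K by apply: ln_sublinear; rewrite ltr0n.
have : 0 <= a / m.+1%:R by rewrite divr_ge0.
have : a <= a * m.+1%:R by rewrite ler_peMr.
by rewrite /glog; move: (m.+1%:R) (ln _) m1 => N l; lra.
Qed.

(* The odd-degree Taylor polynomials of [ln (1 + x)] and of [- 1 / (1 + x)]
   are upper bounds on the whole half-line [x > -1]. *)
Lemma glog_le_poly a n m (i z : K) : 0 <= a ->
  i = n.+1%:R^-1 -> z = m%:R - n%:R ->
  glog a m <= glog a n + (i + a * i ^+ 2) * z - (i ^+ 2 / 2 + a * i ^+ 3) * z ^+ 2
      + (i ^+ 3 / 3 + a * i ^+ 4) * z ^+ 3.
Proof.
move=> a0 iE zE; set N := n.+1%:R : K; set M := m.+1%:R : K.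
have N0 : 0 < N by rewrite ltr0n.
have M0 : 0 < M by rewrite ltr0n.
have i0 : 0 < i by rewrite iE invr_gt0.
have iN : i * N = 1 by rewrite iE mulVf// gt_eqF.
pose x := i * z.
have xE : 1 + x = M / N.
  rewrite -[1]iN /x zE -mulrDr mulrC -/N iE; congr (_ * _).
  by rewrite /N /M -!natr1; ring.
have x0 : 0 < 1 + x by rewrite xE divr_gt0.
have x1 : -1 < x by lra.
have h1 := ln_le_poly3 _ x1.
have lnE : ln (1 + x) = ln M - ln N by rewrite xE ln_div ?posrE.
have y0 : 0 < (1 + x)^-1 by rewrite invr_gt0; lra.
have h2 : 1 - x + x ^+ 2 - x ^+ 3 <= (1 + x)^-1.
  rewrite -[(1 + x)^-1]mul1r ler_pdivlMr; last by lra.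
  rewrite (_ : _ * _ = 1 - x ^+ 4); last by ring.
  by rewrite gerBl exprn_even_ge0.
have aM : a / M = a * i * (1 + x)^-1 by rewrite xE iE -/N; field; rewrite !gt_eqF.
have h3 : a * i * (1 - x + x ^+ 2 - x ^+ 3) <= a / M.
  by rewrite aM ler_wpM2l// mulr_ge0// ltW.
rewrite /glog -/N -/M -iE.
rewrite [X in _ <= X](_ : _ = ln N + a - a * i + (x - x ^+ 2 / 2 + x ^+ 3 / 3) +
  a * i * (x - x ^+ 2 + x ^+ 3)); last by rewrite /x; ring.
move: h1 h3; rewrite lnE; clear; clearbody x.
move: (a / M) (ln M) (ln N) => aM lM lN h1 h3; lra.
Qed.

Lemma glog_superharmonic : exists2 a : K, 0 <= a &
  exists n0, forall c n, mu c <= nu / 2 -> (n0 <= n)%N ->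
    transfer c (glog a) n <= glog a n.
Proof.
have [C C0 hC] := raw_moments; have nu0 := (nu_gt0 q01).
(* C' bounds the coefficient of 1 / N ^ 2 that does not involve a. The correction contributes - a nu
   / 2 = - 2 C' to it, and the remaining terms with a are at most C' from n0 on. *)
pose C' := 2 * C + nu / 2; have C'0 : 0 < C' by rewrite /C'; lra.
pose a := 4 * C' / nu; have a0 : 0 <= a by rewrite /a divr_ge0//; lra.
exists a => //.
have [n0 hn0] : exists n0 : nat, a * (3 * C + nu) / C' <= n0%:R.
  by exists (Num.truncn (a * (3 * C + nu) / C')).+1; apply/ltW; exact: truncnS_gt.
exists n0 => c n hmu n0n.
have [h1 h2 h3 _] := hC c n.
set N := n.+1%:R : K in h1 h3.
have N0 : 0 < N by rewrite ltr0n.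
pose i := N^-1; have i0 : 0 < i by rewrite invr_gt0.
have iN : i * N = 1 by rewrite mulVf// gt_eqF.
have nE : n%:R = N - 1 :> K by rewrite /N -natr1 addrK.
have hN : a * (3 * C + nu) <= C' * N.
  rewrite [C' * N]mulrC -ler_pdivrMr//; apply: (le_trans hn0).
  by rewrite ler_nat; apply: leqW.
apply: (@le_trans _ _ (glog a n + (i + a * i ^+ 2) * raw 1 c n
   - (i ^+ 2 / 2 + a * i ^+ 3) * raw 2 c n + (i ^+ 3 / 3 + a * i ^+ 4) * raw 3 c n)).
  have /= := transfer_poly q01 c n n%:R (glog a n) (i + a * i ^+ 2)
    (- (i ^+ 2 / 2 + a * i ^+ 3)) (i ^+ 3 / 3 + a * i ^+ 4) 0.
  rewrite -!/(raw _ _ _) mul0r addr0 mulNr => <-.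
  apply: transfer_le => //; [exact/lingrowth_tame/lingrowth_glog|exact: tame_poly|].
  by move=> m; rewrite mul0r addr0 mulNr; exact: glog_le_poly.
move: h1 h2 h3; rewrite !ler_norml => /andP[_ h1] /andP[h2 _] /andP[_ h3].
have ige0 := ltW i0.
have i1 : 0 <= i + a * i ^+ 2 by nonneg.
have i2 : 0 <= i ^+ 2 / 2 + a * i ^+ 3 by nonneg.
have i3 : 0 <= i ^+ 3 / 3 + a * i ^+ 4 by nonneg.
have g1 : raw 1 c n <= nu / 2 + C * i.
  by move: h1; rewrite -[C / N]/(C * i); move: (C * i) => Ci; rewrite lerBlDl => /le_trans; apply; rewrite lerD2r.
have g2 : nu * (N - 1) - C <= raw 2 c n by rewrite -nE; lra.
have h5 : a * nu = 4 * C' by rewrite /a; field; rewrite gt_eqF.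
clearbody i a.
have k1 := ler_wpM2l i1 g1; have k2 := ler_wpM2l i2 g2; have k3 := ler_wpM2l i3 h3.
suff : (i + a * i ^+ 2) * (nu / 2 + C * i) - (i ^+ 2 / 2 + a * i ^+ 3) * (nu * (N - 1) - C) +
    (i ^+ 3 / 3 + a * i ^+ 4) * (C * N) <= 0.
  move: k1 k2 k3; move: (i + a * i ^+ 2) (i ^+ 2 / 2 + a * i ^+ 3) (i ^+ 3 / 3 + a * i ^+ 4) => u v w.
  move: (u * _) (v * (_ - _)) (w * (C * N)) => *; lra.
(* Sorted by powers of i, with i * N kept as a factor: the terms of order i cancel exactly since i *
   N = 1. *)
rewrite (_ : _ + _ = i ^+ 2 * (C + (nu + C) / 2 + C / 3 * (i * N) + a * (nu / 2) - a * nu * (i * N)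
   + a * i * (2 * C + nu + C * (i * N) - C + C)) + i * nu / 2 * (1 - i * N)); last by field.
rewrite iN subrr mulr0 addr0 !mulr1.
rewrite pmulr_rle0 ?exprn_gt0//.
have h4 : a * i * (3 * C + nu) <= C'.
  have := ler_wpM2l (ltW i0) hN; rewrite (_ : i * (C' * N) = C' * (i * N)); last by ring.
  by rewrite iN; lra.
by rewrite /C' in h5 h4 *; lra.
Qed.

End Lyapunov.

(** * Global Lyapunov functions for extinction and for survival *)

Section LyapunovFunctions.
Context {K : realType} {q : K}.
Hypothesis q01 : 0 < q < 1.
Local Notation kern := (kern q).
Local Notation raw := (@raw K q).
Local Notation transfer := (transfer q).
Local Notation mu := (mu q).
Local Notation nu := (nu q).

Lemma transfer_ge_term c phi n k : tame phi -> (forall m, 0 <= phi m) ->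
  kern n c k * phi k <= transfer c phi n.
Proof.
move=> tphi phi0; have cphi := tame_cvg q01 n c phi tphi.
have t0 m : 0 <= kern n c m * phi m by rewrite mulr_ge0// kern_ge0.
have nd : nondecreasing_seq (series (fun m => kern n c m * phi m)).
  by apply: nondecreasing_series => m _ _; exact: t0.
apply: le_trans (nondecreasing_cvgn_le nd cphi k.+1).
by rewrite seriesSr lerDr /series /= sumr_ge0.
Qed.

Definition alive (m : nat) : K := (0 < m)%:R.

Lemma lingrowth_alive : lingrowth alive.
Proof. by apply: (lingrowth_bounded _ 1) => m; rewrite normr_nat lern1 leq_b1. Qed.

Lemma transfer_alive c n : transfer c alive n <= 1 - kern n c 0.
Proof.
pose dead (m : nat) : K := (m == 0%N)%:R.
have td : tame dead.
  by apply/lingrowth_tame/(lingrowth_bounded _ 1) => m; rewrite normr_nat lern1 leq_b1.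
rewrite (transfer_ext _ _ (fun m => 1 * 1 + -1 * dead m)); last first.
  by move=> [|m]; rewrite /alive /dead /= ?mulr0 ?addr0 ?mulr1// subrr.
rewrite (transfer_lin q01)//; last exact: tame_const.
rewrite transfer_cst// mulr1 mulN1r lerD2l lerN2.
have := transfer_ge_term c dead n 0 td; rewrite mulr1; apply.
by move=> m; exact: ler0n.
Qed.

(** [glog] is superharmonic only from n0 on. From any n > 0 the chain dies in one step with
    probability [kern n c 0] > 0, so adding Kc times the indicator of being alive lowers the drift
    by at least Kc times this probability. As finitely many n and c are in question, one Kc repairs
    all of them. *)
Lemma recurrence_lyapunov : exists F : nat -> K,
  [/\ lingrowth F, (forall m n, (m <= n)%N -> F m <= F n), F 0%N = 0,
      (forall M : K, exists n, M <= F n) &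
      forall c, mu c <= nu / 2 -> forall n, transfer c F n <= F n].
Proof.
have [a a0 [n0 hn0]] := glog_superharmonic q01.
have tg := lingrowth_glog a a0.
have [Kc Kc0 hKc] : exists2 Kc : K, 0 <= Kc & forall n c, (0 < n < n0)%N ->
    transfer c (glog a) n - glog a n <= Kc * kern n c 0.
  elim: n0 {hn0} => [|k [Kc Kc0 hKc]]; first by exists 0 => // n c; rewrite andbF.
  have [B B0 hB] := cfg_bound (fun c => (transfer c (glog a) k - glog a k) / kern k c 0).
  exists (Kc + B); first by rewrite addr_ge0.
  move=> n c /andP[n_gt0]; have k0 : 0 <= kern n c 0 by exact: kern_ge0.
  rewrite ltnS leq_eqVlt => /orP[/eqP nk|nk].
    have kp : 0 < kern n c 0 by exact: kern_gt0.
    rewrite -ler_pdivrMr//; apply: (@le_trans _ _ B); last by rewrite lerDr.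
    by apply: (le_trans (ler_norm _)); rewrite nk; exact: hB.
  apply: (le_trans (hKc n c _)); first by rewrite n_gt0.
  by rewrite ler_wpM2r// lerDl.
exists (fun n => Kc * alive n + 1 * glog a n); split.
- have [A hA] := tg; exists (Kc + A) => m.
  rewrite mul1r mulrDl; apply: normD_le => //.
  rewrite normrM ger0_norm// ler_wpM2l//.
  by rewrite normr_nat /alive ler_nat (leq_trans (leq_b1 _)).
- move=> m n mn; rewrite !mul1r; apply: lerD; last exact: glog_le.
  by rewrite ler_wpM2l// ler_nat; case: m mn => //= m; case: n.
- by rewrite glog0 !mulr0 addr0.
- move=> M; exists (Num.truncn (expR M)).
  apply: (@le_trans _ _ (ln (Num.truncn (expR M)).+1%:R)).
    rewrite -[leLHS]expRK ler_ln ?posrE ?expR_gt0 ?ltr0n//.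
    exact/ltW/truncnS_gt.
  rewrite mul1r /glog; set N := Num.truncn _; set k := alive N.
  have n1 : 1 <= N.+1%:R :> K by rewrite -[1]/(1%:R) ler_nat.
  have h1 : 0 <= Kc * k by rewrite mulr_ge0// ler0n.
  have h2 : a / N.+1%:R <= a by rewrite ler_pdivrMr ?ltr0n// ler_peMr.
  by move: h1 h2; move: (a / _) (Kc * k) (ln _) => *; lra.
- move=> c hc n; have ta := lingrowth_tame _ lingrowth_alive.
  have tg' := lingrowth_tame _ tg.
  rewrite (transfer_lin q01)// !mul1r.
  case: n => [|n].
    by rewrite !transfer0.
  have hal := transfer_alive c n.+1.
  rewrite (_ : alive n.+1 = 1)//.
  have [lt|ge] := ltnP n.+1 n0.
    have := hKc n.+1 c lt; have := ler_wpM2l Kc0 hal; lra.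
  have := hn0 c n.+1 hc ge.
  have : transfer c alive n.+1 <= 1 by apply: (le_trans hal); rewrite gerBl kern_ge0.
  by move=> /(ler_wpM2l Kc0); lra.
Qed.

(* When the drift dominates, [ln (m + 1)] is a submartingale with increments of
   conditional variance [O(1 / m)], the order of its drift, so that the convex
   function [1 / (A + y)] turns it into a supermartingale for large [A]. *)
Definition invlog (A : K) (m : nat) : K := (A + ln m.+1%:R)^-1.

Lemma invlog_bounds (A : K) m : 1 <= A -> 0 < invlog A m <= 1.
Proof.
move=> A1; have : 0 <= ln m.+1%:R :> K.
  by apply: ln_ge0; rewrite -[leLHS]/(1%:R) ler_nat.
move=> l0; have d1 : 1 <= A + ln m.+1%:R by lra.
by rewrite /invlog invr_gt0 (lt_le_trans ltr01 d1)/= invf_le1// (lt_le_trans ltr01 d1).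
Qed.

(** Write x = i z and d = ln (1 + x). For x >= -1 / 2 the exact second order expansion of 1 / (L +
    d) applies, with L + d >= A and d ^ 2 <= 4 x ^ 2, whence 4 / A. For x < -1 / 2 the value is at
    most 1 / A, which 16 x ^ 4 / A exceeds. *)
Lemma invlog_le_poly (A : K) n m (i L z : K) : 1 <= A ->
  i = n.+1%:R^-1 -> L = A + ln n.+1%:R -> z = m%:R - n%:R ->
  invlog A m <= invlog A n + (- i / L ^+ 2) * z +
    ((1 / 2 + 4 / A) * i ^+ 2 / L ^+ 2) * z ^+ 2 +
    (- (i ^+ 3 / 3 / L ^+ 2)) * z ^+ 3 + (i ^+ 4 / L ^+ 2 + 16 / A * i ^+ 4) * z ^+ 4.
Proof.
move=> A1 iE LE zE; set N := n.+1%:R : K; set M := m.+1%:R : K.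
have N0 : 0 < N by rewrite ltr0n.
have M0 : 0 < M by rewrite ltr0n.
have M1 : 1 <= M by rewrite -[1]/(1%:R) ler_nat.
have lN : 0 <= ln N by apply: ln_ge0; rewrite -[1]/(1%:R) ler_nat.
have lM : 0 <= ln M by exact: ln_ge0.
have i0 : 0 < i by rewrite iE invr_gt0.
have iN : i * N = 1 by rewrite iE mulVf// gt_eqF.
have [x xD xE] : exists2 x, x = i * z & 1 + x = M / N.
  exists (i * z) => //; rewrite -[1]iN zE -mulrDr mulrC -/N iE; congr (_ * _).
  by rewrite /N /M -!natr1; ring.
have x0 : 0 < 1 + x by rewrite xE divr_gt0.
have dE : ln M = ln N + ln (1 + x) by rewrite xE ln_div ?posrE//; ring.
pose d := ln (1 + x); rewrite -/d in dE.
have L0 : 0 < L by rewrite LE -/N; lra.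
have A0 : 0 < A by lra.
have Ld : A <= L + d by rewrite LE -/N; move: dE lM; lra.
have Ld0 : 0 < L + d by lra.
have -> : invlog A n + (- i / L ^+ 2) * z + ((1 / 2 + 4 / A) * i ^+ 2 / L ^+ 2) * z ^+ 2 +
    (- (i ^+ 3 / 3 / L ^+ 2)) * z ^+ 3 + (i ^+ 4 / L ^+ 2 + 16 / A * i ^+ 4) * z ^+ 4 =
    L^-1 + (- x + x ^+ 2 / 2 - x ^+ 3 / 3 + x ^+ 4 + 4 / A * x ^+ 2) / L ^+ 2 + 16 / A * x ^+ 4.
  by rewrite /invlog -/N -LE xD; field; rewrite !gt_eqF.
have -> : invlog A m = (L + d)^-1 by rewrite /invlog -/M LE -/N dE addrA.
have L2 : 0 < (L ^+ 2)^-1 by rewrite invr_gt0 exprn_gt0.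
have x4 : 0 <= x ^+ 4 by exact: exprn_even_ge0.
have Ai : 0 < A^-1 by rewrite invr_gt0.
have [xge|xlt] := leP (-1 / 2) x.
  have h1 := ln_ge_poly4 _ xge; have h2 := ln_sq_le _ xge; rewrite -/d in h1 h2.
  have e : (L + d)^-1 = L^-1 + (- d) / L ^+ 2 + d ^+ 2 * (L + d)^-1 / L ^+ 2.
    by field; rewrite !gt_eqF.
  have h3 : (L + d)^-1 <= A^-1 by rewrite lef_pV2.
  have h4 : d ^+ 2 * (L + d)^-1 <= 4 * x ^+ 2 * A^-1.
    by apply: ler_pM => //; rewrite ?sqr_ge0// ltW// invr_gt0.
  have h5 : - d + d ^+ 2 * (L + d)^-1 <=
      - x + x ^+ 2 / 2 - x ^+ 3 / 3 + x ^+ 4 + 4 / A * x ^+ 2.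
    by rewrite (_ : 4 / A * x ^+ 2 = 4 * x ^+ 2 * A^-1); [lra|ring].
  have h6 := ler_wpM2r (ltW L2) h5.
  have h7 : 0 <= 16 / A * x ^+ 4 by rewrite mulr_ge0// divr_ge0// ltW.
  rewrite {}e; move: h6 h7; rewrite mulrDl.
  move: (- d / L ^+ 2) (d ^+ 2 * _ / L ^+ 2) (16 / A * _) (_ / L ^+ 2) (L^-1) => *; lra.
have h3 : (L + d)^-1 <= A^-1 by rewrite lef_pV2.
have h4 : 1 <= 16 * x ^+ 4.
  have : 1 / 4 <= x ^+ 2 by nra.
  rewrite (_ : x ^+ 4 = x ^+ 2 * x ^+ 2); last by ring.
  by move: (x ^+ 2) => y; nra.
have h5 : 0 <= (- x + x ^+ 2 / 2 - x ^+ 3 / 3 + x ^+ 4 + 4 / A * x ^+ 2) / L ^+ 2.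
  rewrite mulr_ge0//; last exact: ltW.
  have : 0 <= 4 / A * x ^+ 2 by rewrite mulr_ge0 ?sqr_ge0// divr_ge0// ltW.
  have : 0 <= x ^+ 2 by exact: sqr_ge0.
  have : x ^+ 3 <= 0 by rewrite exprSr mulr_ge0_le0 ?sqr_ge0//; lra.
  by lra.
have h6 : A^-1 <= 16 / A * x ^+ 4.
  by rewrite mulrAC ler_peMl// ltW.
have h7 : 0 < L^-1 by rewrite invr_gt0.
move: h5 h6; move: (_ / L ^+ 2) (16 / A * _) => *; lra.
Qed.

Lemma invlog_superharmonic c : nu / 2 < mu c ->
  exists2 A : K, 1 <= A & exists n0, forall n, (n0 <= n)%N ->
    transfer c (invlog A) n <= invlog A n.
Proof.
move=> hmu; have [C C0 hC] := raw_moments q01; have nu0 := nu_gt0 q01.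
pose eta := (mu c - nu / 2) / 2; have eta0 : 0 < eta by rewrite /eta; lra.
(* The term 4 nu / A then costs at most eta, half of the excess mu c - nu / 2 = 2 eta. *)
pose A := 1 + 4 * nu / eta.
have A1 : 1 <= A.
  by rewrite lerDl; apply: divr_ge0; [apply: mulr_ge0 => //|]; exact: ltW.
have hA : 4 / A * nu <= eta.
  have : 4 * nu <= eta * A.
    rewrite (_ : eta * A = eta + 4 * nu); first by rewrite lerDr ltW.
    by rewrite /A; field; rewrite gt_eqF.
  move=> h4; rewrite (_ : 4 / A * nu = (4 * nu) / A); last by ring.
  by rewrite ler_pdivrMr// (lt_le_trans ltr01).
have A0 : 0 < A by lra.
have A4 : 4 / A <= 4 by rewrite ler_pdivrMr// ler_peMr.
exists A => //.
(* 138 = 6 * 23: the 6 comes from L ^ 3 / 6 <= expR L = expR A * N, and 23 = 7 + 16 adds the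
   coefficients of the two error terms bounded in s2 and s3. *)
pose B0 := 138 * C * expR A / eta.
exists (Num.truncn (expR B0)) => n n0n.
have [h1 h2 h3 h4] := hC c n.
set N := n.+1%:R : K in h1 h3 h4.
have N0 : 0 < N by rewrite ltr0n.
have hB : B0 <= ln N.
  rewrite -[leLHS]expRK ler_ln ?posrE ?expR_gt0//.
  apply: (le_trans (ltW (truncnS_gt _))).
  by rewrite ler_nat.
pose L := A + ln N.
have lN : 0 <= ln N by apply: ln_ge0; rewrite -[1]/(1%:R) ler_nat.
have L1 : 1 <= L by rewrite /L; lra.
have hL : 23 * C * L ^+ 2 <= eta * N.
  have L3 : L ^+ 3 / 6 <= expR A * N.
    have := expR_ge1Dxn 2 (_ : 0 <= L); rewrite (_ : 3`!%:R = 6)//.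
    rewrite {3}/L expRD lnK ?posrE// => h; have := h (le_trans ler01 L1).
    by lra.
  have e0 : 0 < expR A by exact: expR_gt0.
  have hB' : 138 * C * expR A <= eta * L.
    rewrite [eta * L]mulrC -ler_pdivrMr//; apply: (le_trans hB).
    by rewrite lerDr; lra.
  have l2 : 0 <= L ^+ 2 by exact: sqr_ge0.
  have k1 := ler_wpM2r l2 hB'.
  have k2 := ler_wpM2l (ltW eta0) L3.
  rewrite -(ler_pM2r e0).
  rewrite (_ : eta * N * _ = eta * (expR A * N)); last by ring.
  apply: le_trans k2; rewrite (_ : eta * _ = eta * L * L ^+ 2 / 6); last by field.
  rewrite ler_pdivlMr//; apply: le_trans k1.
  by rewrite le_eqVlt; apply/orP; left; apply/eqP; ring.
pose i := N^-1.
have i0 : 0 < i by rewrite invr_gt0.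
have iN : i * N = 1 by rewrite mulVf// gt_eqF.
apply: (@le_trans _ _ (invlog A n + (- i / L ^+ 2) * raw 1 c n +
    ((1 / 2 + 4 / A) * i ^+ 2 / L ^+ 2) * raw 2 c n +
    (- (i ^+ 3 / 3 / L ^+ 2)) * raw 3 c n +
    (i ^+ 4 / L ^+ 2 + 16 / A * i ^+ 4) * raw 4 c n)).
  have /= := transfer_poly q01 c n n%:R (invlog A n) (- i / L ^+ 2)
    ((1 / 2 + 4 / A) * i ^+ 2 / L ^+ 2) (- (i ^+ 3 / 3 / L ^+ 2))
    (i ^+ 4 / L ^+ 2 + 16 / A * i ^+ 4).
  rewrite -!/(raw _ _ _) => <-.
  apply: transfer_le => //; last by move=> m; exact: invlog_le_poly.
    apply/lingrowth_tame/(lingrowth_bounded _ 1) => m.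
    by have /andP[? ?] := invlog_bounds A m A1; rewrite ger0_norm// ltW.
  exact: tame_poly.
move: h1 h2 h3 h4; rewrite !ler_norml => /andP[h1 _] /andP[_ h2] /andP[h3 _] /andP[_ h4].
have g1 : mu c - C * i <= raw 1 c n.
  by move: h1; rewrite -[C / N]/(C * i); move: (C * i) => Ci; rewrite lerBrDr addrC.
have g2 : raw 2 c n <= nu * N + C.
  move: h2; rewrite lerBlDr => /le_trans; apply; rewrite addrC lerD2r ler_wpM2l//; first exact: ltW.
  by rewrite ler_nat.
have L0 : 0 < (L ^+ 2)^-1 by rewrite invr_gt0 exprn_gt0//; lra.
have ige0 := ltW i0; have Lge0 := ltW L0.
have Age0 : 0 <= A^-1 by rewrite invr_ge0; lra.
rewrite -!addrA gerDl.
set j := (L ^+ 2)^-1 in L0 Lge0 *.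
have jL : j * L ^+ 2 = 1 by rewrite mulVf// gt_eqF// exprn_gt0//; lra.
have c1 : 0 <= i * j by nonneg.
have c2 : 0 <= (1 / 2 + 4 / A) * i ^+ 2 * j by nonneg.
have c3 : 0 <= i ^+ 3 / 3 * j by nonneg.
have c4 : 0 <= i ^+ 4 * j + 16 / A * i ^+ 4 by nonneg.
have k1 := ler_wpM2l c1 g1; have k2 := ler_wpM2l c2 g2.
have k3 := ler_wpM2l c3 h3; have k4 := ler_wpM2l c4 h4.
apply: (@le_trans _ _ (- (i * j * (mu c - C * i)) + (1 / 2 + 4 / A) * i ^+ 2 * j * (nu * N + C)
   - i ^+ 3 / 3 * j * (- (C * N)) + (i ^+ 4 * j + 16 / A * i ^+ 4) * (C * N ^+ 2))).
  rewrite [leLHS](_ : _ = - (i * j * raw 1 c n) +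
    (1 / 2 + 4 / A) * i ^+ 2 * j * raw 2 c n - i ^+ 3 / 3 * j * raw 3 c n +
    (i ^+ 4 * j + 16 / A * i ^+ 4) * raw 4 c n); last by ring.
  by apply: lerD k4; apply: lerB k3; apply: lerD k2; rewrite lerN2.
clearbody i j A.
rewrite [leLHS](_ : _ = j * (i * (- mu c + (1 / 2 + 4 / A) * nu * (i * N)) +
   i ^+ 2 * C * (1 + (1 / 2 + 4 / A) + (i * N) / 3 + (i * N) ^+ 2)) +
   16 / A * i ^+ 2 * C * (i * N) ^+ 2); last by field; rewrite gt_eqF.
rewrite iN expr1n !mulr1.
have -> : 16 / A * i ^+ 2 * C = j * (i ^+ 2 * (16 / A * C * L ^+ 2)).
  by rewrite -[LHS]mul1r -jL; ring.
rewrite -mulrDr pmulr_rle0//.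
rewrite [leLHS](_ : _ = i * ((- mu c + (1 / 2 + 4 / A) * nu) +
  i * (C * (1 + (1 / 2 + 4 / A) + 1 / 3 + 1) + 16 / A * C * L ^+ 2))); last by ring.
rewrite pmulr_rle0//.
have s1 : - mu c + (1 / 2 + 4 / A) * nu <= - eta by move: hA; rewrite /eta; lra.
have s2 : C * (1 + (1 / 2 + 4 / A) + 1 / 3 + 1) <= 7 * C * L ^+ 2.
  have : C * (4 / A) <= C * 4 by rewrite ler_wpM2l.
  have : C <= C * L ^+ 2 by rewrite ler_peMr// exprn_ege1.
  by lra.
have s3 : 16 / A * C * L ^+ 2 <= 16 * C * L ^+ 2.
  rewrite -!mulrA ler_wpM2l//; rewrite ler_piMl ?invf_le1//.
  by apply: mulr_ge0 => //; exact: sqr_ge0.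
have s4 : i * (C * (1 + (1 / 2 + 4 / A) + 1 / 3 + 1) + 16 / A * C * L ^+ 2) <= i * (eta * N).
  by rewrite ler_wpM2l//; apply: le_trans hL; lra.
by move: s4; rewrite [i * (eta * N)]mulrCA iN mulr1; lra.
Qed.

(** Dividing [invlog] by its value at n0 and truncating at 1 extends superharmonicity below n0:
    there g equals 1, its maximum. *)
Lemma transience_lyapunov c : nu / 2 < mu c -> exists g : nat -> K,
  [/\ (forall n, 0 <= g n <= 1), g 0%N = 1, (exists n, g n < 1) &
      forall n, transfer c g n <= g n].
Proof.
move=> /invlog_superharmonic[A A1 [n0 hn0]].
have f0 m : 0 < invlog A m by have /andP[] := invlog_bounds A m A1.
have f1 m : invlog A m <= 1 by have /andP[] := invlog_bounds A m A1.
have den m : 0 < A + ln m.+1%:R.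
  by have := f0 m; rewrite /invlog invr_gt0.
have nonincr m n : (m <= n)%N -> invlog A n <= invlog A m.
  by move=> mn; rewrite lef_pV2 ?posrE// lerD2l ler_ln ?posrE ?ltr0n// ler_nat.
have r0 m : 0 <= invlog A m / invlog A n0 by rewrite divr_ge0// ltW.
have tf : tame (invlog A).
  by apply/lingrowth_tame/(lingrowth_bounded _ 1) => m; rewrite ger0_norm// ltW.
pose g m := Num.min (invlog A m / invlog A n0) 1.
have g1 m : g m <= 1 by rewrite ge_min lexx orbT.
have g0 m : 0 <= g m by rewrite le_min r0 ler01.
have tg : tame g.
  by apply/lingrowth_tame/(lingrowth_bounded _ 1) => m; rewrite ger0_norm.
exists g; split.
- by move=> n; rewrite g0 g1.
- by apply/min_idPr; rewrite ler_pdivlMr// mul1r nonincr.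
- exists n0.+1; rewrite gt_min ltr_pdivrMr// mul1r; apply/orP; left.
  by rewrite ltf_pV2 ?posrE// ltrD2l ltr_ln ?posrE ?ltr0n// ltr_nat.
- move=> n; rewrite le_min; apply/andP; split; last first.
    rewrite -(transfer_cst q01 c 1 n); apply: transfer_le => //; exact: tame_const.
  have [le|/ltnW le] := leqP n0 n; last first.
    apply: (@le_trans _ _ 1).
      rewrite -(transfer_cst q01 c 1 n); apply: transfer_le => //; exact: tame_const.
    by rewrite ler_pdivlMr// mul1r nonincr.
  apply: (@le_trans _ _ (transfer c (fun m => (invlog A n0)^-1 * invlog A m + 0 * 0) n)).
    apply: transfer_le => //.
      exact: tame_lin (tame_const 0).
    by move=> m; rewrite mul0r addr0 mulrC /g ge_min lexx.
  rewrite (transfer_lin q01)//; last exact: tame_const.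
  by rewrite mul0r addr0 mulrC ler_wpM2r ?invr_ge0 ?hn0// ltW.
Qed.

End LyapunovFunctions.

(** * Crossing probabilities *)

Section Crossing.
Context {K : realType} {q : K}.
Hypothesis q01 : 0 < q < 1.
Local Notation kern := (kern q).
Local Notation rprob := (rprob q).
Local Notation transfer := (transfer q).
Local Notation mu := (mu q).
Local Notation nu := (nu q).
Local Notation alive := (@alive K).
Local Notation step_right := (@step_right 1 1).
Local Notation step_left := (@step_left 1 1).
Implicit Types (s : state 2 2) (x a b : int) (k n m : nat) (phi psi : nat -> K).

Lemma lingrowth_lin (u v : K) phi psi : lingrowth phi -> lingrowth psi ->
  lingrowth (fun m => u * phi m + v * psi m).
Proof.
move=> [A hA] [B hB]; exists (`|u| * A + `|v| * B) => m.
by rewrite mulrDl -!mulrA; apply: normD_le; apply: normM_le.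
Qed.

Lemma lingrowth_shift phi i : (i <= 1)%N -> lingrowth phi ->
  lingrowth (fun m => phi (m + i)%N).
Proof.
move=> i1 [A hA]; exists (A * 2) => m; apply: (le_trans (hA _)).
have A0 : 0 <= A by have := hA 0%N; rewrite mulr1; apply: le_trans.
by rewrite -mulrA ler_wpM2l// -natrM ler_nat; lia.
Qed.

(* Conditioned on the current state [s], the numbers of rightward jumps that the
   sites x, x + 1, ... still make before the walk returns to the left of x form
   a Markov chain in space: a site y left of the walker, or the walker's own
   site, has to be left once more to the left than it is entered from y - 1. *)
Fixpoint crossing s (k : nat) (x : int) (phi : nat -> K) (n : nat) : K :=
  match k with
  | 0 => phi (n + (x <= s.1)%R)%N
  | k'.+1 => transfer (s.2 x) (crossing s k' (x + 1) phi) (n + (x <= s.1)%R)%N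
  end.

Lemma lingrowth_crossing s k x phi : lingrowth phi -> lingrowth (crossing s k x phi).
Proof.
move=> lphi; elim: k x => [|k IH] x /=; apply: lingrowth_shift; rewrite ?leq_b1//.
exact: lingrowth_transfer.
Qed.

Lemma tame_crossing s k x phi : lingrowth phi -> tame (crossing s k x phi).
Proof. by move=> ?; exact/lingrowth_tame/lingrowth_crossing. Qed.

Lemma crossing_le s k x phi psi : lingrowth phi -> lingrowth psi ->
  (forall m, phi m <= psi m) ->
  forall n, crossing s k x phi n <= crossing s k x psi n.
Proof.
move=> lphi lpsi le; elim: k x => [|k IH] x n //=.
by apply: transfer_le => //; exact: tame_crossing.
Qed.

Lemma crossing_lin s k x (u v : K) phi psi n : lingrowth phi -> lingrowth psi ->
  crossing s k x (fun m => u * phi m + v * psi m) n =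
  u * crossing s k x phi n + v * crossing s k x psi n.
Proof.
move=> lphi lpsi; elim: k x n => [|k IH] x n //=.
rewrite -(transfer_lin q01); [|exact: tame_crossing..].
by apply: transfer_ext => m; exact: IH.
Qed.

Lemma crossing_ext s s' k x phi : (forall y, x <= y -> s.2 y = s'.2 y) ->
  (forall y, x <= y -> (y <= s.1) = (y <= s'.1)) ->
  crossing s k x phi =1 crossing s' k x phi.
Proof.
elim: k x => [|k IH] x hw hx n /=; first by rewrite hx.
rewrite hw// hx//; apply: transfer_ext => m; apply: IH => y xy; [apply: hw|apply: hx]; lia.
Qed.

Lemma crossing_step_right s k phi m :
  crossing (step_right s) k (s.1 + 1) phi m = crossing s k (s.1 + 1) phi m.+1.
Proof.
have e0 : (s.1 + 1 <= s.1 + 1)%R = true by lia.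
have e1 : (s.1 + 1 <= s.1)%R = false by lia.
case: k => [|k] /=; rewrite e0 e1 addn0 addn1//.
rewrite /set_site ifN; last by lia.
apply: transfer_ext => i; apply: crossing_ext => y xy /=; last by lia.
by rewrite /set_site ifN//; lia.
Qed.

(** At the walker's own site this is [transferS]: after a jump to the right the next site, on which
    the walker now stands, owes one more leftward jump, which matches the shift of phi by 1. Sites
    further left transmit the identity by linearity. *)
Lemma crossing_harmonic s k x phi n : lingrowth phi -> x <= s.1 < x + k%:Z ->
  crossing s k x phi n = rprob (s.2 s.1) * crossing (step_right s) k x phi n +
    (1 - rprob (s.2 s.1)) * crossing (step_left s) k x phi n.
Proof.
move=> lphi; elim: k x n => [|k IH] x n hx; first by exfalso; lia.
have [xs|xs] : x = s.1 \/ x < s.1 by lia.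
  subst x; have e1 : (s.1 <= s.1 + 1)%R = true by lia.
  have e2 : (s.1 <= s.1 - 1)%R = false by lia.
  rewrite /= e1 e2 lexx addn1 addn0 /set_site eqxx transferS//; last exact: tame_crossing.
  congr (_ * _ + _ * _); apply: transfer_ext => m; first by rewrite crossing_step_right.
  apply: crossing_ext => y xy /=; last by lia.
  by rewrite /set_site ifN//; lia.
have e0 : (x <= s.1)%R = true by lia.
have e1 : (x <= s.1 + 1)%R = true by lia.
have e2 : (x <= s.1 - 1)%R = true by lia.
have e3 : (x == s.1) = false by lia.
rewrite /= e0 e1 e2 addn1 /set_site e3 -(transfer_lin q01); [|exact: tame_crossing..].
by apply: transfer_ext => m; apply: IH; lia.
Qed.

Lemma crossing_left s k x phi : lingrowth phi -> s.1 < x ->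
  crossing s k x phi 0 = phi 0%N.
Proof.
move=> lphi; elim: k x => [|k IH] x sx /=; rewrite (_ : (x <= s.1)%R = false) ?addn0//; try lia.
by rewrite transfer0//; [apply: IH; lia|exact: tame_crossing].
Qed.

Lemma crossing_right s k x n : x + k%:Z <= s.1 -> crossing s k x alive n = 1.
Proof.
elim: k x n => [|k IH] x n xs /=; rewrite (_ : (x <= s.1)%R = true) ?addn1//; try lia.
rewrite (transfer_ext _ _ (fun=> 1)) ?transfer_cst// => m.
by apply: IH; lia.
Qed.

Lemma crossing_alive_ge0 s k x n : 0 <= crossing s k x alive n.
Proof.
elim: k x n => [|k IH] x n /=; first by rewrite ler0n.
by apply: transfer_ge0 => //; exact/tame_crossing/lingrowth_alive.
Qed.

Lemma crossing_alive_le1 s k x n : crossing s k x alive n <= 1.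
Proof.
elim: k x n => [|k IH] x n /=; first by rewrite lern1 leq_b1.
rewrite -(transfer_cst q01 (s.2 x) 1 (n + (x <= s.1)%R)%N).
apply: transfer_le => //; last exact: tame_const.
exact/tame_crossing/lingrowth_alive.
Qed.

(** Peels off the farthest site instead of the nearest one, so that inequalities for [transfer] at
    far sites turn into monotonicity in k. *)
Lemma crossingS s k x phi n : s.1 < x + k%:Z ->
  crossing s k.+1 x phi n = crossing s k x (transfer (s.2 (x + k%:Z)) phi) n.
Proof.
elim: k x n => [|k IH] x n sx.
  rewrite /= addr0; have -> : (x <= s.1)%R = false by lia.
  by apply: transfer_ext => m; rewrite (_ : (x + 1 <= s.1)%R = false) ?addn0//; lia.
have e : x + k.+1%:Z = x + 1 + k%:Z by lia.
rewrite e -[LHS]/(transfer (s.2 x) (crossing s k.+1 (x + 1) phi) _).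
by apply: transfer_ext => m; apply: IH; lia.
Qed.

Lemma kern0_lower M : exists2 e : K, 0 < e & forall n c, (n < M)%N -> e <= kern n c 0.
Proof.
elim: M => [|M [e e0 he]]; first by exists 1.
have kp c : 0 < kern M c 0.
  case: (posnP M) => [->|M0]; last exact: kern_gt0.
  by rewrite kern0.
exists (Num.min e (Num.min (Num.min (kern M p0 0) (kern M p1 0))
   (Num.min (kern M q0 0) (kern M q1 0)))); first by rewrite !lt_min e0 !kp.
move=> n c; rewrite ltnS leq_eqVlt => /orP[/eqP->|nM].
  by elim/cfg_ind: c; rewrite !ge_min lexx ?orbT.
by rewrite ge_min he.
Qed.

(* The spatial chain loses a fixed fraction of the mass that it puts on
   (0, M), hence this mass is small at arbitrarily large distances, and the
   Lyapunov function bounds the mass on [M, oo). *)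
Lemma crossing_vanish s x (N : int) : (forall y, N <= y -> mu (s.2 y) <= nu / 2) ->
  forall n k0 (e : K), 0 < e -> exists2 k, (k0 <= k)%N & crossing s k x alive n <= e.
Proof.
move=> good n k0 e e0.
have [F [lF mF F0 uF hF]] := recurrence_lyapunov q01.
pose k1 := (k0 + `|N - x| + `|s.1 - x|.+1)%N.
have hk k : (k1 <= k)%N -> s.1 < x + k%:Z /\ N <= x + k%:Z by rewrite /k1; lia.
have lal := @lingrowth_alive K.
have Fbound k : (k1 <= k)%N -> crossing s k x F n <= crossing s k1 x F n.
  elim: k => [|k IH]; first by rewrite leqn0 => /eqP->.
  rewrite leq_eqVlt => /orP[/eqP->//|]; rewrite ltnS => k1k.
  have [h1 h2] := hk k k1k; rewrite crossingS//; apply: le_trans (IH k1k).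
  by apply: crossing_le => //; [exact: lingrowth_transfer|apply: hF; exact: good].
set Phi := crossing s k1 x F n in Fbound.
(* Markov's inequality at level M: the mass on [M, oo) is at most Phi / F M <= e / 2. The 1 keeps F
   M positive. *)
have [M hM] := uF (Num.max 1 (2 * Phi / e)).
have FM1 : 1 <= F M by apply: le_trans hM; rewrite le_max lexx.
have FM0 : 0 < F M by rewrite (lt_le_trans ltr01).
have FM2 : Phi / F M <= e / 2.
  have : 2 * Phi / e <= F M by apply: le_trans hM; rewrite le_max lexx orbT.
  by rewrite ler_pdivrMr// => h; rewrite ler_pdivrMr//; lra.
pose mid m : K := ((0 < m) && (m < M))%N%:R.
have lmid : lingrowth mid.
  by apply: (lingrowth_bounded _ 1) => m; rewrite normr_nat lern1 leq_b1.
have [d d0 hd] := kern0_lower M.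
have aliveT c m : transfer c alive m <= 1 * alive m + (- d) * mid m.
  apply: (le_trans (transfer_alive q01 c m)); rewrite /mid mul1r.
  have k0' : 0 <= kern m c 0 by exact: kern_ge0.
  case: m k0' => [|m] k0'; first by rewrite /alive /= mulr0 addr0 /kern subr_le0.
  have [lt|_] := ltnP m.+1 M; last by rewrite mulr0 addr0 gerBl.
  by rewrite mulr1 lerD2l lerN2 hd.
pose G k := crossing s k x alive n; pose D k := crossing s k x mid n.
have decr k : (k1 <= k)%N -> G k.+1 <= G k - d * D k.
  move=> /hk[h1 _]; rewrite /G crossingS//.
  rewrite -[in leRHS](mul1r (crossing s k x alive n)) -mulNr -crossing_lin//.
  apply: crossing_le => //; last exact: lingrowth_lin.
  exact: lingrowth_transfer.
have [k k1k hD] : exists2 k, (k1 <= k)%N & D k <= e / 2.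
  apply: contrapT => hno.
  have big k : (k1 <= k)%N -> e / 2 < D k.
    by move=> k1k; rewrite ltNge; apply/negP => ?; apply: hno; exists k.
  have down j : G (k1 + j)%N <= 1 - j%:R * (d * (e / 2)).
    elim: j => [|j IH]; first by rewrite mul0r subr0; exact: crossing_alive_le1.
    rewrite addnS; apply: (le_trans (decr _ (leq_addr _ _))).
    have := ler_wpM2l (ltW d0) (ltW (big _ (leq_addr j k1))).
    by rewrite -[j.+1%:R]natr1; lra.
  have de0 : 0 < d * (e / 2) by rewrite mulr_gt0// divr_gt0.
  have := down (Num.truncn (1 / (d * (e / 2)))).+1.
  have := truncnS_gt (1 / (d * (e / 2))); rewrite ltr_pdivrMr// => h1 h2.
  have := le_trans (crossing_alive_ge0 _ _ _ _) h2; lra.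
exists k; first by move: k1k; rewrite /k1; lia.
apply: (@le_trans _ _ (1 * D k + (F M)^-1 * crossing s k x F n)).
  rewrite -crossing_lin//; apply: crossing_le => //; first exact: lingrowth_lin.
  move=> m; rewrite mul1r /alive /mid.
  case: m => [|m]; first by rewrite F0 mulr0 addr0.
  have Fm0 m' : 0 <= F m' by rewrite -F0 mF.
  have [lt|ge] := ltnP m.+1 M; first by rewrite lerDl mulr_ge0// invr_ge0 ltW.
  by rewrite add0r mulrC ler_pdivlMr// mul1r mF.
rewrite mul1r mulrC; have := Fbound k k1k => h1.
have : crossing s k x F n / F M <= Phi / F M by rewrite ler_wpM2r// invr_ge0 ltW.
lra.
Qed.

(** The walker's site owes one leftward jump, and before it makes n rightward jumps with probability
    [kern 1 c n] > 0. From this n, where g n < 1, the chain survives any number of sites with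
    probability at least 1 - g n. The minimum with 1 covers k = 0. *)
Lemma crossing_lower c : nu / 2 < mu c -> exists2 d : K, 0 < d &
  forall s k, (forall y, s.1 <= y -> s.2 y = c) -> d <= crossing s k s.1 alive 0.
Proof.
move=> /(transience_lyapunov q01)[g [g01 g0 [n gn] hg]].
have lal := @lingrowth_alive K.
have lg : lingrowth g.
  by apply: (lingrowth_bounded _ 1) => m; have /andP[? ?] := g01 m; rewrite ger0_norm.
exists (Num.min 1 (kern 1 c n * (1 - g n))).
  by rewrite lt_min ltr01 mulr_gt0 ?subr_gt0// kern_gt0.
move=> s k fresh.
have lc : lingrowth (fun m => 1 * 1 + -1 * g m).
  by apply: lingrowth_lin => //; apply: (lingrowth_bounded _ 1) => m; rewrite normr1.
have low j y m : s.1 < y -> 1 * 1 + -1 * g m <= crossing s j y alive m.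
  elim: j y m => [|j IH] y m sy /=.
    rewrite (_ : (y <= s.1)%R = false); last by lia.
    case: m => [|m].
      by rewrite g0 /alive /=; lra.
    by rewrite /alive /=; have /andP[? ?] := g01 m.+1; lra.
  rewrite (_ : (y <= s.1)%R = false) ?addn0; last by lia.
  rewrite fresh; last by lia.
  apply: (@le_trans _ _ (transfer c (fun m => 1 * 1 + -1 * g m) m)); last first.
    apply: transfer_le => //; [exact: lingrowth_tame|exact: tame_crossing|].
    by move=> m'; apply: IH; lia.
  rewrite (transfer_lin q01); [|exact: tame_const|exact: lingrowth_tame].
  by rewrite transfer_cst//; have := hg m; lra.
case: k => [|k] /=; rewrite lexx ge_min ?lexx//.
apply/orP; right; rewrite fresh// add0n.
apply: le_trans (transfer_ge_term q01 c _ 1 n _ _); last 2 first.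
- exact: tame_crossing.
- by move=> m; exact: crossing_alive_ge0.
rewrite ler_wpM2l ?kern_ge0//.
by have := low k (s.1 + 1) n (_ : s.1 < s.1 + 1); rewrite mul1r mulN1r; apply; lia.
Qed.

(** * Confinement probabilities over the times 0, ..., n, as functions of the state alone *)

Fixpoint remain (n : nat) (Q : pred int) s : K :=
  if Q s.1 then
    if n is n'.+1 then rprob (s.2 s.1) * remain n' Q (step_right s) +
      (1 - rprob (s.2 s.1)) * remain n' Q (step_left s) else 1
  else 0.

Local Notation surv n a := (remain n (fun x => (a < x)%R)).
Local Notation stay n a b := (remain n (fun x => (a < x < b)%R)).

Let r0 c : 0 <= rprob c := ltW (rprob_gt0 q01 c).
Let r1 c : 0 <= 1 - rprob c.
Proof. by rewrite subr_ge0 ltW// rprob_lt1. Qed.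

Lemma remain_ge0 n Q s : 0 <= remain n Q s.
Proof.
elim: n s => [|n IH] s /=; case: ifP => // _.
by rewrite addr_ge0// mulr_ge0.
Qed.

Lemma remain_le1 n Q s : remain n Q s <= 1.
Proof.
elim: n s => [|n IH] s /=; case: ifP => // _.
apply: (@le_trans _ _ (rprob (s.2 s.1) * 1 + (1 - rprob (s.2 s.1)) * 1)).
  by apply: lerD; rewrite ler_wpM2l.
by rewrite !mulr1 addrC subrK.
Qed.

(** A walk that stays above a either reaches a + k + 1 or is still inside the strip; [crossing] is
    harmonic in the strip, equal to 1 at its upper end, and so accounts for the former. *)
Lemma surv_le n a k s : a <= s.1 <= a + k.+1%:Z ->
  surv n a s <= crossing s k (a + 1) alive 0 + stay n a (a + k.+1%:Z) s.
Proof.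
have lal := @lingrowth_alive K.
elim: n s => [|n IH] s hs.
  have h := crossing_alive_ge0 s k (a + 1) 0.
  have [sa|sa] : s.1 <= a \/ a < s.1 by lia.
    by rewrite [leLHS]/= ltNge sa addr_ge0// remain_ge0.
  have [sb|sb] : s.1 = a + k.+1%:Z \/ s.1 < a + k.+1%:Z by lia.
    rewrite crossing_right; last by lia.
    by rewrite (le_trans (remain_le1 _ _ _))// lerDl remain_ge0.
  rewrite /= sa sb /=.
  by rewrite lerDr.
have [sa|sa] : s.1 <= a \/ a < s.1 by lia.
  by rewrite [leLHS]/= ltNge sa addr_ge0 ?remain_ge0// crossing_alive_ge0.
have [sb|sb] : s.1 = a + k.+1%:Z \/ s.1 < a + k.+1%:Z by lia.
  rewrite crossing_right; last by lia.
  by rewrite (le_trans (remain_le1 _ _ _))// lerDl remain_ge0.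
rewrite crossing_harmonic//; last by lia.
rewrite /= sa sb /=.
rewrite addrACA -!mulrDr; apply: lerD; rewrite ler_wpM2l//; apply: IH => /=; lia.
Qed.

(** Within n jumps the walk cannot reach the upper end of the strip, so up to then [crossing] stays
    harmonic until the walk falls to a. *)
Lemma surv_ge n a k s : a <= s.1 -> s.1 + n%:Z < a + k.+1%:Z ->
  crossing s k (a + 1) alive 0 <= surv n a s.
Proof.
have lal := @lingrowth_alive K.
elim: n s => [|n IH] s sa0 sb.
  have [sa|sa] : s.1 <= a \/ a < s.1 by lia.
    by rewrite [leRHS]/= ltNge sa crossing_left//; lia.
  rewrite /= (_ : (a < s.1)%R = true); last by lia.
  exact: crossing_alive_le1.
have [sa|sa] : s.1 <= a \/ a < s.1 by lia.
  by rewrite [leRHS]/= ltNge sa crossing_left//; lia.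
rewrite crossing_harmonic//; last by lia.
rewrite /= (_ : (a < s.1)%R = true); last by lia.
by apply: lerD; rewrite ler_wpM2l//; apply: IH => /=; lia.
Qed.

(** An exponential function u of the distance to a, at most 1 on the strip, at least doubles on
    average in one jump. Hence 2 - u contracts by the factor rho = 1 - u 0 / 2, uniformly over
    environments. *)
Lemma stay_vanish a b (e : K) : 0 < e -> exists n, forall s, stay n a b s <= e.
Proof.
move=> e0; pose l := `|b - a|%N.
have absl s : a <= s.1 <= b -> (`|s.1 - a| <= l)%N by rewrite /l; lia.
have inR s : a < s.1 < b -> a <= (step_right s).1 <= b by rewrite /=; lia.
have inL s : a < s.1 < b -> a <= (step_left s).1 <= b by rewrite /=; lia.
have absR s : a < s.1 < b -> `|(step_right s).1 - a|%N = `|s.1 - a|%N.+1 by rewrite /=; lia.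
have cases s : (a <= s.1 <= b) \/ ~~ (a < s.1 < b).
  by case: (boolP (a < s.1 < b)) => ?; [left; lia|right].
clearbody l; have [qgt0 qlt1] := andP q01.
pose m := Num.min q (1 - q).
have m0 : 0 < m by rewrite lt_min qgt0 subr_gt0.
have [mq mq'] : m <= q /\ m <= 1 - q by split; rewrite ge_min lexx ?orbT.
have mr c : m <= rprob c by elim/cfg_ind: c; rewrite rprobE.
(* A rightward jump has probability at least m, so m lam = 2 yields the doubling. *)
pose lam := 2 / m.
have ml : m * lam = 2 by rewrite /lam; field; rewrite gt_eqF.
have lam1 : 1 <= lam.
  by rewrite /lam ler_pdivlMr//; lra.
have lam0 : 0 <= lam by lra.
pose u j : K := lam ^+ j / lam ^+ l.
have L0 : 0 < lam ^+ l by rewrite exprn_gt0//; lra.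
have u0 j : 0 <= u j by rewrite divr_ge0 ?exprn_ge0.
have u1 j : (j <= l)%N -> u j <= 1.
  by move=> jl; rewrite /u ler_pdivrMr// mul1r ler_weXn2l.
have uS j : m * u j.+1 = 2 * u j by rewrite -ml /u [lam ^+ j.+1]exprS; ring.
have ul j : u 0%N <= u j.
  by rewrite /u ler_wpM2r ?invr_ge0 ?(ltW L0)// expr0 exprn_ege1.
pose rho := 1 - u 0%N / 2.
have u00 : 0 < u 0%N by rewrite divr_gt0 ?exprn_gt0//; lra.
have u01 := u1 0%N (leq0n l).
have rho01 : 0 < rho < 1 by apply/andP; split; rewrite /rho; lra.
have main n s : a <= s.1 <= b -> stay n a b s <= rho ^+ n * (2 - u `|s.1 - a|%N).
  elim: n s => [|n IH] s hs.
    rewrite expr0 mul1r /=; have := u1 `|s.1 - a|%N.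
    by case: ifP => _ /(_ (absl _ hs)); lra.
  have rn : 0 <= rho ^+ n by rewrite exprn_ge0//; case/andP: rho01 => /ltW.
  rewrite /=; case: ifP => [hin|_]; last first.
    rewrite mulr_ge0 ?exprn_ge0//; first by case/andP: rho01 => /ltW.
    by have := u1 _ (absl _ hs); lra.
  have iR := IH (step_right s) (inR s hin).
  have iL := IH (step_left s) (inL s hin).
  pose j := `|s.1 - a|%N.
  have eR : `|(step_right s).1 - a|%N = j.+1 by exact: absR.
  rewrite eR in iR.
  have uL := u0 `|(step_left s).1 - a|%N.
  have pr0 := r0 (s.2 s.1); have pr1 := r1 (s.2 s.1).
  have iL' : stay n a b (step_left s) <= rho ^+ n * 2.
    by apply: (le_trans iL); rewrite ler_wpM2l//; lra.
  apply: (@le_trans _ _ (rho ^+ n * (2 - rprob (s.2 s.1) * u j.+1))).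
    have := ler_wpM2l pr0 iR; have := ler_wpM2l pr1 iL'.
    move: (stay _ _ _ _) (stay _ _ _ _) (rho ^+ n) (u _) (rprob _) => *; lra.
  rewrite exprSr -mulrA ler_wpM2l//.
  have h1 : 2 * u j <= rprob (s.2 s.1) * u j.+1 by rewrite -uS ler_wpM2r.
  have := ul j; rewrite /rho -/j; nra.
have [B B0 hB] := geometric_decay rho rho01.
exists (Num.truncn (2 * B / e)) => s.
have [hs|hs] := cases s.
  apply: (le_trans (main _ s hs)); set n := Num.truncn _.
  have n0 : 0 < n.+1%:R :> K by rewrite ltr0n.
  have hb : B / n.+1%:R * 2 <= e.
    rewrite mulrAC ler_pdivrMr// [e * _]mulrC -ler_pdivrMr// [B * 2]mulrC.
    exact/ltW/truncnS_gt.
  apply: le_trans hb; apply: ler_pM => //; last by have := u0 `|s.1 - a|%N; lra.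
    by rewrite exprn_ge0//; case/andP: rho01 => /ltW.
  by have := u1 _ (absl _ hs); lra.
by case: (Num.truncn _) => [|n] /=; rewrite (negbTE hs) ltW.
Qed.

Lemma surv_vanish s a (N : int) : (forall y, N <= y -> mu (s.2 y) <= nu / 2) ->
  forall e : K, 0 < e -> exists n, surv n a s <= e.
Proof.
move=> good e e0; have [sa|sa] : s.1 <= a \/ a < s.1 by lia.
  by exists 0%N; rewrite /= ltNge sa ltW.
have [k hk ck] := crossing_vanish s (a + 1) N good 0%N `|s.1 - a|%N (e / 2) (divr_gt0 e0 (ltr0n _ 2)).
have [n hn] := stay_vanish a (a + k.+1%:Z) (e / 2) (divr_gt0 e0 (ltr0n _ 2)).
exists n; apply: (le_trans (surv_le n a k s _)); first by lia.
by have := hn s; lra.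
Qed.

Lemma surv_lower c : nu / 2 < mu c -> exists2 d : K, 0 < d &
  forall s n, (forall y, s.1 <= y -> s.2 y = c) -> d <= surv n (s.1 - 1) s.
Proof.
move=> /crossing_lower[d d0 hd]; exists d => // s n fresh.
apply: le_trans (surv_ge n (s.1 - 1) n.+1 s _ _); [|lia|lia].
by rewrite subrK; exact: hd.
Qed.

End Crossing.
Arguments remain {K} q n Q s.

(** * The law of the path *)

Definition walk_step (r : bool) (s : state 2 2) : state 2 2 :=
  if r then step_right s else step_left s.

(* Histories are lists of jumps, the latest jump first; [true] is a jump to the
   right. *)
Fixpoint tree_state (w : environment 2 2) (be : seq bool) : state 2 2 :=
  if be is r :: be' then walk_step r (tree_state w be') else (0, w).

Definition jump_prob {K : realType} (q : K) (r : bool) (s : state 2 2) : K :=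
  if r then rprob q (s.2 s.1) else 1 - rprob q (s.2 s.1).

Fixpoint weight {K : realType} (q : K) (w : environment 2 2) (be : seq bool) : K :=
  if be is r :: be' then jump_prob q r (tree_state w be') * weight q w be' else 1.

(** What is retained of the process: an event for each jump history, with its probability and the
    position it determines. In this form the reflection of a walk is again such a walk. *)
Record tree_walk {K : realType} {d : measure_display} {T : measurableType d}
    (P : probability T K) (q : K) (w : environment 2 2) (X : nat -> T -> int)
    (E : seq bool -> set T) : Prop := TreeWalk {
  tree_measurable : forall be, measurable (E be);
  tree_prob : forall be, P (E be) = (weight q w be)%:E;
  tree_sub : forall r be, E (r :: be) `<=` E be;
  tree_pos : forall be t, E be t -> X (size be) t = (tree_state w be).1;
  tree_posM : forall n x, measurable [set t | X n t = x]
}.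

Arguments tree_measurable {K d T P q w X E}.
Arguments tree_prob {K d T P q w X E}.
Arguments tree_sub {K d T P q w X E} _ {r be}.
Arguments tree_pos {K d T P q w X E} _ {be t}.
Arguments tree_posM {K d T P q w X E}.

Section SigmaAlgebra.
Context {T : Type} (G : set (set T)).
Hypothesis sG : sigma_algebra setT G.

Lemma sigma_bigcap (A : nat -> set T) : (forall n, G (A n)) -> G (\bigcap_n A n).
Proof.
move=> GA; case: sG => _ GD GU.
rewrite (_ : \bigcap_n A n = setT `\` \bigcup_n (setT `\` A n)).
  by apply: (GD); apply: GU => n; exact: GD.
apply/seteqP; split => [t h|t [_ h] n _].
  by split=> // -[n _ [_ ]]; apply; exact: h.
by apply: contrapT => nA; apply: h; exists n.
Qed.

Lemma sigma_setI A B : G A -> G B -> G (A `&` B).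
Proof.
move=> GA GB; rewrite (_ : A `&` B = \bigcap_n (if n is 0 then A else B)).
  by apply: sigma_bigcap => -[].
apply/seteqP; split => [t [? ?] [|n] _ //|t h].
by split; [exact: (h 0%N)|exact: (h 1%N)].
Qed.

End SigmaAlgebra.

(** * From the Markov process to the tree of jump histories *)

Section TreeOfWalk.
Context {K : realType} {d : measure_display} {T : measurableType d}.
Variables (P : probability T K) (q : K) (w : environment 2 2).
Variables (X : nat -> T -> int) (W : nat -> T -> environment 2 2).
Hypothesis q01 : 0 < q < 1.
Hypothesis walkP : feedback_walk P (1 - q) q w X W.

Let S n t : state 2 2 := (X n t, W n t).

Fixpoint cylinder (be : seq bool) : set T :=
  if be is r :: be' then
    cylinder be' `&` [set t | S (size be) t = tree_state w be]
  else [set t | S 0 t = (0, w)].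

Lemma cylinder_state be t : cylinder be t -> S (size be) t = tree_state w be.
Proof. by case: be => [|r be] //= []. Qed.

(** An environment is determined by countably many coordinates, enumerated here as m and - m. *)
Lemma history_state n k s : (k <= n)%N -> history X W n [set t | S k t = s].
Proof.
move=> kn.
have sG := @smallest_sigma_algebra _ setT
  (\bigcup_(k in [set k | (k <= n)%N]) coordinate_events X W k).
have sub A : coordinate_events X W k A -> history X W n A.
  by move=> hA; apply: sub_sigma_algebra; exists k.
rewrite (_ : [set t | S k t = s] = [set t | X k t = s.1] `&`
  \bigcap_m ([set t | W k t m%:Z = s.2 m%:Z] `&` [set t | W k t (- m%:Z) = s.2 (- m%:Z)])).
  apply: (sigma_setI _ sG); first by apply: sub; left; exists s.1.
  apply: (sigma_bigcap _ sG) => m.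
  apply: (sigma_setI _ sG); apply: sub; right.
    by exists m%:Z, (s.2 m%:Z).
  by exists (- m%:Z), (s.2 (- m%:Z)).
apply/seteqP; split => [t /= <- //|t [/= h1 h2]].
rewrite /S h1; case: s h1 h2 => x w' /= h1 h2; congr pair; apply/funext => y.
have [n1 n2] := h2 `|y|%N I.
by have [<-|<-] : `|y|%N%:Z = y \/ - `|y|%N%:Z = y by lia.
Qed.

Lemma history_measurable n : history X W n `<=` measurable.
Proof.
apply: smallest_sub; first exact: sigma_algebra_measurable.
by move=> A [k _ hA]; exact: (walk_measurable walkP) hA.
Qed.

Lemma history_cylinder n be : (size be <= n)%N -> history X W n (cylinder be).
Proof.
elim: be => [|r be IH] sn; first exact: history_state.
apply: (sigma_setI _ (smallest_sigma_algebra _ _)); first by apply: IH; exact: ltnW.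
exact: history_state.
Qed.

Lemma measurable_cylinder be : measurable (cylinder be).
Proof. by apply: (@history_measurable (size be)); exact: history_cylinder. Qed.

(** On a cylinder the current state is fixed, so the integrand in the defining identity of the walk
    is constant. *)
Lemma cylinder_prob be : P (cylinder be) = (weight q w be)%:E.
Proof.
elim: be => [|r be IH]; first exact: (walk_init walkP).
have mE := measurable_cylinder be.
have hE := history_cylinder (size be) be (leqnn _).
set c := (tree_state w be).2 (tree_state w be).1.
have prE t : cylinder be t -> prob_right (1 - q) q (S (size be) t) = rprob q c.
  by move=> /cylinder_state ->.
rewrite [weight _ _ _]/= /jump_prob -/c EFinM -IH.
case: r => /=.
  rewrite (_ : _ `&` _ = cylinder be `&`
      [set t | S (size be).+1 t = step_right (S (size be) t)]).
    rewrite (walk_right walkP) // -integral_cst//; apply: eq_integral => t.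
    by rewrite inE => /prE ->.
  by apply/seteqP; split => t [ht] /= h; split => //=; move: h; rewrite (cylinder_state _ _ ht).
rewrite (_ : _ `&` _ = cylinder be `&`
    [set t | S (size be).+1 t = step_left (S (size be) t)]).
  rewrite (walk_left walkP) // -integral_cst//; apply: eq_integral => t.
  by rewrite inE => /prE ->.
by apply/seteqP; split => t [ht] /= h; split => //=; move: h; rewrite (cylinder_state _ _ ht).
Qed.

Lemma tree_walk_of_feedback_walk : tree_walk P q w X cylinder.
Proof.
split.
- exact: measurable_cylinder.
- exact: cylinder_prob.
- by move=> r be t [].
- by move=> be t /cylinder_state <-.
- move=> n x; have := @walk_measurable _ _ _ _ _ _ _ _ _ _ _ walkP n.
  by apply; left; exists x.
Qed.

End TreeOfWalk.

(** * Reflection of the line *)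

Section Mirror.
Context {K : realType} {d : measure_display} {T : measurableType d}.
Variables (P : probability T K) (q : K).

(** The labels are exchanged as well: for p = 1 - q the rightward probability under one label is the
    leftward probability under the other, and R = L makes the two counters interchangeable. *)
Definition mirror_cfg (c : cfg) : cfg :=
  match c with inl i => inr i | inr i => inl i end.

Definition mirror (w : environment 2 2) : environment 2 2 :=
  fun x => mirror_cfg (w (- x)).

Lemma mirror_update c :
  update_right (mirror_cfg c) = mirror_cfg (update_left c) /\
  update_left (mirror_cfg c) = mirror_cfg (update_right c).
Proof.
by case: c => i /=; split => //; case: ifP.
Qed.

Lemma mirror_walk_step r (s s' : state 2 2) :
  s' = (- s.1, mirror s.2) ->
  walk_step (~~ r) s' = (- (walk_step r s).1, mirror (walk_step r s).2).
Proof.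
move=> ->; have [uR uL] := mirror_update (s.2 s.1).
have e y : (y == - s.1) = (- y == s.1) by lia.
case: r; rewrite /= /step_left /step_right /=; congr pair; try lia;
  apply/funext => y; rewrite /mirror /set_site e opprK ?uR ?uL; by case: ifP.
Qed.

Lemma mirror_tree_state w be :
  tree_state (mirror w) (map negb be) = (- (tree_state w be).1, mirror (tree_state w be).2).
Proof.
elim: be => [|r be IH]; first by rewrite /= oppr0.
by rewrite [LHS]/=; apply: mirror_walk_step.
Qed.

Lemma mirror_weight w be : weight q (mirror w) (map negb be) = weight q w be.
Proof.
elim: be => //= r be ->; congr (_ * _); rewrite /jump_prob mirror_tree_state /mirror /= opprK.
by case: r => /=; case: ((tree_state w be).2 _) => i /=; ring.
Qed.

Lemma mirror_tree_walk w X E : tree_walk P q w X E ->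
  tree_walk P q (mirror w) (fun n t => - X n t) (E \o map negb).
Proof.
move=> [mE pE sE xE mX]; have nK be : map negb (map negb be) = be.
  by rewrite -map_comp (eq_map negbK) map_id.
split.
- by move=> be; exact: mE.
- by move=> be; rewrite /= pE -[in RHS](nK be) mirror_weight.
- by move=> r be t; exact: sE.
- move=> be t /xE; rewrite size_map => ->.
  by rewrite -[in RHS](nK be) mirror_tree_state.
- move=> n x; rewrite (_ : [set t | - X n t = x] = [set t | X n t = - x]); first exact: mX.
  by apply/seteqP; split => t /= => [<-|->]; rewrite opprK.
Qed.

End Mirror.

(** * Real-valued probabilities and measurability of countable quantifiers *)

Section RealProbability.
Context {K : realType} {d : measure_display} {T : measurableType d}.
Variable P : probability T K.

Definition pr (A : set T) : K := fine (P A).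

Lemma prE A : measurable A -> P A = (pr A)%:E.
Proof. by move=> mA; rewrite /pr fineK// fin_num_measure. Qed.

Lemma pr_ge0 A : 0 <= pr A.
Proof. by rewrite /pr fine_ge0. Qed.

Lemma pr_le A B : measurable A -> measurable B -> A `<=` B -> pr A <= pr B.
Proof.
by move=> mA mB AB; rewrite -lee_fin -!prE// le_measure ?inE.
Qed.

Lemma prU A B : measurable A -> measurable B -> A `&` B = set0 ->
  pr (A `|` B) = pr A + pr B.
Proof.
move=> mA mB AB; apply: EFin_inj; rewrite EFinD -!prE//; last exact: measurableU.
exact: measureU.
Qed.

Lemma pr0 : pr set0 = 0.
Proof. by rewrite /pr measure0. Qed.

Lemma pr_split A B : measurable A -> measurable B ->
  pr A = pr (A `&` B) + pr (A `\` B).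
Proof.
move=> mA mB; rewrite -prU; [|exact: measurableI|exact: measurableD|].
  by rewrite setUIDK.
by apply/seteqP; split => // t [[_ ?] [_]].
Qed.

Lemma pr_bigcap_ge (A : nat -> set T) (c : K) : (forall n, measurable (A n)) ->
  (forall n, A n.+1 `<=` A n) -> (forall n, c <= pr (A n)) -> c <= pr (\bigcap_n A n).
Proof.
move=> mA sA cA; have mI : measurable (\bigcap_n A n) by exact: bigcapT_measurable.
rewrite -lee_fin -prE//.
have cvgA : P \o A @ \oo --> P (\bigcap_n A n).
  apply: nonincreasing_cvg_mu => //; first by rewrite -ge0_fin_numE// fin_num_measure.
  by apply/nonincreasing_seqP => n; apply/subsetPset; exact: sA.
rewrite -(cvg_lim _ cvgA)//; apply: lime_ge; first by apply/cvg_ex; eexists; exact: cvgA.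
by apply: nearW => n; rewrite -[(P \o A) n]/(P (A n)) prE// lee_fin.
Qed.

Lemma measurable_forall (Q : nat -> T -> Prop) :
  (forall n, measurable [set t | Q n t]) -> measurable [set t | forall n, Q n t].
Proof.
move=> mQ; rewrite (_ : [set t | forall n, Q n t] = \bigcap_n [set t | Q n t]).
  exact: bigcapT_measurable.
by apply/seteqP; split => [t h n _|t h n]; exact: h.
Qed.

Lemma measurable_exists (Q : nat -> T -> Prop) :
  (forall n, measurable [set t | Q n t]) -> measurable [set t | exists n, Q n t].
Proof.
move=> mQ; rewrite (_ : [set t | exists n, Q n t] = \bigcup_n [set t | Q n t]).
  exact: bigcupT_measurable.
by apply/seteqP; split => [t [n h]|t [n _ h]]; exists n.
Qed.

Lemma measurable_imply (a : Prop) (Q : T -> Prop) :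
  measurable [set t | Q t] -> measurable [set t | a -> Q t].
Proof.
move=> mQ; have [ha|ha] := pselect a.
  by rewrite (_ : [set t | a -> Q t] = [set t | Q t])//; apply/seteqP; split => t /=; auto.
rewrite (_ : [set t | a -> Q t] = setT); first exact: measurableT.
by apply/seteqP; split => // t _ /ha.
Qed.

Lemma measurable_and_cst (a : Prop) (Q : T -> Prop) :
  measurable [set t | Q t] -> measurable [set t | a /\ Q t].
Proof.
move=> mQ; have [ha|ha] := pselect a.
  by rewrite (_ : [set t | a /\ Q t] = [set t | Q t])//; apply/seteqP; split => t /=; tauto.
rewrite (_ : [set t | a /\ Q t] = set0); first exact: measurable0.
by apply/seteqP; split => t // [].
Qed.

End RealProbability.

(** * Almost sure behaviour of a walk given by its jump histories *)

Section TreeWalk.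
Context {K : realType} {q : K}.
Hypothesis q01 : 0 < q < 1.
Context {d : measure_display} {T : measurableType d}.
Variable P : probability T K.
Local Notation pr := (pr P).
Local Notation weight := (weight q).
Local Notation surv n a := (remain q n (fun x => (a < x)%R)).
Implicit Types (be : seq bool) (a b : int) (n m k j : nat) (Q : pred int).

Section OneWalk.
Variables (w : environment 2 2) (X : nat -> T -> int) (E : seq bool -> set T).
Hypothesis walkE : tree_walk P q w X E.
Local Notation tstate := (tree_state w).

Let mE be : measurable (E be) := tree_measurable walkE be.

Lemma measurable_pos (R : int -> Prop) n : measurable [set t | R (X n t)].
Proof.
rewrite (_ : [set t | R (X n t)] = [set t | exists k : nat,
   (R k%:Z /\ X n t = k%:Z) \/ (R (- k%:Z) /\ X n t = - k%:Z)]).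
  apply: measurable_exists => k; rewrite [X in measurable X](_ : _ =
    [set t | R k%:Z /\ X n t = k%:Z] `|` [set t | R (- k%:Z) /\ X n t = - k%:Z])//.
  by apply: measurableU; apply: measurable_and_cst; exact: (tree_posM walkE).
apply/seteqP; split => t /=; last by move=> [k [[h ->]|[h ->]]].
move=> h; exists `|X n t|%N.
have [e|e] : `|X n t|%N%:Z = X n t \/ - `|X n t|%N%:Z = X n t by lia.
  by left; rewrite e.
by right; rewrite e.
Qed.

Lemma weight_gt0 be : 0 < weight w be.
Proof.
elim: be => //= r be IH; rewrite mulr_gt0// /jump_prob.
by case: r; rewrite ?subr_gt0 ?rprob_gt0 ?rprob_lt1.
Qed.

Lemma weight_split be : weight w be = weight w (true :: be) + weight w (false :: be).
Proof. by rewrite /= -mulrDl /jump_prob addrC subrK mul1r. Qed.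

Lemma pr_cyl be : pr (E be) = weight w be.
Proof. by rewrite /pr (tree_prob walkE). Qed.

Lemma tree_next r be : (tstate (r :: be)).1 = (tstate be).1 + (if r then 1 else -1).
Proof. by case: r. Qed.

(** The events of the two continuations are disjoint, as their positions differ, and their weights
    add up to that of [be]; so they exhaust [E be] up to a null set. *)
Lemma pr_tree be (A : set T) : measurable A ->
  pr (E be `&` A) = pr (E (true :: be) `&` A) + pr (E (false :: be) `&` A).
Proof.
move=> mA; have dis : E (true :: be) `&` E (false :: be) = set0.
  apply/seteqP; split => // t [/(tree_pos walkE) h1 /(tree_pos walkE) h2].
  by move: h1; rewrite [size _]/= h2 !tree_next; lia.
pose U := E (true :: be) `|` E (false :: be).
have mU : measurable U by exact: measurableU.
have UE : U `<=` E be by move=> t []; exact: (tree_sub walkE).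
have D0 : pr (E be `\` U) = 0.
  have := pr_split P (E be) U (mE be) mU.
  rewrite (_ : E be `&` U = U); last by apply/setIidr.
  by rewrite /U prU// !pr_cyl weight_split -/U; lra.
rewrite (pr_split P _ U (measurableI _ _ (mE be) mA) mU).
rewrite [X in _ + X](_ : _ = 0) ?addr0; last first.
  apply/eqP; rewrite eq_le pr_ge0 andbT -D0 pr_le//.
  - by apply: measurableD => //; exact: measurableI.
  - exact: measurableD.
  - by move=> t [[? _] ?].
rewrite -prU; [|exact: measurableI..|].
  congr pr; apply/seteqP; split => t.
    by move=> [[_ At] [Et|Et]]; [left|right].
  by move=> [[Et At]|[Et At]]; (split; [split=> //; apply: UE|]); [left|left|right|right].
by rewrite setIACA dis set0I.
Qed.

Lemma tree_null (A : set T) : measurable A ->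
  (exists n, forall be, size be = n -> pr (E be `&` A) = 0) -> P A = 0%E.
Proof.
move=> mA [n hn].
have h j : forall be, (size be + j = n)%N -> pr (E be `&` A) = 0.
  elim: j => [|j IH] be hs; first by apply: hn; rewrite -hs addn0.
  by rewrite pr_tree// !IH ?addr0// /= addSnnS.
have h0 := h n [::] erefl.
rewrite prE//; congr (_%:E); apply/eqP; rewrite eq_le pr_ge0 andbT.
rewrite (pr_split P A (E [::]))// setIC h0 add0r.
have : pr (setT `\` E [::]) = 0.
  have := pr_split P setT (E [::]) (@measurableT _ T) (mE _).
  by rewrite setTI pr_cyl /= /pr probability_setT /= => h1; lra.
move=> <-; apply: pr_le => //; [exact: measurableD|exact: measurableD|].
by move=> t [].
Qed.

Definition window (Q : pred int) m n : set T :=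
  [set t | forall k, (m <= k <= m + n)%N -> Q (X k t)].

Lemma measurable_window Q m n : measurable (window Q m n).
Proof.
apply: measurable_forall => k; apply: measurable_imply.
exact: (measurable_pos (fun x => Q x)).
Qed.

Lemma windowS Q m n : window Q m n.+1 `<=` window Q m n.
Proof. by move=> t h k hk; apply: h; lia. Qed.

Lemma window_out Q be n : ~~ Q (tstate be).1 -> E be `&` window Q (size be) n = set0.
Proof.
move=> nQ; apply/seteqP; split => // t [/(tree_pos walkE) Et /(_ (size be))].
by rewrite Et (negbTE nQ) leqnn leq_addr => /(_ isT).
Qed.

Lemma window0 Q be : Q (tstate be).1 -> E be `&` window Q (size be) 0 = E be.
Proof.
move=> hQ; apply/seteqP; split => t; first by case.
by move=> Et; split => // k hk; rewrite (_ : k = size be) ?(tree_pos walkE Et)//; lia.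
Qed.

Lemma window_step Q r be n : Q (tstate be).1 ->
  E (r :: be) `&` window Q (size be) n.+1 = E (r :: be) `&` window Q (size (r :: be)) n.
Proof.
move=> hQ; apply/seteqP; split => t [Et h]; split => // k /= hk; first by apply: h; lia.
have [e|e] : k = size be \/ ((size be).+1 <= k <= (size be).+1 + n)%N by lia.
  by rewrite e (tree_pos walkE (tree_sub walkE _ Et)).
exact: h.
Qed.

(** The bridge from [remain], a function of the state, to the probability space. *)
Lemma pr_window Q be n :
  pr (E be `&` window Q (size be) n) = weight w be * remain q n Q (tstate be).
Proof.
elim: n be => [|n IH] be.
  rewrite /=; case: ifP => hQ; last by rewrite window_out ?pr0 ?mulr0// hQ.
  by rewrite window0// pr_cyl mulr1.
rewrite /=; case: ifP => hQ; last by rewrite window_out ?pr0 ?mulr0// hQ.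
rewrite (pr_tree be); last exact: measurable_window.
by rewrite !window_step// !IH /= /jump_prob; ring.
Qed.

Lemma tree_pos_le be : (`|(tstate be).1| <= size be)%N.
Proof. by elim: be => //= r be IH; have := tree_next r be; case: r => /=; lia. Qed.

(** A history of n jumps has left only sites of absolute value below n; thus the hypotheses near
    infinity pass to every reachable state. *)
Lemma tree_env_fresh be y : (size be)%:Z <= y -> (tstate be).2 y = w y.
Proof.
elim: be => //= r be IH hy; have hp := tree_pos_le be.
by case: r => /=; rewrite /set_site ifN ?IH//; lia.
Qed.

Definition tail_window (Q : pred int) m : set T := \bigcap_n window Q m n.

Lemma tail_windowP Q m t : tail_window Q m t <-> forall k, (m <= k)%N -> Q (X k t).
Proof.
split => [h k mk|h n _ k /andP[mk _]]; last exact: h.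
by apply: (h k I); rewrite mk leq_addl.
Qed.

Lemma measurable_tail_window Q m : measurable (tail_window Q m).
Proof. by apply: bigcapT_measurable => n; exact: measurable_window. Qed.

Definition eventually_in (Q : pred int) : set T :=
  [set t | exists m, forall k, (m <= k)%N -> Q (X k t)].

Lemma eventually_in_bigcup Q : eventually_in Q = \bigcup_m tail_window Q m.
Proof.
by apply/seteqP; split => t [m]; [move=> h; exists m => //|move=> _ h; exists m]; exact/tail_windowP.
Qed.

Lemma measurable_eventually_in Q : measurable (eventually_in Q).
Proof.
by rewrite eventually_in_bigcup; apply: bigcupT_measurable => m; exact: measurable_tail_window.
Qed.

(** Countably many entrance times m suffice, and for each of them the finitely many histories of
    length m. *)
Lemma eventually_in_null Q :
  (forall be (e : K), 0 < e -> exists n, remain q n Q (tstate be) <= e) ->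
  P (eventually_in Q) = 0%E.
Proof.
move=> hQ; apply/negligibleP; first exact: measurable_eventually_in.
rewrite eventually_in_bigcup; apply: negligible_bigcup => m.
have mQ := measurable_tail_window Q m.
apply/negligibleP => //; apply: tree_null => //.
exists m => be sbe; apply/eqP; rewrite eq_le pr_ge0 andbT.
apply/ler_addgt0Pr => e e0; rewrite add0r.
have w0 := weight_gt0 be.
have [n hn] := hQ be (e / weight w be) (divr_gt0 e0 w0).
apply: (@le_trans _ _ (pr (E be `&` window Q (size be) n))).
  apply: pr_le; [exact: measurableI|exact/measurableI/measurable_window|].
  by move=> t [Et h]; split => //; rewrite sbe; exact: h.
by rewrite pr_window mulrC -ler_pdivlMr.
Qed.

Lemma not_transient_right a (N : int) :
  (forall y, N <= y -> mu q (w y) <= nu q / 2) ->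
  P (eventually_in (fun x => (a < x)%R)) = 0%E.
Proof.
move=> good; apply: eventually_in_null => be e e0.
apply: (surv_vanish q01 _ _ (Num.max N (size be)%:Z)) => // y hy.
by rewrite tree_env_fresh ?good//; lia.
Qed.

Lemma bounded_null a b : P (eventually_in (fun x => (a < x < b)%R)) = 0%E.
Proof.
apply: eventually_in_null => be e e0.
by have [n hn] := stay_vanish q01 a b e e0; exists n.
Qed.

Lemma measurable_pos2 (R : int -> int -> Prop) n m :
  measurable [set t | R (X n t) (X m t)].
Proof.
rewrite (_ : [set t | _] = [set t | exists k : nat,
   (X n t = k%:Z /\ R k%:Z (X m t)) \/ (X n t = - k%:Z /\ R (- k%:Z) (X m t))]).
  apply: measurable_exists => k; rewrite [X in measurable X](_ : _ =
    ([set t | X n t = k%:Z] `&` [set t | R k%:Z (X m t)]) `|`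
    ([set t | X n t = - k%:Z] `&` [set t | R (- k%:Z) (X m t)]))//.
  apply: measurableU; apply: measurableI; try exact: (tree_posM walkE);
    [exact: (measurable_pos (R k%:Z))|exact: (measurable_pos (R (- k%:Z)))].
apply/seteqP; split => t /=; last by move=> [k [[-> h]|[-> h]]].
move=> h; exists `|X n t|%N.
have [e|e] : `|X n t|%N%:Z = X n t \/ - `|X n t|%N%:Z = X n t by lia.
  by left; rewrite e.
by right; rewrite e.
Qed.

(** Outside the events of the histories the path may jump arbitrarily. Steps of size 1 are what
    makes a path that avoids 0 keep its sign. *)
Lemma nearest_neighbour_null : P.-negligible [set t | exists n,
  X n.+1 t <> X n t + 1 /\ X n.+1 t <> X n t - 1].
Proof.
rewrite (_ : [set t | _] = \bigcup_n [set t |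
  X n.+1 t <> X n t + 1 /\ X n.+1 t <> X n t - 1]); last first.
  by apply/seteqP; split => t [n]; [move=> h; exists n|move=> _ h; exists n].
apply: negligible_bigcup => n.
have mA := measurable_pos2 (fun x y => x <> y + 1 /\ x <> y - 1) n.+1 n.
apply/negligibleP => //; apply: tree_null => //.
exists n.+1 => -[//|r be] [sbe].
rewrite (_ : _ `&` _ = set0) ?pr0//; apply/seteqP; split => // t [Et].
have h1 := tree_pos walkE Et; have h2 := tree_pos walkE (tree_sub walkE _ Et).
by move: h1; rewrite /= !sbe in h2 *; rewrite h2 => -> ; case: (r) => /=; lia.
Qed.

(** * A constant supercritical configuration on the right *)

Section Transient.
Variables (c : cfg) (N : int).
Hypothesis wc : forall y, N <= y -> w y = c.
Hypothesis muc : nu q / 2 < mu q c.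

Definition oscillating b : set T := [set t |
  (forall j, exists k, (j <= k)%N /\ j%:Z <= X k t) /\
  (forall m, exists k, (m <= k)%N /\ X k t < b)].

Lemma measurable_oscillating b : measurable (oscillating b).
Proof.
apply: measurableI.
  apply: measurable_forall => j; apply: measurable_exists => k.
  apply: measurable_and_cst; exact: (measurable_pos (fun x => j%:Z <= x)).
apply: measurable_forall => j; apply: measurable_exists => k.
apply: measurable_and_cst; exact: (measurable_pos (fun x => x < b)).
Qed.

Let osc_bound b (C : K) := forall be, pr (E be `&` oscillating b) <= C * weight w be.

(** Stop at the first time up to n at which the walk is not above a, and apply the uniform bound C
    from there. *)
Lemma osc_surv b (C : K) a n be : 0 <= C -> osc_bound b C ->
  pr (E be `&` oscillating b) <= C * (1 - surv n a (tstate be)) * weight w be +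
    pr (E be `&` window (fun x => a < x) (size be) n `&` oscillating b).
Proof.
move=> C0 hC; elim: n be => [|n IH] be.
  case: (boolP (a < (tstate be).1)) => ha.
    by rewrite window0// lerDr /= ha subrr mulr0 mul0r.
  by rewrite /= (negbTE ha) subr0 mulr1 (le_trans (hC be))// lerDl pr_ge0.
case: (boolP (a < (tstate be).1)) => ha; last first.
  by rewrite /= (negbTE ha) subr0 mulr1 (le_trans (hC be))// lerDl pr_ge0.
have mO := measurable_oscillating b.
have mW : measurable (window (fun x => a < x) (size be) n.+1 `&` oscillating b).
  by apply: measurableI => //; exact: measurable_window.
rewrite -setIA (pr_tree be _ mO) (pr_tree be _ mW) !(setIA _ (window _ _ _)) !window_step//.
apply: (le_trans (lerD (IH (true :: be)) (IH (false :: be)))).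
rewrite [surv n.+1 a _]/= ha (weight_split be) /= /jump_prob.
by rewrite le_eqVlt; apply/orP; left; apply/eqP; ring.
Qed.

(** As n grows, the surviving part disappears: a walk that never goes below its present position,
    which is at least b, does not return below b. *)
Lemma osc_fresh b (C delta : K) be : 0 <= C -> osc_bound b C ->
  b <= (tstate be).1 ->
  (forall n, delta <= surv n ((tstate be).1 - 1) (tstate be)) ->
  pr (E be `&` oscillating b) <= C * (1 - delta) * weight w be.
Proof.
move=> C0 hC hb hd; set a := (tstate be).1 - 1 in hd.
have mO := measurable_oscillating b; have w0 := ltW (weight_gt0 be).
rewrite -subr_le0.
have -> : 0 = pr (\bigcap_n (E be `&` window (fun x => a < x) (size be) n `&` oscillating b)) :> K.
  rewrite (_ : \bigcap_n _ = set0) ?pr0//; apply/seteqP; split => // t h.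
  have [_ [_ /(_ (size be))[k [sk]]]] := h 0%N I.
  have [[_ /(_ k)]] := h k I; rewrite sk leq_addl => /(_ isT); rewrite /a; lia.
apply: pr_bigcap_ge => n.
- by apply: measurableI => //; apply: measurableI => //; exact: measurable_window.
- by move=> t [[? /windowS ?] ?].
- have := osc_surv b C a n be C0 hC.
  have : C * (1 - surv n a (tstate be)) * weight w be <= C * (1 - delta) * weight w be.
    by rewrite ler_wpM2r// ler_wpM2l// lerB.
  lra.
Qed.

(** All positions of the history count, not just the last: the sites from b on have then never been
    left, even after one further jump. *)
Fixpoint below b be :=
  ((tstate be).1 < b) && (if be is _ :: be' then below b be' else true).

Lemma below_pos b be : below b be -> (tstate be).1 < b.
Proof. by case: be => [|r be] /andP[]. Qed.

Lemma below_env b be r y : below b be -> b <= y -> (tstate (r :: be)).2 y = w y.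
Proof.
elim: be r => [|r' be IH] r hb hy; have := below_pos _ _ hb.
  by case: r => /= h; rewrite /set_site ifN//; lia.
move=> h; have ne : y != (tstate (r' :: be)).1 by lia.
have -> : (tstate [:: r, r' & be]).2 y = (tstate (r' :: be)).2 y.
  by case: r; rewrite /= /set_site ifN.
by apply: IH => //; case/andP: hb.
Qed.

Lemma below_size b be : (size be)%:Z < b -> below b be.
Proof.
elim: be => [|r be IH] hb; first by rewrite /= andbT; move: hb => /=; lia.
have h := tree_pos_le (r :: be).
by apply/andP; split; [move: h hb; lia|apply: IH; move: hb => /=; lia].
Qed.

(* When the walk first reaches a level beyond all sites visited so far, the
   environment ahead is untouched and the walk never turns back with
   probability at least [delta]; a uniform bound [C] on the conditional
   probability of oscillating thus improves to [C * (1 - delta)]. *)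
Lemma osc_improve b : exists2 delta : K, 0 < delta < 1 &
  forall C, 0 <= C -> osc_bound b C -> osc_bound b (C * (1 - delta)).
Proof.
have [dl dl0 hdl] := surv_lower q01 c muc.
exists (Num.min dl (1 / 2)).
  rewrite lt_min dl0 gt_min; apply/andP; split; last by apply/orP; right; lra.
  by rewrite divr_gt0.
set delta := Num.min _ _ => C C0 hC be0.
have mO := measurable_oscillating b.
(* A level above b, inside the region where w is c, and beyond everything that be0 can have visited.
   An oscillating path must reach it. *)
pose b' := Num.max (Num.max b N) ((size be0)%:Z + 1).
have [b'b b'N b's] : [/\ b <= b', N <= b' & (size be0)%:Z < b'] by rewrite /b'; split; lia.
have main n be : below b' be -> pr (E be `&` oscillating b) <=
    C * (1 - delta) * weight w be +
    pr (E be `&` window (fun x => x < b') (size be) n `&` oscillating b).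
  have C10 : 0 <= C * (1 - delta).
    by rewrite mulr_ge0// subr_ge0 ge_min; apply/orP; right; lra.
  elim: n be => [|n IH] be hbe; have pos_be := below_pos _ _ hbe.
    by rewrite window0// lerDr mulr_ge0// ltW// weight_gt0.
  have mW : measurable (window (fun x => x < b') (size be) n.+1 `&` oscillating b).
    by apply: measurableI => //; exact: measurable_window.
  rewrite -setIA (pr_tree be _ mO) (pr_tree be _ mW) !(setIA _ (window _ _ _)) !window_step//.
  have child r : pr (E (r :: be) `&` oscillating b) <=
      C * (1 - delta) * weight w (r :: be) +
      pr (E (r :: be) `&` window (fun x => x < b') (size (r :: be)) n `&` oscillating b).
    have [lt|ge] := ltP (tstate (r :: be)).1 b'.
      by apply: IH; rewrite [below _ _]/= -[walk_step _ _]/(tstate (r :: be)) lt hbe.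
    have eb : (tstate (r :: be)).1 = b' by move: (tree_next r be) ge; case: (r); lia.
    rewrite -[leLHS]addr0 lerD ?pr_ge0//.
    apply: osc_fresh => //; first by rewrite eb.
    move=> n'; apply: (@le_trans _ _ dl); first by rewrite ge_min lexx.
    apply: hdl => y; rewrite eb => hy; rewrite (below_env b')// wc//.
    exact: le_trans hy.
  apply: (le_trans (lerD (child true) (child false))).
  by rewrite (weight_split be) le_eqVlt; apply/orP; left; apply/eqP; ring.
have hbe0 := below_size _ _ b's.
rewrite -subr_le0.
have -> : 0 = pr (\bigcap_n (E be0 `&` window (fun x => x < b') (size be0) n `&` oscillating b)) :> K.
  rewrite (_ : \bigcap_n _ = set0) ?pr0//; apply/seteqP; split => // t h.
  have [_ [/(_ (size be0 + `|b'|)%N)[k [sk hk]] _]] := h 0%N I.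
  have [[_ /(_ k) h1] _] := h k I; exfalso.
  have {}h1 : X k t < b' by apply: h1; rewrite leq_addl (leq_trans (leq_addr _ _) sk).
  by clear -hk h1; lia.
apply: pr_bigcap_ge => n.
- by apply: measurableI => //; apply: measurableI => //; exact: measurable_window.
- by move=> t [[? /windowS ?] ?].
- by have := main n be0 hbe0; lra.
Qed.

Lemma oscillating_null b : P (oscillating b) = 0%E.
Proof.
have mO := measurable_oscillating b.
have [dl /andP[d0 d1] hd] := osc_improve b.
have hn n : osc_bound b ((1 - dl) ^+ n).
  elim: n => [|n IH]; last by rewrite exprSr; apply: hd => //; rewrite exprn_ge0// subr_ge0 ltW.
  move=> be; rewrite expr0 mul1r -pr_cyl; by apply: pr_le; [exact: measurableI|exact: mE|move=> t []].
apply: tree_null => //; exists 0%N => be _.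
apply/eqP; rewrite eq_le pr_ge0 andbT; apply/ler_addgt0Pr => e e0; rewrite add0r.
have lam01 : 0 < 1 - dl < 1 by apply/andP; split; lra.
have [B B0 hB] := geometric_decay _ lam01.
have w0 := weight_gt0 be.
pose n := Num.truncn (B * weight w be / e).
apply: (le_trans (hn n be)); apply: (le_trans (ler_wpM2r (ltW w0) (hB n))).
rewrite mulrAC ler_pdivrMr ?ltr0n// -ler_pdivrMl// mulrC.
exact/ltW/truncnS_gt.
Qed.

(** With positive probability the walk opens with m = |N| + 1 jumps to the right; everything ahead
    is then fresh and equal to c. *)
Lemma escape_positive : exists2 b : int, 0 < pr (eventually_in (fun x => b < x)) & 0 <= b.
Proof.
have [dl dl0 hdl] := surv_lower q01 c muc.
pose m := `|N|%N.+1; pose be := nseq m true.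
have posn k : (tstate (nseq k true)).1 = k%:Z.
  by elim: k => //= k IH; rewrite IH; lia.
have posbe : (tstate be).1 = m%:Z by exact: posn.
exists (m%:Z - 1); last by rewrite /m; lia.
have fresh y : (tstate be).1 <= y -> (tstate be).2 y = c.
  rewrite posbe => hy; rewrite tree_env_fresh; first by apply: wc; move: hy; rewrite /m; lia.
  by rewrite size_nseq.
have mQ := measurable_tail_window (fun x => m%:Z - 1 < x) (size be).
apply: (@lt_le_trans _ _ (pr (E be `&` tail_window (fun x => m%:Z - 1 < x) (size be)))); last first.
  apply: pr_le; [exact: measurableI|exact: measurable_eventually_in|].
  by move=> t [_ h]; rewrite eventually_in_bigcup; exists (size be).
have w0 := weight_gt0 be.
apply: (@lt_le_trans _ _ (weight w be * dl)); first by rewrite mulr_gt0.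
rewrite (_ : _ `&` _ = \bigcap_n (E be `&` window (fun x => m%:Z - 1 < x) (size be) n)); last first.
  by apply/seteqP; split => t; [move=> [? h] n _; split => //; exact: h
    |move=> h; split=> [|n _]; [have [] := h 0%N I|have [] := h n I]].
apply: pr_bigcap_ge => n.
- by apply: measurableI => //; exact: measurable_window.
- by move=> t [? /windowS ?].
- by rewrite pr_window ler_wpM2l ?(ltW w0)// -posbe; exact: hdl.
Qed.

End Transient.

End OneWalk.
End TreeWalk.

(** * Recurrence and transience of a single path *)

Lemma not_recurrentP (x : nat -> int) : ~ recurrent x ->
  exists m, forall k, (m <= k)%N -> x k <> 0.
Proof.
move=> /contrapT /finite_seqP[s es]; exists (\max_(i <- s) i).+1 => k mk xk.
have : [set n | x n = 0] k by [].
rewrite es /= => ks; have := @leq_bigmax_seq _ s xpredT id k ks isT.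
by rewrite leqNgt mk.
Qed.

Lemma not_recurrent_sign (x : nat -> int) :
  (forall n, x n.+1 = x n + 1 \/ x n.+1 = x n - 1) -> ~ recurrent x ->
  (exists m, forall k, (m <= k)%N -> 0 < x k) \/
  (exists m, forall k, (m <= k)%N -> 0 < - x k).
Proof.
move=> nn /not_recurrentP[m hm].
have h j : x (m + j)%N <> 0 by apply: hm; exact: leq_addr.
have [p|n] : 0 < x m \/ 0 < - x m by have := h 0%N; rewrite addn0; lia.
  left; exists m => k /subnKC <-; elim: (k - m)%N => [|j IH]; first by rewrite addn0.
  by have := h j.+1; have := nn (m + j)%N; rewrite addnS; lia.
right; exists m => k /subnKC <-; elim: (k - m)%N => [|j IH]; first by rewrite addn0.
by have := h j.+1; have := nn (m + j)%N; rewrite addnS; lia.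
Qed.

Lemma transient_pinftyP (K : realType) (x : nat -> int) : transient_pinfty K x <->
  forall j : nat, exists m, forall k, (m <= k)%N -> j%:Z <= x k.
Proof.
rewrite /transient_pinfty cvgryPge; split => [h j|h A].
  have [m _ hm] := h (j%:Z%:~R); exists m => k mk.
  by have := hm k mk; rewrite /= ler_int.
have [m hm] := h `|Num.ceil A|%N; exists m => // k /= mk.
apply: (le_trans (ceil_ge A)); rewrite ler_int; apply: le_trans (hm k mk).
by move: (Num.ceil A) => c; clear; lia.
Qed.

Lemma transient_ninftyP (K : realType) (x : nat -> int) :
  transient_ninfty K x <-> transient_pinfty K (fun n => - x n).
Proof.
rewrite /transient_ninfty /transient_pinfty -cvgNry.
rewrite (_ : - (fun n => _) = (fun n => (- x n)%:~R))//.
by apply/funext => n; rewrite /= fctE mulrNz.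
Qed.

Lemma pinfty_ninfty_disjoint (K : realType) (x : nat -> int) :
  transient_pinfty K x -> transient_ninfty K x -> False.
Proof.
move=> /transient_pinftyP/(_ 1%N)[m hm] /transient_ninftyP/transient_pinftyP/(_ 1%N)[m' hm'].
by have := hm (maxn m m') (leq_maxl _ _); have := hm' (maxn m m') (leq_maxr _ _); lia.
Qed.

(** * At most one transient side *)

Section Dichotomy.
Context {K : realType} {q : K}.
Hypothesis q01 : 0 < q < 1.
Context {d : measure_display} {T : measurableType d}.
Variable P : probability T K.
Variables (w : environment 2 2) (X : nat -> T -> int) (E : seq bool -> set T).
Hypothesis walkE : tree_walk P q w X E.

Let Y (n : nat) (t : T) : int := - X n t.
Let walkY : tree_walk P q (mirror w) Y (E \o map negb) := mirror_tree_walk _ _ _ _ _ walkE.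

Definition recurrent_side (w' : environment 2 2) : Prop :=
  exists N, forall y, N <= y -> mu q (w' y) <= nu q / 2.
Definition transient_side (w' : environment 2 2) : Prop :=
  exists c N, nu q / 2 < mu q c /\ forall y, N <= y -> w' y = c.

Let pinf : set T := [set t | transient_pinfty K (X ^~ t)].

Let limsup (x : nat -> int) : Prop := forall j, exists k, (j <= k)%N /\ j%:Z <= x k.

Lemma not_limsup (x : nat -> int) : ~ limsup x ->
  exists j : nat, forall k, (j <= k)%N -> x k < j%:Z.
Proof.
move=> /existsNP[j hj]; exists j => k jk; rewrite ltNge; apply/negP => h.
by apply: hj; exists k.
Qed.

(** A nearest neighbour path that is not recurrent is eventually positive or eventually negative,
    and each side excludes one of the two. *)
Lemma ae_recurrent : recurrent_side w -> recurrent_side (mirror w) ->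
  {ae P, forall t, recurrent (X ^~ t)}.
Proof.
move=> [N hN] [N' hN']; have hX := not_transient_right q01 P _ _ _ walkE 0 N hN.
have hY := not_transient_right q01 P _ _ _ walkY 0 N' hN'.
have nX : P.-negligible (eventually_in X (fun x => 0 < x)).
  by apply/negligibleP => //; exact: (measurable_eventually_in q01 P _ _ _ walkE).
have nY : P.-negligible (eventually_in Y (fun x => 0 < x)).
  by apply/negligibleP => //; exact: (measurable_eventually_in q01 P _ _ _ walkY).
have nN := nearest_neighbour_null q01 P _ _ _ walkE.
apply: negligibleS (negligibleU nN (negligibleU nX nY)) => t /= nr.
have [h|h] := pselect (exists n, X n.+1 t <> X n t + 1 /\ X n.+1 t <> X n t - 1); first by left.
right; apply: (not_recurrent_sign (X ^~ t)) => // n.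
have [|h1] := pselect (X n.+1 t = X n t + 1); first by left.
have [|h2] := pselect (X n.+1 t = X n t - 1); first by right.
by exfalso; apply: h; exists n.
Qed.

Lemma ae_limsup_transient : transient_side w ->
  P.-negligible [set t | limsup (X ^~ t) /\ ~ transient_pinfty K (X ^~ t)].
Proof.
move=> [c [N [muc wc]]].
have nO : P.-negligible (\bigcup_(b : nat) oscillating X b%:Z).
  apply: negligible_bigcup => b; apply/negligibleP.
    exact: (measurable_oscillating q01 P _ _ _ walkE).
  exact: (oscillating_null q01 P _ _ _ walkE c N wc muc).
apply: negligibleS nO => t [ls nt].
apply: contrapT => h; apply: nt; apply/transient_pinftyP => b.
apply: contrapT => nb; apply: h; exists b => //; split => // m.
apply: contrapT => hm; apply: nb; exists m => k mk; rewrite leNgt; apply/negP => lt.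
by apply: hm; exists k.
Qed.

(** The recurrent left side excludes paths bounded above, since reflected they would stay above a
    level. Hence the upper limit is infinite, and oscillation is excluded by the right side. *)
Lemma ae_transient_pinfty : transient_side w -> recurrent_side (mirror w) ->
  {ae P, forall t, transient_pinfty K (X ^~ t)}.
Proof.
move=> tw [N hN]; have nO := ae_limsup_transient tw.
have nY : P.-negligible (\bigcup_(j : nat) eventually_in Y (fun x => (- j%:Z < x)%R)).
  apply: negligible_bigcup => j; apply/negligibleP.
    exact: (measurable_eventually_in q01 P _ _ _ walkY).
  exact: (not_transient_right q01 P _ _ _ walkY _ N hN).
apply: negligibleS (negligibleU nO nY) => t /= nt.
have [ls|/not_limsup[j hj]] := pselect (limsup (X ^~ t)); first by left.
by right; exists j => //; exists j => k jk; rewrite /Y ltrN2 hj.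
Qed.

Lemma measurable_pinf : measurable pinf.
Proof.
rewrite (_ : pinf = [set t | forall j : nat, exists m, forall k, (m <= k)%N -> j%:Z <= X k t]).
  apply: measurable_forall => j; apply: measurable_exists => m.
  apply: measurable_forall => k; apply: measurable_imply.
  exact: (measurable_pos q01 P _ _ _ walkE (fun x => j%:Z <= x)).
by apply/seteqP; split => t h; [exact: (transient_pinftyP K (X ^~ t)).1 h
  |exact: (transient_pinftyP K (X ^~ t)).2 h].
Qed.
End Dichotomy.

(** * Two transient sides *)

Section TwoSided.
Context {K : realType} {q : K}.
Hypothesis q01 : 0 < q < 1.
Context {d : measure_display} {T : measurableType d}.
Variable P : probability T K.

Lemma tree_ninfE (X : nat -> T -> int) :
  [set t | transient_ninfty K (X ^~ t)] = [set t | transient_pinfty K (fun n => - X n t)].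
Proof. by apply/seteqP; split => t h; [exact: (transient_ninftyP K (X ^~ t)).1 h
  |exact: (transient_ninftyP K (X ^~ t)).2 h]. Qed.

(** A path is unbounded above, unbounded below, or confined to a strip; the first two force
    transience almost surely, the third is null. *)
Lemma two_sided_null w X E : tree_walk P q w X E ->
  @transient_side K q w -> @transient_side K q (mirror w) ->
  P.-negligible [set t | ~ transient_pinfty K (X ^~ t) /\ ~ transient_ninfty K (X ^~ t)].
Proof.
move=> walkE tw tm; have walkY := mirror_tree_walk _ _ _ _ _ walkE.
have n1 := ae_limsup_transient q01 P _ _ _ walkE tw.
have n2 := ae_limsup_transient q01 P _ _ _ walkY tm.
have n3 : P.-negligible (\bigcup_(j : nat) eventually_in X (fun x => (- j%:Z < x < j%:Z)%R)).
  apply: negligible_bigcup => j; apply/negligibleP.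
    exact: (measurable_eventually_in q01 P _ _ _ walkE).
  exact: (bounded_null q01 P _ _ _ walkE).
apply: negligibleS (negligibleU n1 (negligibleU n2 n3)) => t [hp hn].
have [ls|/not_limsup[j hj]] := pselect (forall j, exists k, (j <= k)%N /\ j%:Z <= X k t).
  by left.
have [ls|/not_limsup[i hi]] := pselect (forall j, exists k, (j <= k)%N /\ j%:Z <= - X k t).
  by right; left; split => // /transient_ninftyP.
right; right; exists (maxn i j) => //; exists (maxn i j) => k; rewrite geq_max => /andP[ik jk].
by have := hj k jk; have := hi k ik; lia.
Qed.

(** Staying above a nonnegative level rules out the limit at minus infinity, so by [two_sided_null]
    the event of [escape_positive] lies in transience to plus infinity up to a null set. *)
Lemma escape_gt0 w X E : tree_walk P q w X E ->
  @transient_side K q w -> @transient_side K q (mirror w) ->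
  0 < pr P [set t | transient_pinfty K (X ^~ t)].
Proof.
move=> walkE tw tm; have null := two_sided_null _ _ _ walkE tw tm.
have [c [N [muc wc]]] := tw.
have [b pb b0] := escape_positive q01 P _ _ _ walkE c N wc muc.
have mP := measurable_pinf q01 P _ _ _ walkE.
have mE := measurable_eventually_in q01 P _ _ _ walkE (fun x => b < x).
apply: (lt_le_trans pb); rewrite (pr_split P _ _ mE mP).
rewrite [X in _ + X](_ : _ = 0).
  by rewrite addr0; apply: pr_le; [exact: measurableI|exact: mP|move=> t []].
have mD := measurableD mE mP.
apply: EFin_inj; rewrite -prE//; apply/negligibleP => //.
apply: negligibleS null => t [[m hm] nt]; split => // /transient_ninftyP/transient_pinftyP.
move=> /(_ 0%N)[m' hm'].
by have := hm (maxn m m') (leq_maxl _ _); have := hm' (maxn m m') (leq_maxr _ _); lia.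
Qed.

Lemma two_sided w X E : tree_walk P q w X E ->
  @transient_side K q w -> @transient_side K q (mirror w) ->
  P [set t | transient_pinfty K (X ^~ t)] =
    (1 - P [set t | transient_ninfty K (X ^~ t)])%E /\
  (0 < P [set t | transient_pinfty K (X ^~ t)] < 1)%E.
Proof.
move=> walkE tw tm; have walkY := mirror_tree_walk _ _ _ _ _ walkE.
have null := two_sided_null _ _ _ walkE tw tm.
have mP := measurable_pinf q01 P _ _ _ walkE.
have mN : measurable [set t | transient_ninfty K (X ^~ t)].
  by rewrite tree_ninfE; exact: (measurable_pinf q01 P _ _ _ walkY).
have eqP : P [set t | transient_pinfty K (X ^~ t)] =
    (1 - P [set t | transient_ninfty K (X ^~ t)])%E.
  have mC := measurableC mN.
  rewrite -probability_setC// (prE P _ mC) (prE P _ mP) (pr_split P _ _ mC mP).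
  rewrite setIC (_ : _ `&` _ = [set t | transient_pinfty K (X ^~ t)]); last first.
    apply/seteqP; split => t; first by case.
    by move=> h; split => // h'; exact: pinfty_ninfty_disjoint h h'.
  rewrite [X in _ + X](_ : _ = 0) ?addr0//.
  have mD := measurableD mC mP.
  apply: EFin_inj; rewrite -prE//; apply/negligibleP => //.
  by apply: negligibleS null => t [].
split=> //.
have pp := escape_gt0 _ _ _ walkE tw tm.
have wmm : mirror (mirror w) = w.
  by apply/funext => y; rewrite /mirror opprK; case: (w y).
have pn : 0 < pr P [set t | transient_ninfty K (X ^~ t)].
  rewrite tree_ninfE; apply: (escape_gt0 _ _ _ walkY) => //; rewrite wmm//.
rewrite {1}(prE P _ mP) lte_fin pp /= eqP (prE P _ mN) -EFinB lte_fin.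
by rewrite gtrBl.
Qed.

End TwoSided.

(** * Conclusion *)

Section DriftGap.
Context {K : realType} {q : K}.
Hypothesis q01 : 0 < q < 1.

Lemma drift_gap :
  [/\ nu q / 2 - mu q p0 = (q ^+ 2 + 3 * q - 1) / (q * (1 + q)),
      nu q / 2 - mu q q0 = (1 - q - q ^+ 3) / (q ^+ 2 * (1 + q)),
      mu q p1 <= nu q / 2 & mu q q1 <= nu q / 2].
Proof.
have [qgt0 qlt1] := andP q01.
have q_neq0 : q != 0 by rewrite gt_eqF.
have q1gt0 : 0 < 1 + q by lra.
have q1_neq0 : 1 + q != 0 by rewrite gt_eqF.
have gap1 : nu q / 2 - mu q p1 = (2 - q) / (1 + q).
  rewrite /nu /mu /poisson !cfg_funE /poisson_bar /poisson1 /poisson0; field; apply/andP; split=> //.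
have gap2 : nu q / 2 - mu q q1 = (q ^+ 3 + (1 - q) ^+ 2) / (q ^+ 2 * (1 + q)).
  rewrite /nu /mu /poisson !cfg_funE /poisson_bar /poisson1 /poisson0; field; apply/andP; split=> //.
split.
- by rewrite /nu /mu /poisson !cfg_funE /poisson_bar /poisson1 /poisson0; field; apply/andP; split.
- by rewrite /nu /mu /poisson !cfg_funE /poisson_bar /poisson1 /poisson0; field; apply/andP; split.
- by rewrite -subr_ge0 gap1 divr_ge0//; lra.
- rewrite -subr_ge0 gap2 divr_ge0//.
    by rewrite addr_ge0 ?sqr_ge0// exprn_ge0// ltW.
  by rewrite mulr_ge0 ?sqr_ge0// ltW.
Qed.

Lemma p0_recurrent : 0 <= q ^+ 2 + 3 * q - 1 -> mu q p0 <= nu q / 2.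
Proof.
have [qgt0 qlt1] := andP q01; have [e _ _ _] := drift_gap => le.
by rewrite -subr_ge0 e divr_ge0// mulr_ge0//; lra.
Qed.

Lemma p0_transient : q ^+ 2 + 3 * q - 1 < 0 -> nu q / 2 < mu q p0.
Proof.
have [qgt0 qlt1] := andP q01; have [e _ _ _] := drift_gap => le.
rewrite -subr_lt0 e ltr_pdivrMr ?mul0r// mulr_gt0//; lra.
Qed.

Lemma q0_recurrent : q ^+ 3 + q - 1 <= 0 -> mu q q0 <= nu q / 2.
Proof.
have [qgt0 qlt1] := andP q01; have [_ e _ _] := drift_gap => le.
by rewrite -subr_ge0 e divr_ge0 ?mulr_ge0 ?sqr_ge0//; lra.
Qed.

Lemma q0_transient : 0 < q ^+ 3 + q - 1 -> nu q / 2 < mu q q0.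
Proof.
have [qgt0 qlt1] := andP q01; have [_ e _ _] := drift_gap => le.
rewrite -subr_lt0 e ltr_pdivrMr ?mul0r; first lra.
by rewrite mulr_gt0 ?exprn_gt0//; lra.
Qed.

(** [q1star] is the positive root of this quadratic. *)
Lemma q1starE : (q < q1star K) = (q ^+ 2 + 3 * q - 1 < 0).
Proof.
have [qgt0 qlt1] := andP q01.
rewrite /q1star; set r := Num.sqrt 13.
have r2 : r ^+ 2 = 13 by rewrite sqr_sqrtr.
have r0 : 0 <= r by exact: sqrtr_ge0.
apply/idP/idP => [lt|]; first by nra.
by apply: contraLR; rewrite -!leNgt => le; nra.
Qed.

Lemma q2starE : (q2star K < q) = (0 < q ^+ 3 + q - 1).
Proof.
have [qgt0 qlt1] := andP q01.
have [/andP[z0 z1] ez] := (q2starP (q2star K)).2 erefl.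
set z := q2star K in z0 z1 ez *.
have e : q ^+ 3 + q - 1 = (q - z) * (q ^+ 2 + q * z + z ^+ 2 + 1).
  by rewrite -[LHS]subr0 -ez; ring.
rewrite e pmulr_lgt0 ?subr_gt0//.
by rewrite !addr_gt0 ?exprn_gt0// mulr_gt0.
Qed.

Lemma recurrent_ne_p0 : mu q q0 <= nu q / 2 ->
  forall c : cfg, c <> p0 -> mu q c <= nu q / 2.
Proof. by have [_ _ ? ?] := drift_gap => ?; elim/cfg_ind. Qed.

Lemma recurrent_ne_q0 : mu q p0 <= nu q / 2 ->
  forall c : cfg, c <> q0 -> mu q c <= nu q / 2.
Proof. by have [_ _ ? ?] := drift_gap => ?; elim/cfg_ind. Qed.

End DriftGap.

(** * Hypotheses near infinity under reflection, and the cases with one supercritical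
    configuration *)

Lemma mirrorK : involutive mirror.
Proof.
by move=> w; apply/funext => y; rewrite /mirror opprK; case: (w y).
Qed.

Lemma mirror_cfg_neq (c c' : cfg) : c <> c' -> mirror_cfg c <> mirror_cfg c'.
Proof. by case: c c' => i [] j h //= [e]; apply: h; rewrite e. Qed.

Section Sides.
Context (w : environment 2 2).

Lemma near_mirror (Q : cfg -> Prop) :
  near_ninfty (fun x => Q (mirror_cfg (w x))) -> near_pinfty (fun x => Q (mirror w x)).
Proof. by move=> [N hN]; exists (- N) => y hy; apply: hN; lia. Qed.

Lemma near_pinfty_imply (Q Q' : cfg -> Prop) : (forall c, Q c -> Q' c) ->
  near_pinfty (fun x => Q (w x)) -> near_pinfty (fun x => Q' (w x)).
Proof. by move=> QQ' [N hN]; exists N => y /hN /QQ'. Qed.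

Lemma near_ninfty_imply (Q Q' : cfg -> Prop) : (forall c, Q c -> Q' c) ->
  near_ninfty (fun x => Q (w x)) -> near_ninfty (fun x => Q' (w x)).
Proof. by move=> QQ' [N hN]; exists N => y /hN /QQ'. Qed.

End Sides.

Section Trichotomy.
Context {K : realType} {q : K}.
Hypothesis q01 : 0 < q < 1.
Context {d : measure_display} {T : measurableType d}.
Variables (P : probability T K) (w : environment 2 2).
Variables (X : nat -> T -> int) (E : seq bool -> set T).
Hypothesis walkE : tree_walk P q w X E.

(* [c] is the configuration whose presence on the right makes the walk escape
   to the right; by reflection its mirror image does so on the left. *)
Lemma critical_cases (c : cfg) : nu q / 2 < mu q c ->
  (forall c', c' <> c -> mu q c' <= nu q / 2) ->
  [/\ (near_pinfty (fun x => w x = c) -> near_ninfty (fun x => w x <> mirror_cfg c) ->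
         {ae P, forall t, transient_pinfty K (X ^~ t)}),
      (near_ninfty (fun x => w x = mirror_cfg c) -> near_pinfty (fun x => w x <> c) ->
         {ae P, forall t, transient_ninfty K (X ^~ t)}),
      (near_pinfty (fun x => w x <> c) -> near_ninfty (fun x => w x <> mirror_cfg c) ->
         {ae P, forall t, recurrent (X ^~ t)}) &
      (near_pinfty (fun x => w x = c) -> near_ninfty (fun x => w x = mirror_cfg c) ->
         P [set t | transient_pinfty K (X ^~ t)] =
           (1 - P [set t | transient_ninfty K (X ^~ t)])%E /\
         (0 < P [set t | transient_pinfty K (X ^~ t)] < 1)%E)].
Proof.
move=> muc rec; have walkY := mirror_tree_walk _ _ _ _ _ walkE.
have cK c' : mirror_cfg (mirror_cfg c') = c' by case: c'.
have tr : near_pinfty (fun x => w x = c) -> @transient_side K q w.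
  by move=> [N hN]; exists c, N.
have rr : near_pinfty (fun x => w x <> c) -> @recurrent_side K q w.
  exact: (near_pinfty_imply w (fun c' => c' <> c) (fun c' => mu q c' <= nu q / 2) rec).
have tl : near_ninfty (fun x => w x = mirror_cfg c) -> @transient_side K q (mirror w).
  move=> h; have [N hN] : near_pinfty (fun x => mirror w x = c).
    apply: (near_mirror w (fun c' => c' = c)).
    by apply: (near_ninfty_imply w (fun c' => c' = mirror_cfg c)
      (fun c' => mirror_cfg c' = c)) h => c' ->.
  by exists c, N.
have rl : near_ninfty (fun x => w x <> mirror_cfg c) -> @recurrent_side K q (mirror w).
  move=> h; have := near_mirror w (fun c' => mu q c' <= nu q / 2); apply.
  apply: (near_ninfty_imply w (fun c' => c' <> mirror_cfg c)
    (fun c' => mu q (mirror_cfg c') <= nu q / 2)) h => c' ne.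
  by apply: rec; rewrite -[c]cK; exact: mirror_cfg_neq.
split.
- move=> /tr tw /rl rw; exact: (ae_transient_pinfty q01 P _ _ _ walkE).
- move=> /tl tw /rr rw.
  have : {ae P, forall t, transient_pinfty K (fun n => - X n t)}.
    by apply: (ae_transient_pinfty q01 P _ _ _ walkY) => //; rewrite mirrorK.
  by apply: negligibleS => t nt h; apply: nt; exact/transient_ninftyP.
- move=> /rr rw /rl rw'; exact: (ae_recurrent q01 P _ _ _ walkE).
- move=> /tr tw /tl tw'; exact: (two_sided q01 P _ _ _ walkE).
Qed.

End Trichotomy.

Theorem theorem8 (K : realType) (p q : K) (hq : 0 < q < 1) (hp : p = 1 - q)
    (w : environment 2 2)
    (hw : 1 / 2 < q ->
       (exists c, near_pinfty (fun x => w x = c)) /\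
       (exists c, near_ninfty (fun x => w x = c)))
    (d : measure_display) (T : measurableType d) (P : probability T K)
    (X : nat -> T -> int) (W : nat -> T -> environment 2 2)
    (hX : feedback_walk P p q w X W) :
  alpha p q 2 2 = 1 / 2 /\
  (* (i) *)
  (q < q1star K ->
    [/\ (near_pinfty (fun x => w x = p0) ->
         near_ninfty (fun x => w x <> q0) ->
         {ae P, forall t, transient_pinfty K (X ^~ t)}),
        (near_ninfty (fun x => w x = q0) ->
         near_pinfty (fun x => w x <> p0) ->
         {ae P, forall t, transient_ninfty K (X ^~ t)}),
        (near_pinfty (fun x => w x <> p0) ->
         near_ninfty (fun x => w x <> q0) ->
         {ae P, forall t, recurrent (X ^~ t)}) &
        (near_pinfty (fun x => w x = p0) ->
         near_ninfty (fun x => w x = q0) ->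
         P [set t | transient_pinfty K (X ^~ t)] =
           (1 - P [set t | transient_ninfty K (X ^~ t)])%E /\
         (0 < P [set t | transient_pinfty K (X ^~ t)] < 1)%E)]) /\
  (* (ii) *)
  (q2star K < q ->
    [/\ (near_pinfty (fun x => w x = q0) ->
         near_ninfty (fun x => w x <> p0) ->
         {ae P, forall t, transient_pinfty K (X ^~ t)}),
        (near_ninfty (fun x => w x = p0) ->
         near_pinfty (fun x => w x <> q0) ->
         {ae P, forall t, transient_ninfty K (X ^~ t)}),
        (near_pinfty (fun x => w x <> q0) ->
         near_ninfty (fun x => w x <> p0) ->
         {ae P, forall t, recurrent (X ^~ t)}) &
        (near_pinfty (fun x => w x = q0) ->
         near_ninfty (fun x => w x = p0) ->
         P [set t | transient_pinfty K (X ^~ t)] =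
           (1 - P [set t | transient_ninfty K (X ^~ t)])%E /\
         (0 < P [set t | transient_pinfty K (X ^~ t)] < 1)%E)]) /\
  (* (iii) *)
  (q1star K <= q <= q2star K -> {ae P, forall t, recurrent (X ^~ t)}).
Proof.
have [qgt0 qlt1] := andP hq.
have walkE : tree_walk P q w X (cylinder w X W).
  by apply: tree_walk_of_feedback_walk => //; rewrite -hp.
have [_ _ gp1 gq1] := drift_gap hq.
split; [|split; [|split]].
(* For p = 1 - q and R = L = 2 both brackets in alpha equal A, so alpha = (p + q) / 2. *)
- have q2 : q ^+ 2 < 1 by rewrite expr_lt1// ltW.
  have A0 : 0 < (1 - q) * q ^+ 2 * (1 - q ^+ 2).
    by rewrite !mulr_gt0 ?exprn_gt0// subr_gt0.
  rewrite hp /alpha subKr; set A := (1 - q) * q ^+ 2 * (1 - q ^+ 2) in A0 *.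
  by rewrite -mulrDl subrK -mulr2n; field; rewrite gt_eqF.
- rewrite q1starE// => lt; apply: (critical_cases hq P w X _ walkE p0).
    exact: p0_transient.
  (* q ^ 2 + 3 q < 1 forces q < 1 / 3, hence q ^ 3 + q < 1. *)
  by apply: (recurrent_ne_p0 hq); apply: q0_recurrent => //; nra.
- rewrite q2starE// => lt; apply: (critical_cases hq P w X _ walkE q0).
    exact: q0_transient.
  (* q ^ 3 + q > 1 forces q > 1 / 2, hence q ^ 2 + 3 q > 1. *)
  by apply: (recurrent_ne_q0 hq); apply: p0_recurrent => //; nra.
- move=> /andP[]; rewrite leNgt q1starE// -leNgt => le1.
  rewrite leNgt q2starE// -leNgt => le2.
  have all c : mu q c <= nu q / 2.
    elim/cfg_ind: c => //; [exact: p0_recurrent|exact: q0_recurrent].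
  by apply: (ae_recurrent hq P _ _ _ walkE); exists 0.
Qed.
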